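(* Let $V$ be a potential as in the context (twice continuously differentiable on an open interval containing $1$, $V''>0$, $V'(1)=0$). There exist $\alpha_0=\alpha_0(V)>0$ and a constant $m_0=m_0(V)\in\mathbb R$ such that for every $\alpha\in(0,\alpha_0)$ and every $l\in(1-\alpha/2,1+\alpha/2)$, $$\lim_{\beta\to\infty}\ \sup_{N\ge 5}\ \sup_{m\ge m_0}\ \sup_{x\in A_2}\ \sup_{z\in\mathcal N}\ E_{P_{\beta,m,N}}\big[\,|\hat\omega(x+z)-\hat\omega(x)-lz|^2\,\big]=0 .$$ Here $N$ ranges over integers, $m$ over reals, and $P_{\beta,m,N}$ (which also depends on $\alpha,l,V$) is the Gibbs measure defined in the context.
   Context: Potential. $V$ is a real-valued, twice continuously differentiable function on an open interval containing $1$, with $V''>0$ and $V'(1)=0$. The parameter $\alpha>0$ is always so small that $V$ is defined on $[1-\alpha,1+\alpha]$ (and $\alpha<1$), and $l\in(1-\alpha/2,1+\alpha/2)$. Lattice. Identify $\mathbb C$ with $\mathbb R^2$. Let $\tau=e^{\pi i/3}$, $A_2=\mathbb Z+\tau\mathbb Z$ (triangular lattice), $x\sim y$ iff $|x-y|=1$, and $\mathcal N=\{\tau^j:j\in\mathbb Z\}$ (the six neighbors of $0$). For $N\in\mathbb N$ let $I_N=\{x+\tau^2y:x,y\in\{0,\dots,N-1\}\}$ (representatives of $A_2/NA_2$) and $\Lambda_{lN}=[0,lN)+\tau^2[0,lN)$ (representatives of $\mathbb C/lNA_2$). For $x\in A_2$, $z\in\{1,\tau\}$ let $\Delta_{x,z}=\{x+sz+t\tau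 z:s,t>0,\ s+t<1\}$ (open triangle with corners $x,x+z,x+\tau z$), and $\mathcal T=\{\Delta_{x,z}:x\in A_2,z\in\{1,\tau\}\}$. Configurations. Let $\diamond$ be an extra symbol denoting a hole (defect). $\Omega^*_{l,N}$ is the set of $\omega\in(\mathbb C\cup\{\diamond\})^{A_2}$ such that for all $x,z\in A_2$: $\omega(x+Nz)=\omega(x)+lNz$ if $\omega(x)\ne\diamond$, and $\omega(x+Nz)=\diamond$ if $\omega(x)=\diamond$. Such $\omega$ is determined by its restriction to $I_N$, so $\Omega^*_{l,N}$ is identified with $(\mathbb C\cup\{\diamond\})^{I_N}$. Two configurations $\omega,\omega'$ are identified if there is $z\in A_2$ with $\omega(x)=\omega'(x+Nz)$ for all $x\in A_2$; $\underline\Omega_{l,N}$ is the quotient, identified with a measurable set of representatives in $\Omega^*_{l,N}$, e.g. those $\omega$ with $\omega(x)\in\Lambda_{lN}$ for the lexicographically smallest $x\in I_N$ with $\omega(x)\ne\diamond$ (together with the constant configuration $\diamond$); the choice is irrelevant. For $x\in A_2$ put $\hat\omega(x)=\omega(x)$ if $\omega(x)\neq\diamond$ and $\hat\omega(x)=\frac16\sum_{z\in\mathcal N}\omega(x+z)$ if $\omega(x)=\diamond$ (used for configurations satisfying (Ω2) below, so that the sum makes sense), and extend $\hat\omega$ to a map $\mathbb C\to\mathbb C$ that is affine linear on the closure of every triangle in $\mathcal T$. The set $\Omega_{l,N}$ of allowed configurations consists of all $\omega\in\underline\Omega_{l,N}$ with: (Ω1) $|\omega(x)-\omega(y)|\in(1-\alpha,1+\alpha)$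 for all $x\sim y$ in $A_2$ with $\omega(x)\ne\diamond\ne\omega(y)$; (Ω2) for all $x,y\in A_2$, $\omega(x)=\omega(y)=\diamond$ only if $x=y$ or $|x-y|>2$; (Ω3) $\hat\omega:\mathbb C\to\mathbb C$ is bijective; (Ω4) $\operatorname{Im}\big(\frac{\hat\omega(x+\tau z)-\hat\omega(x)}{\hat\omega(x+z)-\hat\omega(x)}\big)>0$ for all $x\in A_2$, $z\in\mathcal N$. Gibbs measure. For $m\in\mathbb R$ and $\omega\in\Omega_{l,N}$, $$H_{m,N}(\omega)=\tfrac12\sum_{x\in I_N}\sum_{y\in A_2:\,y\sim x}1_{\{\omega(x)\ne\diamond,\ \omega(y)\neq\diamond\}}V(|\omega(x)-\omega(y)|)+m\sum_{x\in I_N}1_{\{\omega(x)=\diamond\}}.$$ Let $\lambda$ be Lebesgue measure on $\mathbb C$; $\mu_N$ is the restriction to $\underline\Omega_{l,N}$ of the product measure $(\lambda+\delta_\diamond)^{I_N}$ on $(\mathbb C\cup\{\diamond\})^{I_N}\cong\Omega^*_{l,N}$. For $\beta>0$, $Z_{\beta,m,N}=\int_{\Omega_{l,N}}e^{-\beta H_{m,N}}\,d\mu_N$ and $P_{\beta,m,N}(d\omega)=Z_{\beta,m,N}^{-1}e^{-\beta H_{m,N}(\omega)}\mu_N(d\omega)$, a probability measure on $\Omega_{l,N}$; $E_{P_{\beta,m,N}}$ is its expectation. *)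

(* Defs.v *)
From HB Require Import structures.
From mathcomp Require Import all_boot all_order all_algebra.
From mathcomp Require Import all_classical all_reals all_analysis.
From mathcomp Require Import complex.
From mathcomp Require Import ring lra zify.

Set Implicit Arguments.
Unset Strict Implicit.
Unset Printing Implicit Defensive.
Import Order.TTheory GRing.Theory Num.Theory numFieldNormedType.Exports.
Import ComplexField.Normc.
Local Open Scope classical_set_scope.
Local Open Scope ring_scope.
Local Open Scope complex_scope.

Definition option_display : measure_display -> measure_display.
Proof. exact. Qed.

Section option_measurable.
Context d (T : measurableType d).

Definition option_measurable : set (set (option T)) :=
  [set A | measurable (Some @^-1` A)].

Let option_measurable0 : option_measurable set0.
Proof. by rewrite /option_measurable/= preimage_set0. Qed.

Let option_measurableC A : option_measurable A -> option_measurable (~` A).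
Proof. by rewrite /option_measurable/= preimage_setC; exact: measurableC. Qed.

Let option_measurable_bigcup (F : (set (option T))^nat) :
  (forall i, option_measurable (F i)) -> option_measurable (\bigcup_i F i).
Proof.
move=> mF; rewrite /option_measurable/= preimage_bigcup.
by apply: bigcup_measurable => i _; exact: mF.
Qed.

HB.instance Definition _ := isMeasurable.Build (option_display d) (option T)
  option_measurable0 option_measurableC option_measurable_bigcup.

Lemma measurable_Some : measurable_fun [set: T] (@Some T).
Proof. by move=> _ A mA; rewrite setTI. Qed.

End option_measurable.


Section hole_measure.
Context d (T : measurableType d) (R : realType).
Variable mu : {sigma_finite_measure set T -> \bar R}.
Local Open Scope ereal_scope.

Definition hole_measure (A : set (option T)) : \bar R :=
  mu (Some @^-1` A) + \d_None A.

Let hole_measure0 : hole_measure set0 = 0.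
Proof. by rewrite /hole_measure preimage_set0 !measure0 adde0. Qed.

Let hole_measure_ge0 A : 0 <= hole_measure A.
Proof. by rewrite adde_ge0. Qed.

Let hole_measure_sigma_additive : semi_sigma_additive hole_measure.
Proof.
move=> F mF tF mUF; rewrite /hole_measure preimage_bigcup.
have -> : (fun n => \sum_(0 <= i < n) (mu (Some @^-1` F i) + \d_None (F i)))
    = (fun n => \sum_(0 <= i < n) mu (Some @^-1` F i)
                + \sum_(0 <= i < n) \d_None (F i)).
  by apply/funext => n; rewrite big_split.
have tSF : trivIset setT (fun n => Some @^-1` F n).
  apply/trivIsetP => i j _ _ ij; rewrite -preimage_setI.
  by move/trivIsetP : tF => /(_ _ _ I I ij) ->; rewrite preimage_set0.
apply: cvgeD.
- by rewrite ge0_adde_def// inE measure_ge0.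
- by apply: measure_semi_sigma_additive => //; rewrite -preimage_bigcup.
- exact: measure_semi_sigma_additive.
Qed.

HB.instance Definition _ := isMeasure.Build _ _ _ hole_measure
  hole_measure0 hole_measure_ge0 hole_measure_sigma_additive.

Let hole_measure_sigma_finite : sigma_finite setT hole_measure.
Proof.
have [F FT Foo] := sigma_finiteT mu.
exists (fun n => [set None] `|` Some @` F n).
  rewrite eqEsubset; split=> // -[t _|_]; last by exists 0%N => //; left.
  have [n _ Fnt] : (\bigcup_n F n) t by rewrite -FT.
  by exists n => //; right; exists t.
move=> n; have [mFn Fnoo] := Foo n.
have FE : Some @^-1` ([set None] `|` Some @` F n) = F n.
  by rewrite eqEsubset; split=> t /=;
    [case=> // -[u Fu [<-]]|move=> Ft; right; exists t].
split; first by rewrite /measurable/= /option_measurable/= FE.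
rewrite /hole_measure FE lte_add_pinfty// diracE.
by case: (_ \in _); rewrite ?ltry.
Qed.

HB.instance Definition _ := Measure_isSigmaFinite.Build _ _ _ hole_measure
  hole_measure_sigma_finite.

End hole_measure.

(** An alias of [m1 \x m2] on which the sigma-finite structure is inferred. *)
Section product_measure.
Context d1 d2 (T1 : measurableType d1) (T2 : measurableType d2) (R : realType).
Variable m1 : {sigma_finite_measure set T1 -> \bar R}.
Variable m2 : {sigma_finite_measure set T2 -> \bar R}.
Local Open Scope ereal_scope.

Definition product_measure : set (T1 * T2) -> \bar R := m1 \x m2.

HB.instance Definition _ := Measure.on product_measure.

Let product_measure_sigma_finite : sigma_finite setT product_measure.
Proof.
have /sigma_finiteP[F [TF ndF Foo]] := sigma_finiteT m1.
have /sigma_finiteP[G [TG ndG Goo]] := sigma_finiteT m2.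
exists (fun n => F n `*` G n).
  rewrite -setXTT TF TG predeqE => -[x y]; split=> [[[n _ Fnx] [k _ Gky]]|].
    exists (maxn n k) => //; split.
    - by have /subsetPset := ndF _ _ (leq_maxl n k); exact.
    - by have /subsetPset := ndG _ _ (leq_maxr n k); exact.
  by move=> [n _ []/= ? ?]; split; exists n.
move=> k; have [? ?] := Foo k; have [? ?] := Goo k.
split; first exact: measurableX.
by rewrite /product_measure product_measure1E// lte_mul_pinfty// ge0_fin_numE.
Qed.

HB.instance Definition _ := Measure_isSigmaFinite.Build _ _ _ product_measure
  product_measure_sigma_finite.

End product_measure.

Definition cons_tuple (T : Type) n (p : T * n.-tuple T) : n.+1.-tuple T :=
  [tuple of p.1 :: p.2].

Section cons_measure.
Context d (T : measurableType d) (R : realType) (n : nat).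
Variable m : {sigma_finite_measure set (T * n.-tuple T)%type -> \bar R}.
Local Open Scope ereal_scope.

Definition cons_measure := pushforward m (@cons_tuple T n).

Let measurable_cons_tuple : measurable_fun setT (@cons_tuple T n).
Proof. by apply: measurable_cons; [exact: measurable_fst|exact: measurable_snd]. Qed.

Let cons_measure0 : cons_measure set0 = 0.
Proof. by rewrite /cons_measure/pushforward preimage_set0 measure0. Qed.

Let cons_measure_ge0 A : 0 <= cons_measure A.
Proof. exact: measure_ge0. Qed.

Let cons_measure_sigma_additive : semi_sigma_additive cons_measure.
Proof. by apply: measure_semi_sigma_additive. Qed.

HB.instance Definition _ := isMeasure.Build _ _ _ cons_measure
  cons_measure0 cons_measure_ge0 cons_measure_sigma_additive.

Let cons_measure_sigma_finite : sigma_finite setT cons_measure.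
Proof.
have [F FT Foo] := sigma_finiteT m.
pose split_tuple (t : n.+1.-tuple T) := (thead t, [tuple of behead t]).
have consK p : split_tuple (cons_tuple p) = p.
  case: p => x t; congr pair => //; exact: val_inj.
have msplit : measurable_fun setT split_tuple.
  by apply/measurable_fun_pair; [exact: measurable_tnth|exact: measurable_behead].
exists (fun k => split_tuple @^-1` F k).
  by rewrite -preimage_bigcup -FT preimage_setT.
move=> k; have [mFk Fkoo] := Foo k; split.
  by rewrite -[X in measurable X]setTI; exact: msplit.
rewrite /cons_measure/pushforward -comp_preimage.
by rewrite (_ : _ @^-1` _ = F k)// /preimage; apply/seteqP; split=> p /=; rewrite consK.
Qed.

HB.instance Definition _ := Measure_isSigmaFinite.Build _ _ _ cons_measure
  cons_measure_sigma_finite.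

End cons_measure.

Section power_measure.
Context d (T : measurableType d) (R : realType).
Variable mu : {sigma_finite_measure set T -> \bar R}.
Local Open Scope ereal_scope.

Fixpoint power_measure n : {sigma_finite_measure set (n.-tuple T) -> \bar R} :=
  match n with
  | 0 => \d_[tuple]
  | k.+1 => @cons_measure _ T R k (product_measure mu (power_measure k))
  end.

Lemma power_measureE n (A : 'I_n -> set T) : (forall i, measurable (A i)) ->
  power_measure n [set t | forall i, A i (tnth t i)] = \prod_(i < n) mu (A i).
Proof.
elim: n A => [|n IH] A mA.
  rewrite big_ord0 /= diracE mem_set// => i; by case: i.
rewrite big_ord_recl -IH// -product_measure1E//.
  rewrite /= /cons_measure/pushforward/product_measure.
  congr ((mu \x power_measure n) _); apply/seteqP; split=> -[x t] /=.
    move=> h; split=> [|i]; first exact: (h ord0).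
    by have := h (lift ord0 i); rewrite /cons_tuple tnthS.
  move=> [Ax At] i; have [->//|[j ->]] : i = ord0 \/ exists j, i = lift ord0 j.
    by case: (unliftP ord0 i) => [j ->|->]; [right; exists j|left].
  by rewrite /cons_tuple tnthS.
have -> : [set t | forall i, A (lift ord0 i) (tnth t i)] =
    \big[setI/setT]_(i < n) ((fun t : n.-tuple T => tnth t i) @^-1` A (lift ord0 i)).
  rewrite -bigcap_seq; apply/seteqP; split=> t /= h i; last first.
    by apply: h; rewrite /= mem_index_enum.
  by move=> _; exact: h.
apply: bigsetI_measurable => i _; rewrite -[X in measurable X]setTI.
by apply: measurable_tnth => //; exact: mA.
Qed.

End power_measure.

(** Points of the triangular lattice Z + tau Z are given by their coordinates
    in the basis (1, tau^2), which also generates it since tau^2 = tau - 1;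
    thus {0, ..., N-1}^2 is the box of representatives modulo N. *)
Definition lattice := (int * int)%type.

(** tau (a + b tau^2) = (a - b) + a tau^2 *)
Definition mul_tau (x : lattice) : lattice := (x.1 - x.2, x.1).

Definition nbrs : seq lattice := [seq iter j mul_tau (1, 0) | j <- iota 0 6].

Section lattice.
Variable R : realType.
Local Notation C := R[i].

Definition tau : C := cos (pi / 3) +i* sin (pi / 3).

Definition emb (x : lattice) : C := x.1%:~R + x.2%:~R * tau ^+ 2.

Definition adj (x y : lattice) : Prop := normc (emb x - emb y) = 1.

Lemma tauE : tau = 2^-1 +i* (Num.sqrt 3 / 2).
Proof.
have s3 : (Num.sqrt 3 : R) ^+ 2 = 3 by rewrite sqr_sqrtr.
have pi0 := @pi_gt0 R.
have cgt0 : 0 < cos (pi / 3 : R) by apply: cos_gt0_pihalf; apply/andP; split; lra.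
have sgt0 : 0 < sin (pi / 3 : R) by apply: sin_gt0_pi; apply/andP; split; lra.
have cs := cos2Dsin2 (pi / 3 : R).
have c3 : cos (pi / 3 + (pi / 3 + pi / 3) : R) = -1.
  by rewrite (_ : _ + _ = pi) ?cospi//; lra.
move: c3; rewrite !cosD sinD.
set c := cos _ in cgt0 cs *; set s := sin _ in sgt0 cs *.
move=> c3.
have ch : c = 2^-1.
  have h : (c + 1) * (2 * c - 1) ^+ 2 = 0.
    have -> : (c + 1) * (2 * c - 1) ^+ 2 = 4 * c ^+ 3 - 3 * c + 1 by ring.
    have : c * (c * c - s * s) - s * (s * c + c * s) = 4 * c ^+ 3 - 3 * c.
      have -> : c * (c * c - s * s) - s * (s * c + c * s) =
        c ^+ 3 - 3 * c * s ^+ 2 by ring.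
      by rewrite (_ : s ^+ 2 = 1 - c ^+ 2); [ring|rewrite -cs; ring].
    by rewrite c3 => <-; ring.
  move/eqP : h; rewrite mulf_eq0 => /orP[/eqP|]; first by lra.
  by rewrite expf_eq0/= => /eqP; lra.
rewrite /tau -/c -/s ch; congr (_ +i* _).
apply/eqP; rewrite -(@eqrXn2 _ 2)// ?(ltW sgt0) ?divr_ge0 ?sqrtr_ge0//.
apply/eqP; rewrite exprMn s3 (_ : s ^+ 2 = 1 - c ^+ 2); last by rewrite -cs; ring.
by rewrite ch; field.
Qed.

Lemma tau_sqr : tau ^+ 2 = tau - 1.
Proof.
have s3 : (Num.sqrt 3 : R) ^+ 2 = 3 by rewrite sqr_sqrtr.
rewrite tauE expr2; apply/eqP; rewrite eq_complex/=; apply/andP; split; apply/eqP.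
  have -> : Num.sqrt 3 / 2 * (Num.sqrt 3 / 2) = Num.sqrt 3 ^+ 2 / 4 :> R by field.
  by rewrite s3; field.
by field.
Qed.

Lemma emb_mul_tau x : emb (mul_tau x) = tau * emb x.
Proof.
case: x => a b; rewrite /emb/mul_tau/= tau_sqr rmorphB/=.
have -> : tau * (a%:~R + b%:~R * (tau - 1)) =
  a%:~R * tau + b%:~R * tau ^+ 2 - b%:~R * tau by ring.
by rewrite tau_sqr; ring.
Qed.

Lemma embD x y : emb (x + y) = emb x + emb y.
Proof. by rewrite /emb/= !rmorphD/=; ring. Qed.


Lemma embN x : emb (- x) = - emb x.
Proof. by rewrite /emb/= !rmorphN/=; ring. Qed.

Lemma normc_emb x :
  normc (emb x) ^+ 2 = (x.1 ^+ 2 - x.1 * x.2 + x.2 ^+ 2)%:~R.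
Proof.
case: x => a b; rewrite /emb tau_sqr tauE.
have s3 : (Num.sqrt 3 : R) ^+ 2 = 3 by rewrite sqr_sqrtr.
have -> : (a%:~R + b%:~R * (2^-1 +i* (Num.sqrt 3 / 2) - 1) : C) =
   (a%:~R - b%:~R / 2) +i* (b%:~R * Num.sqrt 3 / 2).
  apply/eqP; rewrite -(rmorph_int (real_complex R) a) -(rmorph_int (real_complex R) b).
  by rewrite eq_complex/=; apply/andP; split; apply/eqP; field.
rewrite /= sqr_sqrtr; last by rewrite addr_ge0// sqr_ge0.
rewrite !rmorphD/= rmorphN/= rmorphM/= !rmorphXn/=.
have -> : (b%:~R * Num.sqrt 3 / 2) ^+ 2 = b%:~R ^+ 2 * (Num.sqrt 3) ^+ 2 / 4 :> R by field.
by rewrite s3; field.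
Qed.

Lemma normc_ge0 (p : C) : 0 <= normc p.
Proof. by case: p => a b; exact: sqrtr_ge0. Qed.

Lemma adjE x y : adj x y <-> y - x \in nbrs.
Proof.
rewrite /adj.
have -> : emb x - emb y = - emb (y - x) by rewrite embD embN opprB; ring.
rewrite normcN; case: (y - x) => a b.
have nE := normc_emb (a, b); rewrite /= in nE.
have -> : normc (emb (a, b)) = 1 <-> a ^+ 2 - a * b + b ^+ 2 = 1 :> int.
  split=> [h|h].
    by apply: (@intr_inj R); rewrite -nE h expr1n.
  move: nE; rewrite h => /eqP; rewrite sqrp_eq1 ?normc_ge0//; by move/eqP.
split.
  move=> h.
  have b2 : 3 * (b * b) <= 4.
    have : 4 * (a ^+ 2 - a * b + b ^+ 2) = (2 * a - b) ^+ 2 + 3 * (b * b) by ring.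
    by rewrite h; have := sqr_ge0 (2 * a - b); lia.
  have a2 : 3 * (a * a) <= 4.
    have : 4 * (a ^+ 2 - a * b + b ^+ 2) = (2 * b - a) ^+ 2 + 3 * (a * a) by ring.
    by rewrite h; have := sqr_ge0 (2 * b - a); lia.
  have {}a2 : -1 <= a <= 1 by apply/andP; split; nia.
  have {}b2 : -1 <= b <= 1 by apply/andP; split; nia.
  move: h.
  have : a = -1 \/ a = 0 \/ a = 1 by lia.
  have : b = -1 \/ b = 0 \/ b = 1 by lia.
  by move=> [->|[->|->]] [->|[->|->]].
by rewrite /nbrs !inE/= => /or4P[/eqP[-> ->]|/eqP[-> ->]|/eqP[-> ->]
  |/or3P[/eqP[-> ->]|/eqP[-> ->]|/eqP[-> ->]]].
Qed.
End lattice.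

(** [None] is the hole. *)
Definition conf (R : realType) := lattice -> option R[i].

Section interpolation.
Variable R : realType.
Local Notation C := R[i].
Variable omega : conf R.

(** The default 0 is never used under [holes_separated]: a hole has no hole
    among its neighbours. *)
Definition hat_site (x : lattice) : C :=
  if omega x is Some p then p
  else 6^-1 * \sum_(z <- nbrs) odflt 0 (omega (x + z)).

(** The affine interpolation on the closed triangle with corners x, x + z,
    x + tau z, at the point x + s z + t tau z. *)
Definition affine_on (x z : lattice) (s t : R) : C :=
  hat_site x + s%:C * (hat_site (x + z) - hat_site x)
             + t%:C * (hat_site (x + mul_tau z) - hat_site x).

(** A point of C is s + t tau^2 with s, t real. The half of the unit cell at x
    below (resp. above) its diagonal from x to x + tau is the triangle x, x + 1,
    x + tau (resp. x, x + tau, x + tau^2). Lemma [hatP] says that [hat] is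
    affine on every such closed triangle. *)
Definition hat (p : C) : C :=
  let t := complex.Im p / complex.Im (tau R ^+ 2) in
  let s := complex.Re p - t * complex.Re (tau R ^+ 2) in
  let x : lattice := (Num.floor s, Num.floor t) in
  let u := s - (Num.floor s)%:~R in
  let v := t - (Num.floor t)%:~R in
  if v <= u then affine_on x (1, 0) (u - v) v
  else affine_on x (mul_tau (1, 0)) u (v - u).

Let hat_coord (s t : R) : C :=
  let x : lattice := (Num.floor s, Num.floor t) in
  let u := s - (Num.floor s)%:~R in
  let v := t - (Num.floor t)%:~R in
  if v <= u then affine_on x (1, 0) (u - v) v
  else affine_on x (mul_tau (1, 0)) u (v - u).

Let hat_coordE s t : hat (s%:C + t%:C * tau R ^+ 2) = hat_coord s t.
Proof.
have s3 : Num.sqrt 3 != 0 :> R by rewrite lt0r_neq0// sqrtr_gt0.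
have -> : s%:C + t%:C * tau R ^+ 2 = (s - t / 2) +i* (t * (Num.sqrt 3 / 2)).
  rewrite tau_sqr tauE; apply/eqP; rewrite eq_complex/=.
  by apply/andP; split; apply/eqP; field.
rewrite /hat tau_sqr tauE/=.
have -> : t * (Num.sqrt 3 / 2) / (Num.sqrt 3 / 2 - 0) = t by field.
by have -> : s - t / 2 - t * (2^-1 - 1) = s by field.
Qed.

Let hat_coord_cell (x : lattice) u v : 0 <= u <= 1 -> 0 <= v <= 1 ->
  hat_coord (x.1%:~R + u) (x.2%:~R + v) =
  if v <= u then affine_on x (1, 0) (u - v) v
  else affine_on x (mul_tau (1, 0)) u (v - u).
Proof.
have fl (c : int) (w : R) : 0 <= w < 1 -> Num.floor (c%:~R + w) = c.
  by move=> w01; apply: floor_def; rewrite rmorphD/=; lra.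
have fl1 (c : int) : Num.floor (c%:~R + 1 : R) = c + 1.
  by apply: floor_def; rewrite !rmorphD/=; lra.
have subl (c w : R) : c + w - c = w by ring.
have sub1 (c : int) : (c%:~R + 1 - (c + 1)%:~R : R) = 0 by rewrite rmorphD/=; ring.
have pE (c d e f : int) : ((c, d) + (e, f) : lattice) = (c + e, d + f) by [].
case: x => a b /= /andP[u0 u1] /andP[v0 v1]; rewrite /hat_coord/=.
have /orP[/eqP {}u1|{}u1] : (u == 1) || (u < 1) by rewrite -le_eqVlt.
all: have /orP[/eqP {}v1|{}v1] : (v == 1) || (v < 1) by rewrite -le_eqVlt.
- rewrite u1 v1 !fl1 !sub1 !lexx !subrr /affine_on/mul_tau/= !pE rmorph0 rmorph1.
  by rewrite !subr0; ring.
- rewrite u1 fl1 sub1 fl ?v0// subl (ltW v1) subr0.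
  have [v00|vp] := leP v 0.
    have -> : v = 0 by apply/eqP; rewrite eq_le v00 v0.
    by rewrite !subr0 /affine_on/mul_tau/= !pE rmorph0 rmorph1 ?addr0; ring.
  rewrite /affine_on/mul_tau/= !pE rmorph0 rmorphB rmorph1 ?subrr ?subr0 ?addr0.
  by rewrite ?add0r; ring.
- rewrite v1 fl1 sub1 fl ?u0// subl u0 subr0 leNgt u1/=.
  rewrite /affine_on/mul_tau/= !pE rmorph0 rmorphB rmorph1 ?subrr ?subr0 ?addr0.
  by rewrite ?add0r; ring.
- by rewrite !fl ?u0 ?v0// !subl.
Qed.

Lemma hatP x z (s t : R) : z \in [:: (1, 0); mul_tau (1, 0)] ->
  0 <= s -> 0 <= t -> s + t <= 1 ->
  hat (emb R x + s%:C * emb R z + t%:C * emb R (mul_tau z)) = affine_on x z s t.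
Proof.
move=> zP s0 t0 st1; rewrite /emb -!(rmorph_int (real_complex R)).
move: zP; rewrite !inE => /orP[|] /eqP -> /=.
  have -> : (real_complex R x.1%:~R + real_complex R x.2%:~R * tau R ^+ 2
    + s%:C * (real_complex R 1%:~R + real_complex R 0%:~R * tau R ^+ 2)
    + t%:C * (real_complex R (1 - 0)%:~R + real_complex R 1%:~R * tau R ^+ 2))
    = (x.1%:~R + (s + t))%:C + (x.2%:~R + t)%:C * tau R ^+ 2.
    by rewrite subr0 !rmorphD/=; ring.
  rewrite hat_coordE hat_coord_cell; [|apply/andP; split; lra..].
  by rewrite ifT; [rewrite addrK|lra].
have -> : (real_complex R x.1%:~R + real_complex R x.2%:~R * tau R ^+ 2
    + s%:C * (real_complex R (1 - 0)%:~R + real_complex R 1%:~R * tau R ^+ 2)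
    + t%:C * (real_complex R (1 - 0 - 1)%:~R + real_complex R (1 - 0)%:~R * tau R ^+ 2))
    = (x.1%:~R + s)%:C + (x.2%:~R + (s + t))%:C * tau R ^+ 2.
  by rewrite subr0 subrr !rmorphD/=; ring.
rewrite hat_coordE hat_coord_cell; [|apply/andP; split; lra..].
have [ts|ts] := leP (s + t) s; last by rewrite addrAC subrr add0r.
have -> : t = 0 by lra.
by rewrite addr0 subrr /affine_on rmorph0 !mul0r !addr0.
Qed.

Lemma hat_emb x : hat (emb R x) = hat_site x.
Proof.
have := @hatP x (1, 0) 0 0 _ (lexx _) (lexx _).
by rewrite mem_head addr0 ler01 /affine_on rmorph0 !mul0r !addr0; exact.
Qed.

End interpolation.

Section model.
Variables (R : realType) (V : R -> R) (alpha l : R) (N : nat).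
Local Notation C := R[i].

Definition box : seq lattice :=
  [seq (i%:Z, j%:Z) | i <- iota 0 N, j <- iota 0 N].

Definition quasiperiodic (omega : conf R) : Prop :=
  forall x z, omega (x + z *+ N) =
    omap (fun p => p + (l * N%:R)%:C * emb R z) (omega x).

(** The quasiperiodic configuration whose values on [box], in lexicographic
    order, are listed by [w] (see [conf_of_bij]); C is identified with R * R. *)
Definition conf_of (w : (N * N).-tuple (option (R * R))) : conf R := fun x =>
  omap (fun p => (p.1 +i* p.2)
                 + (l * N%:R)%:C * emb R ((x.1 %/ N)%Z, (x.2 %/ N)%Z))
       (nth None w (`|(x.1 %% N)%Z| * N + `|(x.2 %% N)%Z|)%N).

Lemma conf_of_quasiperiodic w : (0 < N)%N -> quasiperiodic (conf_of w).
Proof.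
move=> N0 x z; have Nz : (N : int) != 0 by rewrite -lt0n.
rewrite /conf_of.
have -> : (x + z *+ N).1 = z.1 * N + x.1.
  by rewrite [LHS]raddfD/= raddfMn/= addrC -mulr_natr natz.
have -> : (x + z *+ N).2 = z.2 * N + x.2.
  by rewrite [LHS]raddfD/= raddfMn/= addrC -mulr_natr natz.
rewrite !divzMDl// !modzMDl; case: nth => //= p; congr Some.
have -> : ((z.1 + (x.1 %/ N)%Z, z.2 + (x.2 %/ N)%Z) : lattice) =
  ((x.1 %/ N)%Z, (x.2 %/ N)%Z) + z by case: (z) => z1 z2; congr pair; rewrite addrC.
by rewrite embD; ring.
Qed.

Lemma conf_of_bij omega : (0 < N)%N -> quasiperiodic omega ->
  exists! w, conf_of w = omega.
Proof.
move=> N0 qp; have Nz : (N : int) != 0 by rewrite -lt0n.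
pose site (k : nat) : lattice := ((k %/ N)%N : int, (k %% N)%N : int).
have conf_site w k : (k < N * N)%N ->
    conf_of w (site k) = omap (fun p => p.1 +i* p.2) (nth None w k).
  move=> kN; have kd : (k %/ N < N)%N by rewrite ltn_divLR.
  have km : (k %% N < N)%N by rewrite ltn_mod.
  rewrite /conf_of/site/= !modz_small ?divz_small/= ?ltz_nat//.
  rewrite -divn_eq; case: nth => //= p; congr Some.
  by rewrite /emb/= !mul0r addr0 mulr0 addr0.
pose w0 : (N * N).-tuple (option (R * R)) :=
  [tuple of mkseq (fun k => omap (fun p => (complex.Re p, complex.Im p))
                              (omega (site k))) (N * N)].
exists w0; split; last first.
  move=> w wE; apply: eq_from_tnth => k; rewrite !(tnth_nth None) /w0/=.
  rewrite nth_mkseq// -wE conf_site//.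
  by case: (nth None w k) => //= -[].
apply/funext => x.
pose r : lattice := ((x.1 %% N)%Z, (x.2 %% N)%Z).
pose q : lattice := ((x.1 %/ N)%Z, (x.2 %/ N)%Z).
have xE : x = r + q *+ N.
  apply: injective_projections.
    rewrite [RHS]raddfD/= raddfMn/= addrC -mulr_natr natz.
    exact: divz_eq.
  rewrite [RHS]raddfD/= raddfMn/= addrC -mulr_natr natz.
  exact: divz_eq.
have r1 : (`|r.1| < N)%N.
  by rewrite -ltz_nat abszE ger0_norm ?modz_ge0// ltz_pmod.
have r2 : (`|r.2| < N)%N.
  by rewrite -ltz_nat abszE ger0_norm ?modz_ge0// ltz_pmod.
set k := (`|r.1| * N + `|r.2|)%N.
have kN : (k < N * N)%N by rewrite /k; nia.
have sk : site k = r.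
  rewrite /site /k divnMDl// divn_small// addn0 modnMDl modn_small//.
  by rewrite !abszE !ger0_norm ?modz_ge0//; case: (r).
rewrite {2}xE qp xE (conf_of_quasiperiodic w0 N0) -sk conf_site//.
by rewrite /w0/= nth_mkseq// sk; case: (omega r) => // -[].
Qed.

Definition lex_lt (x y : lattice) : bool :=
  (x.1 < y.1) || (x.1 == y.1) && (x.2 < y.2).

Definition fundamental_domain : set C :=
  [set p | exists s t : R, [/\ 0 <= s < l * N%:R, 0 <= t < l * N%:R
                             & p = s%:C + tau R ^+ 2 * t%:C]].

(** Representatives modulo the translations omega |-> omega (. + N z): the value
    at the first site of [box] which is not a hole is in [fundamental_domain].
    The configuration with holes everywhere is included. *)
Definition representatives : set ((N * N).-tuple (option (R * R))) :=
  [set w | forall x p, x \in box -> conf_of w x = Some p ->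
     (forall y, y \in box -> lex_lt y x -> conf_of w y = None) ->
     fundamental_domain p].

Definition edge_lengths (omega : conf R) : Prop :=
  forall x y p q, adj R x y -> omega x = Some p -> omega y = Some q ->
    1 - alpha < normc (p - q) < 1 + alpha.

Definition holes_separated (omega : conf R) : Prop :=
  forall x y, omega x = None -> omega y = None ->
    x = y \/ 2 < normc (emb R x - emb R y).

Definition hat_bijective (omega : conf R) : Prop := bijective (hat omega).

Definition orientation_preserving (omega : conf R) : Prop :=
  forall x z, z \in nbrs ->
    0 < complex.Im ((hat_site omega (x + mul_tau z) - hat_site omega x)
                    / (hat_site omega (x + z) - hat_site omega x)).

Definition allowed : set ((N * N).-tuple (option (R * R))) :=
  [set w | [/\ representatives w, edge_lengths (conf_of w),
               holes_separated (conf_of w), hat_bijective (conf_of w)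
             & orientation_preserving (conf_of w)]].

Definition pair_energy (a b : option C) : R :=
  match a, b with
  | Some p, Some q => V (normc (p - q))
  | _, _ => 0
  end.

Definition hamiltonian (m : R) (w : (N * N).-tuple (option (R * R))) : R :=
  2^-1 * (\sum_(x <- box) \sum_(z <- nbrs)
            pair_energy (conf_of w x) (conf_of w (x + z)))
  + m * \sum_(x <- box) (conf_of w x == None)%:R.

(** [mu_N] and [gibbs] are plain set functions; the library integral accepts
    those. *)
Definition mu_N (A : set ((N * N).-tuple (option (R * R)))) : \bar R :=
  power_measure
    (hole_measure (product_measure (@lebesgue_measure R) (@lebesgue_measure R)))
    (N * N) (A `&` representatives).

Definition boltzmann (beta m : R) (w : (N * N).-tuple (option (R * R))) : R :=
  expR (- (beta * hamiltonian m w)).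

Definition partition_function (beta m : R) : \bar R :=
  (\int[mu_N]_(w in allowed) (boltzmann beta m w)%:E)%E.

Definition gibbs (beta m : R) (A : set ((N * N).-tuple (option (R * R)))) :
    \bar R :=
  ((partition_function beta m)^-1
   * \int[mu_N]_(w in allowed `&` A) (boltzmann beta m w)%:E)%E.

Definition mean_sq_deviation (beta m : R) (x z : lattice) : \bar R :=
  (\int[gibbs beta m]_w
     (normc (hat_site (conf_of w) (x + z) - hat_site (conf_of w) x
             - l%:C * emb R z) ^+ 2)%:E)%E.

End model.

(** The values of V outside the open interval I are irrelevant. *)
Record potential (R : realType) (I : set R) (V : R -> R) : Prop := {
  potential_open : open I ;
  potential_itv : is_interval I ;
  potential_1 : I 1 ;
  potential_derivable : forall r, I r -> derivable V r 1 ;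
  potential_derivable2 : forall r, I r -> derivable (derive1 V) r 1 ;
  potential_C2 : forall r, I r -> {for r, continuous (derive1 (derive1 V))} ;
  potential_convex : forall r, I r -> 0 < derive1 (derive1 V) r ;
  potential_min : derive1 V 1 = 0
}.

(* Main.v *)
Require Import Defs.
From HB Require Import structures.
From mathcomp Require Import all_boot all_order all_algebra.
From mathcomp Require Import all_classical all_reals all_analysis.
From mathcomp Require Import measurable_realfun complex ring lra zify.

(** The signed area of the triangles is a null Lagrangian: its sum over a period
    does not depend on the configuration. Hence the sum over all triangles of the
    squared conformality defect (the distance from being equilateral) is a
    multiple of the Dirichlet energy of the deviation of the interpolation from
    the scaled lattice, and so is the sum of r^2 - l^2 over all edge lengths r.
    By Heron's formula the conformality defect of a positively oriented triangle
    is bounded by differences of its squared side lengths. As V is uniformly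
    convex and V' is small near 1, the total squared deviation is therefore
    bounded by the energy excess over the scaled lattice; a hole costs a bounded
    amount, which m >= m0 compensates. The allowed configurations have volume at
    most K ^ (N * N) and those close to the scaled lattice have volume at least
    (4 * delta ^ 2) ^ (N * N), so at low temperature the expected energy excess
    per site is small uniformly in N and m. By shift invariance of the Gibbs
    measure the expectation at one site equals the average over all sites. *)

Set Implicit Arguments.
Unset Strict Implicit.
Unset Printing Implicit Defensive.
Import Order.TTheory GRing.Theory Num.Theory numFieldNormedType.Exports.
Import ComplexField.Normc.
Local Open Scope classical_set_scope.
Local Open Scope ring_scope.
Local Open Scope complex_scope.

(** * Periodic sums over the box *)

(** For [l] other than 1 the slope V'(l) need not vanish, and the sum of r - l over the edges is not
    a function of the deviation. The linear term is therefore taken in r^2: with k = V'(l) / (2 l)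
    the terms k (r^2 - l^2) sum to exactly k times the deviation, and |k| <= c / 192 lets half of
    the gain c / 96 from the quadratic terms absorb them. The volume bound has no factor depending
    on the size of the domain for each particle, because the box is traversed along a path of
    neighbours: only the first particle ranges over the whole fundamental domain. A shift does not
    preserve the chosen representatives, so shift invariance compares two fundamental domains of the
    group of translations by l N A_2. This requires measurability of the allowed set, while
    bijectivity of the interpolation involves uncountably many points. As the interpolation is
    Lipschitz and coercive, bijectivity is equivalent to countably many conditions at rational
    points. Near the scaled lattice, bijectivity holds because the interpolation is a small
    Lipschitz perturbation of multiplication by [l]. *)

Section box_sums.
Variable N : nat.
Hypothesis N0 : (0 < N)%N.

(** The order is the lexicographic one in which [conf_of] reads its tuple. Together with [index_of]
    and [cell_of] it forms a division with remainder in the lattice modulo [N]. *)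
Definition site (k : nat) : lattice := ((k %/ N)%N : int, (k %% N)%N : int).

Definition index_of (x : lattice) : nat :=
  (`|(x.1 %% N)%Z| * N + `|(x.2 %% N)%Z|)%N.

Definition cell_of (x : lattice) : lattice := ((x.1 %/ N)%Z, (x.2 %/ N)%Z).

Let Nz : (N : int) != 0. Proof. by rewrite -lt0n. Qed.

Lemma mulrn_lattice (z : lattice) n : z *+ n = (z.1 * n%:Z, z.2 * n%:Z).
Proof.
by apply: injective_projections; rewrite raddfMn/= -mulr_natr natz.
Qed.

Lemma absz_mod_lt (a : int) : (`|(a %% N)%Z| < N)%N.
Proof. by rewrite -ltz_nat abszE ger0_norm ?modz_ge0// ltz_pmod. Qed.

Lemma index_of_lt x : (index_of x < N * N)%N.
Proof.
rewrite /index_of; have := absz_mod_lt x.1; have := absz_mod_lt x.2.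
by move: `|_|%N `|_|%N => a b; nia.
Qed.

Lemma site_index_of x : site (index_of x) = ((x.1 %% N)%Z, (x.2 %% N)%Z).
Proof.
rewrite /site/index_of divnMDl// modnMDl divn_small ?absz_mod_lt//.
by rewrite modn_small ?absz_mod_lt// addn0 !abszE !ger0_norm ?modz_ge0.
Qed.

Lemma index_of_site k : (k < N * N)%N -> index_of (site k) = k.
Proof.
move=> kN; have kd : (k %/ N < N)%N by rewrite ltn_divLR.
have km : (k %% N < N)%N by rewrite ltn_mod.
by rewrite /index_of/site/= !modz_small ?ltz_nat//= -divn_eq.
Qed.

Lemma lattice_divE x : x = site (index_of x) + cell_of x *+ N.
Proof.
rewrite site_index_of mulrn_lattice; apply: injective_projections => /=.
  by rewrite addrC; exact: divz_eq.
by rewrite addrC; exact: divz_eq.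
Qed.

Lemma index_ofDMn x z : index_of (x + z *+ N) = index_of x.
Proof.
by rewrite mulrn_lattice /index_of/= ![_ + _ * _]addrC !modzMDl.
Qed.

Lemma cell_ofDMn x z : cell_of (x + z *+ N) = cell_of x + z.
Proof.
rewrite mulrn_lattice /cell_of/= ![_ + _ * _]addrC !divzMDl//.
by case: z => z1 z2; apply: injective_projections; rewrite /= addrC.
Qed.

Lemma cell_of_site k : (k < N * N)%N -> cell_of (site k) = 0.
Proof.
move=> kN; have kd : (k %/ N < N)%N by rewrite ltn_divLR.
have km : (k %% N < N)%N by rewrite ltn_mod.
by rewrite /cell_of/site/= !divz_small ?ltz_nat.
Qed.

Lemma index_of_shift x y : index_of (site (index_of x) + y) = index_of (x + y).
Proof. by rewrite {2}(lattice_divE x) addrAC index_ofDMn. Qed.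

(** The permutation by which a lattice translation acts on the residues modulo [N]. It reindexes box
    sums here and permutes the coordinates of tuples in [shift_tuple]. *)
Definition shift_index (y : lattice) (k : 'I_(N * N)) : 'I_(N * N) :=
  Ordinal (index_of_lt (site k + y)).

Lemma shift_indexK y : cancel (shift_index y) (shift_index (- y)).
Proof.
by move=> k; apply: val_inj; rewrite /= index_of_shift addrK index_of_site.
Qed.

Lemma shift_index_bij y : bijective (shift_index y).
Proof.
exists (shift_index (- y)); first exact: shift_indexK.
by move=> k; rewrite -{1}(opprK y) shift_indexK.
Qed.

Lemma mem_box x : (x \in box N) = (0 <= x.1 < N%:Z) && (0 <= x.2 < N%:Z).
Proof.
apply/allpairsP/andP => [[[i j] /=]|[/andP[x10 x1N] /andP[x20 x2N]]].
  by rewrite !mem_iota/= !add0n => -[iN jN ->]; rewrite /= !ltz_nat iN jN.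
exists (`|x.1|%N, `|x.2|%N); rewrite !mem_iota/= !add0n -!ltz_nat.
rewrite !abszE !ger0_norm//; split=> //; by case: (x).
Qed.

Lemma mem_box_site k : (k < N * N)%N -> site k \in box N.
Proof.
by move=> kN; rewrite mem_box /site/= !ltz_nat ltn_mod N0 ltn_divLR// kN.
Qed.

Lemma site_box x : x \in box N -> site (index_of x) = x.
Proof.
rewrite mem_box site_index_of => /andP[x1 x2].
by rewrite !modz_small//; case: x {x1 x2}.
Qed.

Lemma perm_box : perm_eq (box N) [seq site k | k <- iota 0 (N * N)].
Proof.
apply: uniq_perm.
- apply: allpairs_uniq; rewrite ?iota_uniq//.
  by move=> [a b] [c d] _ _ /= [-> ->].
- rewrite map_inj_in_uniq ?iota_uniq// => a b; rewrite !mem_iota/= !add0n.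
  by move=> aN bN ab; rewrite -(index_of_site aN) ab index_of_site.
- move=> x; apply/idP/mapP => [xb|[k]].
    by exists (index_of x); rewrite ?mem_iota ?index_of_lt// site_box.
  by rewrite mem_iota/= add0n => kN ->; exact: mem_box_site.
Qed.

Definition box_periodic (T : Type) (F : lattice -> T) :=
  forall x z, F (x + z *+ N) = F x.

Section sums.
Variable M : nmodType.
Implicit Type F : lattice -> M.

Lemma box_sumE F : \sum_(x <- box N) F x = \sum_(k < N * N) F (site k).
Proof.
by rewrite (perm_big _ perm_box)/= big_map -(big_mkord xpredT (F \o site))
  /index_iota subn0.
Qed.

Lemma box_sum_shift F y : box_periodic F ->
  \sum_(x <- box N) F (x + y) = \sum_(x <- box N) F x.
Proof.
move=> pF; rewrite !box_sumE [RHS](reindex (shift_index y))/=; last first.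
  exact/onW_bij/shift_index_bij.
by apply: eq_bigr => k _; rewrite {1}[site k + y]lattice_divE pF.
Qed.

End sums.

Lemma size_box : size (box N) = (N * N)%N.
Proof. by rewrite size_allpairs !size_iota. Qed.

End box_sums.

(** * Dirichlet energy and conformality defects *)

(** The three quadratic forms are locked so that simplification keeps them folded until [planeE]
    expands them into coordinates. *)
HB.lock Definition sqnorm (R : realType) (p : R[i]) : R :=
  complex.Re p ^+ 2 + complex.Im p ^+ 2.

HB.lock Definition scal (R : realType) (p q : R[i]) : R :=
  complex.Re p * complex.Re q + complex.Im p * complex.Im q.

HB.lock Definition cross (R : realType) (p q : R[i]) : R :=
  complex.Re p * complex.Im q - complex.Im p * complex.Re q.

Section plane.
Variable R : realType.
Local Notation C := R[i].
Local Notation Re := complex.Re.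
Local Notation Im := complex.Im.
Implicit Types a b p q : C.

Lemma sqnormE p : sqnorm p = Re p ^+ 2 + Im p ^+ 2.
Proof. by rewrite unlock. Qed.

Lemma scalE p q : scal p q = Re p * Re q + Im p * Im q.
Proof. by rewrite unlock. Qed.

Lemma crossE p q : cross p q = Re p * Im q - Im p * Re q.
Proof. by rewrite unlock. Qed.

Definition planeE := (sqnormE, scalE, crossE).

Lemma normc_sqrt p : normc p = Num.sqrt (sqnorm p).
Proof. by rewrite sqnormE; case: p. Qed.

Lemma sqnorm_ge0 p : 0 <= sqnorm p.
Proof. by rewrite sqnormE addr_ge0// sqr_ge0. Qed.

Lemma normc_sqr p : normc p ^+ 2 = sqnorm p.
Proof. by rewrite normc_sqrt sqr_sqrtr// sqnorm_ge0. Qed.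

Lemma ReD p q : Re (p + q) = Re p + Re q. Proof. by case: p; case: q. Qed.
Lemma ImD p q : Im (p + q) = Im p + Im q. Proof. by case: p; case: q. Qed.
Lemma ReN p : Re (- p) = - Re p. Proof. by case: p. Qed.
Lemma ImN p : Im (- p) = - Im p. Proof. by case: p. Qed.
Lemma ReM p q : Re (p * q) = Re p * Re q - Im p * Im q.
Proof. by case: p; case: q. Qed.
Lemma ImM p q : Im (p * q) = Re p * Im q + Im p * Re q.
Proof. by case: p; case: q. Qed.
Lemma Re_real (r : R) : Re r%:C = r. Proof. by []. Qed.
Lemma Im_real (r : R) : Im r%:C = 0. Proof. by []. Qed.
Lemma Re_tau : Re (tau R) = 2^-1. Proof. by rewrite tauE. Qed.
Lemma Im_tau : Im (tau R) = Num.sqrt 3 / 2. Proof. by rewrite tauE. Qed.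

Definition ReImE := (ReD, ImD, ReN, ImN, ReM, ImM, Re_tau, Im_tau, Re_real, Im_real).

Lemma sqr_sqrt3 : Num.sqrt 3 ^+ 2 = 3 :> R.
Proof. by rewrite sqr_sqrtr. Qed.

Lemma sqnormB p q : sqnorm (p - q) = sqnorm p - 2 * scal p q + sqnorm q.
Proof. by rewrite !planeE !ReImE; ring. Qed.

(** The left side is the conformality defect: it vanishes exactly when 0, a, b are the corners of a
    positively oriented equilateral triangle. As [cross a b] is twice the signed area, the last term
    is the null Lagrangian. *)
Lemma sqnorm_sub_tau a b :
  sqnorm (b - tau R * a) =
  sqnorm a + sqnorm b - scal a b - Num.sqrt 3 * cross a b.
Proof.
have := sqr_sqrt3; rewrite !planeE !ReImE => s3.
set s := Num.sqrt 3 in s3 *.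
have -> : (Re b + - (2^-1 * Re a - s / 2 * Im a)) ^+ 2 +
   (Im b + - (2^-1 * Im a + s / 2 * Re a)) ^+ 2 =
   Re b ^+ 2 + Im b ^+ 2 + (4^-1 + s ^+ 2 / 4) * (Re a ^+ 2 + Im a ^+ 2)
   - (Re a * Re b + Im a * Im b) - s * (Re a * Im b - Im a * Re b) by field.
by rewrite s3; field.
Qed.

Lemma sqnorm_tau : sqnorm (tau R) = 1.
Proof.
by rewrite !planeE Re_tau Im_tau exprMn sqr_sqrt3; field.
Qed.

Lemma sqnormM p q : sqnorm (p * q) = sqnorm p * sqnorm q.
Proof. by rewrite !planeE !ReImE; ring. Qed.

Lemma nbrsE : nbrs = [:: (1, 0); (1, 1); (0, 1); (-1, 0); (-1, -1); (0, -1)]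
  :> seq (int * int).
Proof. by []. Qed.

Lemma mul_tau_nbrs z : (mul_tau z \in nbrs) = (z \in nbrs).
Proof.
rewrite !nbrsE !inE; case: z => a b; rewrite /mul_tau/= !xpair_eqE.
by apply/idP/idP; lia.
Qed.

Lemma nbrsN z : z \in nbrs -> - z \in nbrs.
Proof.
rewrite nbrsE !inE.
by move=> /or4P[/eqP->|/eqP->|/eqP->|/or3P[/eqP->|/eqP->|/eqP->]].
Qed.

Lemma sum_nbrs_mul_tau (M : nmodType) (F : lattice -> M) :
  \sum_(z <- nbrs) F (mul_tau z) = \sum_(z <- nbrs) F z.
Proof.
rewrite nbrsE -(big_map (mul_tau : lattice -> lattice) xpredT F) /=.
by apply: perm_big; rewrite -(perm_rot 5).
Qed.

(** This is tau - 1 = tau^2 in lattice coordinates: the third side of a triangle is again a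
    neighbour vector. *)
Lemma mul_tauBl z : mul_tau z - z = mul_tau (mul_tau z).
Proof. by case: z => a b; apply: injective_projections; rewrite /= //; ring. Qed.

Lemma sqnorm_emb z : z \in nbrs -> sqnorm (emb R z) = 1.
Proof.
rewrite -normc_sqr normc_emb nbrsE !inE.
by move=> /or4P[/eqP->|/eqP->|/eqP->|/or3P[/eqP->|/eqP->|/eqP->]].
Qed.

Lemma embMn z n : emb R (z *+ n) = n%:R%:C * emb R z.
Proof.
elim: n => [|n IH]; first by rewrite mulr0n rmorph0 mul0r /emb/= mul0r addr0.
by rewrite mulrS embD IH -natr1 rmorphD rmorph1; ring.
Qed.

Section box_identities.
Variable N : nat.
Hypothesis N0 : (0 < N)%N.
Variable u : lattice -> C.
Hypothesis pu : box_periodic N u.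

(** Autocorrelations of [u]. By shift invariance of box sums every quadratic sum in the increments
    of [u] reduces to [c], which is even, and [s], which is odd. *)
Let c z := \sum_(x <- box N) scal (u x) (u (x + z)).
Let s z := \sum_(x <- box N) cross (u x) (u (x + z)).

Let sum_scal y z : \sum_(x <- box N) scal (u (x + y)) (u (x + z)) = c (z - y).
Proof.
transitivity (\sum_(x <- box N) scal (u (x + y)) (u (x + y + (z - y)))).
  by apply: eq_bigr => x _; rewrite -addrA subrKC.
apply: (box_sum_shift N0 (F := fun x => scal (u x) (u (x + (z - y)))) y).
by move=> x v; rewrite addrAC !pu.
Qed.

Let sum_cross y z : \sum_(x <- box N) cross (u (x + y)) (u (x + z)) = s (z - y).
Proof.
transitivity (\sum_(x <- box N) cross (u (x + y)) (u (x + y + (z - y)))).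
  by apply: eq_bigr => x _; rewrite -addrA subrKC.
apply: (box_sum_shift N0 (F := fun x => cross (u x) (u (x + (z - y)))) y).
by move=> x v; rewrite addrAC !pu.
Qed.

Let cN z : c (- z) = c z.
Proof.
have := sum_scal z 0; rewrite sub0r => <-; rewrite /c.
by apply: eq_bigr => x _; rewrite addr0 !planeE; ring.
Qed.

Let sN z : s (- z) = - s z.
Proof.
have := sum_cross z 0; rewrite sub0r => <-; rewrite /s -sumrN.
by apply: eq_bigr => x _; rewrite addr0 !planeE; ring.
Qed.

Let sum_sqnorm z : \sum_(x <- box N) sqnorm (u (x + z) - u x) = 2 * c 0 - 2 * c z.
Proof.
transitivity (\sum_(x <- box N) (scal (u (x + z)) (u (x + z))
   - 2 * scal (u x) (u (x + z)) + scal (u (x + 0)) (u (x + 0)))).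
  apply: eq_bigr => x _; rewrite addr0 sqnormB !planeE; ring.
rewrite !big_split/= sumrN -mulr_sumr !sum_scal !subrr -/(c z); ring.
Qed.

Let sum_triangle z :
  \sum_(x <- box N) sqnorm (u (x + mul_tau z) - u x - tau R * (u (x + z) - u x)) =
  3 * c 0 - 2 * c z - c (mul_tau z) - c (mul_tau (mul_tau z)) + c (- z)
  - Num.sqrt 3 * (s (mul_tau (mul_tau z)) - s (- z) - s (mul_tau z)).
Proof.
transitivity (\sum_(x <- box N) (sqnorm (u (x + mul_tau z) - u x)
   + sqnorm (u (x + z) - u x) - scal (u (x + z)) (u (x + mul_tau z))
   + scal (u (x + z)) (u (x + 0)) + scal (u x) (u (x + mul_tau z))
   - scal (u (x + 0)) (u (x + 0))
   - Num.sqrt 3 * (cross (u (x + z)) (u (x + mul_tau z))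
      - cross (u (x + z)) (u (x + 0)) - cross (u x) (u (x + mul_tau z))))).
  apply: eq_bigr => x _; rewrite addr0 sqnorm_sub_tau.
  by rewrite !planeE !ReImE; ring.
rewrite !big_split/= !sumrN -mulr_sumr !big_split/= !sumrN.
rewrite !sum_sqnorm !sum_scal !sum_cross !sub0r oppr0 mul_tauBl.
rewrite -/(c (mul_tau z)) -/(s (mul_tau z)); ring.
Qed.

(* For box_periodic maps the determinant is a null Lagrangian, so that the integral
   of the squared conformality defect is a multiple of the Dirichlet energy. *)
Lemma box_conformal_defect :
  \sum_(x <- box N) \sum_(z <- nbrs)
    sqnorm (u (x + mul_tau z) - u x - tau R * (u (x + z) - u x)) =
  3 / 2 * \sum_(x <- box N) \sum_(z <- nbrs) sqnorm (u (x + z) - u x).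
Proof.
rewrite exchange_big/= [X in _ = _ * X]exchange_big/=.
under eq_bigr do rewrite sum_triangle.
under [in RHS]eq_bigr do rewrite sum_sqnorm.
rewrite nbrsE !big_cons !big_nil/=.
(* Each cross term is summed over all six neighbours, where the odd function [s] sums to zero; this
   is the null Lagrangian property. Both sides become 18 c(0) minus 3 times the sum of [c] over the
   neighbours. *)
rewrite !cN !sN.
by field.
Qed.

(** Expanding the square leaves l^2, since neighbour vectors have norm 1, and a term linear in the
    increment of [u], which telescopes to zero over a period. *)
Lemma box_sqnorm_affine (l : R) :
  \sum_(x <- box N) \sum_(z <- nbrs)
    (sqnorm (u (x + z) - u x + l%:C * emb R z) - l ^+ 2) =
  \sum_(x <- box N) \sum_(z <- nbrs) sqnorm (u (x + z) - u x).
Proof.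
rewrite exchange_big/= [RHS]exchange_big/= big_seq [RHS]big_seq.
apply: eq_bigr => z zn.
have tele g : {morph g : p q / p + q >-> p + q :> R} -> g 0 = 0 ->
    \sum_(x <- box N) g (u (x + z) - u x) = 0.
  move=> gD g0; have gN p : g (- p) = - g p.
    by apply/eqP; rewrite -addr_eq0 -gD addNr g0.
  under eq_bigr do rewrite gD gN.
  rewrite sumrB (box_sum_shift N0 (F := g \o u))/= ?subrr//.
  by move=> x v /=; rewrite pu.
transitivity (\sum_(x <- box N) (sqnorm (u (x + z) - u x)
   + (2 * l) * scal (emb R z) (u (x + z) - u x))).
  apply: eq_bigr => x _; move: (emb R z) (sqnorm_emb zn) => e.
  rewrite !planeE !ReImE => h.
  transitivity (Re (u (x + z) - u x) ^+ 2 + Im (u (x + z) - u x) ^+ 2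
    + (2 * l) * (Re e * Re (u (x + z) - u x)
                 + Im e * Im (u (x + z) - u x))
    + l ^+ 2 * (Re e ^+ 2 + Im e ^+ 2 - 1)); last first.
    by rewrite h; ring.
  by rewrite !ReImE; ring.
rewrite big_split/= -mulr_sumr (tele (fun p => scal (emb R z) p)) ?mulr0 ?addr0//.
- by move=> p q; rewrite !planeE !ReImE; ring.
- by rewrite !planeE /=; ring.
Qed.

End box_identities.
End plane.

(** * Energy excess of allowed configurations *)

Section double_sums.
Variables (R : pzRingType) (I J : Type) (r : seq I) (s : seq J).

Lemma sum2D (F G : I -> J -> R) :
  \sum_(x <- r) \sum_(z <- s) (F x z + G x z) =
  \sum_(x <- r) \sum_(z <- s) F x z + \sum_(x <- r) \sum_(z <- s) G x z.
Proof. by rewrite -big_split; apply: eq_bigr => x _; exact: big_split. Qed.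

Lemma sum2Z a (F : I -> J -> R) :
  \sum_(x <- r) \sum_(z <- s) a * F x z = a * \sum_(x <- r) \sum_(z <- s) F x z.
Proof. by rewrite mulr_sumr; apply: eq_bigr => x _; rewrite mulr_sumr. Qed.

End double_sums.

(** * The conformality defect of a single triangle *)

Section triangle.
Variable R : realType.
Local Notation C := R[i].
Implicit Types a b p q : C.

Lemma normc_dist_triangle q p r :
  normc (p - r) <= normc (p - q) + normc (q - r).
Proof. by rewrite -[in leLHS](subrK q p) -addrA; exact: le_normcD. Qed.

Lemma Im_div p q : p != 0 -> complex.Im (q / p) = cross p q / sqnorm p.
Proof.
case: p => a b; case: q => c d; rewrite eq_complex/= => ab.
rewrite !planeE/=; field.
rewrite paddr_eq0 ?sqr_ge0// !expf_eq0/=.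
by apply: contra ab => /andP[/eqP-> /eqP->]; rewrite !eqxx.
Qed.

Lemma sqnorm_eq0 p : (sqnorm p == 0) = (p == 0).
Proof.
case: p => a b; rewrite sqnormE/= paddr_eq0 ?sqr_ge0// !expf_eq0/=.
by rewrite eq_complex.
Qed.

(** Turns the orientation condition into positivity of a polynomial, the signed area. For [p = 0]
    both sides are false because the inverse of 0 is 0. *)
Lemma Im_div_gt0 p q : (0 < complex.Im (q / p)) = (0 < cross p q).
Proof.
have [->|p0] := eqVneq p 0; first by rewrite invr0 mulr0 !planeE/= !mul0r subrr.
rewrite Im_div// pmulr_lgt0// invr_gt0 lt_neqAle sqnorm_ge0 andbT.
by rewrite eq_sym sqnorm_eq0.
Qed.

(* By Heron's formula the right-hand side is the product of the conformality
   defect with S + 4 sqrt 3 A, where S is the sum of the squared sides and A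
   is the area. *)
Lemma conformal_defect_le a b : 0 < cross a b ->
  sqnorm (b - tau R * a) * (sqnorm a + sqnorm b + sqnorm (b - a)) <=
  (sqnorm a - sqnorm b) ^+ 2 + (sqnorm b - sqnorm (b - a)) ^+ 2
  + (sqnorm (b - a) - sqnorm a) ^+ 2.
Proof.
move=> ab0; have Q0 := sqnorm_ge0 (b - tau R * a).
set S := _ + sqnorm (b - a).
have s30 : 0 <= Num.sqrt 3 :> R by rewrite sqrtr_ge0.
have s3 := sqr_sqrt3 R.
have QE : sqnorm (b - tau R * a) = S / 2 - Num.sqrt 3 * cross a b.
  rewrite /S sqnorm_sub_tau sqnormB.
  have -> : scal b a = scal a b by rewrite !planeE; ring.
  by field.
apply: (@le_trans _ _ (sqnorm (b - tau R * a) * (S + 2 * Num.sqrt 3 * cross a b))).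
  by rewrite ler_wpM2l// lerDl !mulr_ge0// ltW.
rewrite QE le_eqVlt; apply/orP; left; apply/eqP.
have -> : (S / 2 - Num.sqrt 3 * cross a b) * (S + 2 * Num.sqrt 3 * cross a b) =
  S ^+ 2 / 2 - 2 * Num.sqrt 3 ^+ 2 * cross a b ^+ 2 by field.
by rewrite s3 /S !planeE !ReImE; field.
Qed.

(** The constant: r + l < 3 gives (r^2 - l^2)^2 <= 9 (r - l)^2, the three squared differences are at
    most 4 times the sum of the (r^2 - l^2)^2, and the sum of the squared sides is at least 3/4; 4 *
    9 / (3/4) = 48. *)
Lemma conformal_defect_near a b (l : R) : 0 < cross a b ->
  2^-1 < l < 3 / 2 -> 2^-1 < normc a < 3 / 2 -> 2^-1 < normc b < 3 / 2 ->
  2^-1 < normc (b - a) < 3 / 2 ->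
  sqnorm (b - tau R * a) <=
  48 * ((normc a - l) ^+ 2 + (normc b - l) ^+ 2 + (normc (b - a) - l) ^+ 2).
Proof.
move=> /conformal_defect_le; rewrite -!normc_sqr.
move: (normc a) (normc b) (normc (b - a)) (normc (b - tau R * a)) => x y z t H hl hx hy hz.
have sq r : 2^-1 < r < 3 / 2 -> (r ^+ 2 - l ^+ 2) ^+ 2 <= 9 * (r - l) ^+ 2.
  move=> hr; have -> : (r ^+ 2 - l ^+ 2) ^+ 2 = (r + l) ^+ 2 * (r - l) ^+ 2 by ring.
  by rewrite ler_wpM2r ?sqr_ge0//; nra.
have := sq _ hx; have := sq _ hy; have := sq _ hz => qz qy qx.
have S0 : 3 / 4 <= x ^+ 2 + y ^+ 2 + z ^+ 2 by nra.
have t0 : 0 <= t ^+ 2 by rewrite sqr_ge0.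
have {S0}S0 : t ^+ 2 * (3 / 4) <= t ^+ 2 * (x ^+ 2 + y ^+ 2 + z ^+ 2).
  by rewrite ler_wpM2l.
have d u v : (u - v) ^+ 2 <= 2 * (u - l ^+ 2) ^+ 2 + 2 * (v - l ^+ 2) ^+ 2.
  by have := sqr_ge0 (u + v - 2 * l ^+ 2); nra.
have := d (x ^+ 2) (y ^+ 2); have := d (y ^+ 2) (z ^+ 2); have := d (z ^+ 2) (x ^+ 2).
lra.
Qed.

(** Crude substitute for triangles with a corner at a hole, where only the bound of [step_bound] on
    the sides is available. *)
Lemma conformal_defect_bound a b (K : R) : normc a <= K -> normc b <= K ->
  sqnorm (b - tau R * a) <= 4 * K ^+ 2.
Proof.
move=> aK bK; rewrite -normc_sqr.
have tn : normc (tau R) = 1 by rewrite normc_sqrt sqnorm_tau sqrtr1.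
have : normc (b - tau R * a) <= normc b + normc a.
  by rewrite (le_trans (le_normcD _ _))// normcN normcM tn mul1r.
have := normc_ge0 a; have := normc_ge0 b; have := normc_ge0 (b - tau R * a).
move: (normc a) (normc b) (normc (b - tau R * a)) aK bK => x y t xK yK *.
have -> : 4 * K ^+ 2 = (2 * K) ^+ 2 by ring.
by rewrite ler_pXn2r// ?nnegrE; lra.
Qed.

End triangle.

(** * Step bounds, hole costs and energy excess of one configuration *)

Section allowed_configurations.
Variables (R : realType) (alpha l : R) (N : nat).
Local Notation C := R[i].
Variable omega : conf R.
Hypothesis alpha2 : alpha <= 2^-1.
Hypothesis qp : quasiperiodic l N omega.
Hypothesis el : edge_lengths alpha omega.
Hypothesis hs : holes_separated omega.

Local Notation f := (hat_site omega).

Lemma hole_nbr x z : z \in nbrs -> omega x = None -> omega (x + z) <> None.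
Proof.
move=> zn hx hxz; have := hs hx hxz.
have e1 : normc (emb R x - emb R (x + z)) = 1.
  by rewrite embD opprD addrA subrr sub0r normcN normc_sqrt sqnorm_emb// sqrtr1.
rewrite e1; case=> [e|]; last by rewrite ltNge ler1n.
have : z = 0 by apply: (addrI x); rewrite addr0.
by move=> z0; move: zn; rewrite z0.
Qed.

Lemma hat_site_Some x p : omega x = Some p -> f x = p.
Proof. by rewrite /hat_site => ->. Qed.

Lemma hat_site_quasiperiodic x z : f (x + z *+ N) = f x + (l * N%:R)%:C * emb R z.
Proof.
have mean (F G : lattice -> C) c : (forall y, y \in nbrs -> G y = F y + c) ->
    6^-1 * (\sum_(y <- nbrs) G y) = 6^-1 * (\sum_(y <- nbrs) F y) + c.
  move=> GF; rewrite big_seq (eq_bigr _ GF) -big_seq big_split/=.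
  by rewrite nbrsE !big_cons !big_nil/=; field.
rewrite /hat_site qp; case E : (omega x) => [p|] /=; first by [].
apply: mean => y yn; rewrite addrAC qp.
by case E2 : (omega (x + y)) => [q|//]; have := hole_nbr yn E.
Qed.

Lemma edge_bounds x z : z \in nbrs -> omega x <> None -> omega (x + z) <> None ->
  1 - alpha < normc (f (x + z) - f x) < 1 + alpha.
Proof.
move=> zn; case E : (omega x) => [p|//] _; case E2 : (omega (x + z)) => [q|//] _.
rewrite (hat_site_Some E) (hat_site_Some E2) -normcN opprB.
apply: (el (x := x) (y := x + z)) => //.
by apply/adjE; rewrite addrAC subrr add0r.
Qed.

Lemma nbrs_iter z y : z \in nbrs -> y \in nbrs ->
  exists2 k, (k < 6)%N & y = iter k mul_tau z.
Proof.
have : all (fun z => all (fun y => has (fun k => y == iter k mul_tau z) (iota 0 6))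
  nbrs) nbrs by [].
move=> /allP h /h /allP{}h /h /hasP[k]; rewrite mem_iota/= add0n => k6 /eqP ->.
by exists k.
Qed.

Lemma iter_nbrs k z : z \in nbrs -> iter k mul_tau z \in nbrs.
Proof. by move=> zn; elim: k => //= k; rewrite mul_tau_nbrs. Qed.

(** The six neighbours of a hole are occupied and consecutive ones are adjacent, so walking around
    the hexagon takes at most 5 edges, each shorter than 1 + alpha <= 2. *)
Lemma hexagon_diam x z y : z \in nbrs -> y \in nbrs -> omega x = None ->
  normc (f (x + y) - f (x + z)) <= 10.
Proof.
move=> zn yn hx; have [k k6 ->] := nbrs_iter zn yn.
suff : normc (f (x + iter k mul_tau z) - f (x + z)) <= 2 * k%:R.
  move=> /le_trans; apply; rewrite (_ : 10 = 2 * 5%:R) ?ler_pM2l ?ler_nat//.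
  by rewrite -natrM.
elim: k {k6} => [|k IH]; first by rewrite subrr normc0 mulr0.
rewrite (le_trans (normc_dist_triangle (f (x + iter k mul_tau z)) _ _))//.
rewrite -[k.+1%:R]natr1 mulrDr mulr1 addrC lerD//.
have kn := iter_nbrs k zn; have kn' := iter_nbrs k.+1 zn.
have e : x + iter k.+1 mul_tau z =
    x + iter k mul_tau z + mul_tau (mul_tau (iter k mul_tau z)).
  by rewrite -mul_tauBl -addrA subrKC.
have := @edge_bounds (x + iter k mul_tau z) (mul_tau (mul_tau (iter k mul_tau z))).
rewrite -e !mul_tau_nbrs => /(_ kn) h.
have /andP[_] := h (hole_nbr kn hx) (hole_nbr kn' hx).
by move: alpha2; lra.
Qed.

(** The value at a hole is the mean of its six neighbours, so this difference is the mean of six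
    differences across the hexagon. *)
Lemma hole_step x z : z \in nbrs -> omega x = None ->
  normc (f (x + z) - f x) <= 10.
Proof.
move=> zn hx.
have -> : f (x + z) - f x = 6^-1 * \sum_(y <- nbrs) (f (x + z) - f (x + y)).
  rewrite sumrB {2}/hat_site hx.
  have -> : \sum_(y <- nbrs) f (x + y) = \sum_(y <- nbrs) odflt 0 (omega (x + y)).
    rewrite big_seq [RHS]big_seq; apply: eq_bigr => y yn.
    by case E : (omega (x + y)) => [p|]; [exact: hat_site_Some|have := hole_nbr yn hx].
  rewrite [X in _ = _ * (X - _)](_ : _ = 6 * f (x + z)); first by field.
  by rewrite nbrsE !big_cons !big_nil/=; ring.
have n6 : normc (6^-1 : C) = 6^-1.
  by rewrite normcV normcMn normc1.
rewrite normcM n6.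
have : normc (\sum_(y <- nbrs) (f (x + z) - f (x + y))) <=
   \sum_(y <- nbrs) normc (f (x + z) - f (x + y)).
  elim/big_ind2 : _ => //; first by rewrite normc0.
  by move=> p r q s pr qs; rewrite (le_trans (le_normcD _ _))// lerD.
have : \sum_(y <- nbrs) normc (f (x + z) - f (x + y)) <= \sum_(y <- nbrs) 10.
  rewrite big_seq [leRHS]big_seq; apply: ler_sum => y yn; exact: hexagon_diam.
have -> : \sum_(y <- nbrs) (10 : R) = 60 by rewrite nbrsE !big_cons big_nil; ring.
lra.
Qed.

Lemma step_bound x z : z \in nbrs -> normc (f (x + z) - f x) <= 10.
Proof.
move=> zn; case E : (omega x) => [p|]; last exact: hole_step.
case E2 : (omega (x + z)) => [q|].
  have := @edge_bounds x z zn; rewrite E E2 => h.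
  have /andP[_] : 1 - alpha < normc (f (x + z) - f x) < 1 + alpha by exact: h.
  by move: alpha2; lra.
rewrite -normcN opprB -{1}(addrK z x).
by apply: hole_step; [exact: nbrsN|].
Qed.

Definition is_hole x : R := (omega x == None)%:R.

(** The two weights delete the edges at a hole, so that the sum may run over all pairs of a site and
    a direction. *)
Definition edge_defect x z : R :=
  (1 - is_hole x) * (1 - is_hole (x + z)) * (normc (f (x + z) - f x) - l) ^+ 2.

Definition deviation : R :=
  \sum_(x <- box N) \sum_(z <- nbrs) sqnorm (f (x + z) - f x - l%:C * emb R z).

Definition total_defect : R := \sum_(x <- box N) \sum_(z <- nbrs) edge_defect x z.

Definition hole_count : R := \sum_(x <- box N) is_hole x.

Hypothesis N0 : (0 < N)%N.
Hypothesis l2 : 2^-1 < l < 3 / 2.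

Lemma is_hole_ge0 x : 0 <= is_hole x. Proof. exact: ler0n. Qed.

Lemma is_hole_periodic : box_periodic N is_hole.
Proof. by move=> x z; rewrite /is_hole qp; case: (omega x). Qed.

Lemma edge_defect_periodic z : box_periodic N (edge_defect^~ z).
Proof.
move=> x y; rewrite /edge_defect [x + y *+ N + z]addrAC !is_hole_periodic.
by rewrite !hat_site_quasiperiodic opprD addrACA subrr addr0.
Qed.

Lemma edge_defect_ge0 x z : 0 <= edge_defect x z.
Proof.
rewrite /edge_defect /is_hole; case: (_ == _); case: (_ == _);
  by rewrite ?subrr ?mul0r ?mulr0 ?mul0r// subr0 !mul1r sqr_ge0.
Qed.

Lemma hole_count_ge0 : 0 <= hole_count.
Proof. by apply: sumr_ge0 => x _; exact: is_hole_ge0. Qed.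

(** Subtracting the scaled lattice turns the quasiperiodic values into a periodic map, to which the
    box identities apply. *)
Definition displacement (x : lattice) : C := f x - l%:C * emb R x.

Local Notation u := displacement.

Lemma displacementB x z : u (x + z) - u x = f (x + z) - f x - l%:C * emb R z.
Proof. by rewrite /displacement embD; ring. Qed.

Lemma displacement_periodic : box_periodic N u.
Proof.
move=> x z; rewrite /displacement hat_site_quasiperiodic embD.
rewrite embMn.
by rewrite rmorphM; ring.
Qed.

Lemma deviationE : deviation =
  \sum_(x <- box N) \sum_(z <- nbrs) (sqnorm (f (x + z) - f x) - l ^+ 2).
Proof.
rewrite -[LHS](eq_bigr _ (fun x _ => eq_bigr _ (fun z _ => congr1 _ (displacementB x z)))).
rewrite -(box_sqnorm_affine N0 displacement_periodic l).
by apply: eq_bigr => x _; apply: eq_bigr => z _; rewrite displacementB subrK.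
Qed.

Hypothesis op : orientation_preserving omega.

(** The scaled lattice has no conformality defect, so that of the displacement is that of the image
    triangle. The coefficient 48 comes from [conformal_defect_near]; if some corner is a hole, the
    bound 4 * 10^2 = 400 of the crude estimate suffices. *)
Let triangle_bound x z : z \in nbrs ->
  sqnorm (u (x + mul_tau z) - u x - tau R * (u (x + z) - u x)) <=
  48 * (edge_defect x z + edge_defect x (mul_tau z)
        + edge_defect (x + z) (mul_tau (mul_tau z)))
  + 400 * (is_hole x + is_hole (x + z) + is_hole (x + mul_tau z)).
Proof.
move=> zn; have tzn := zn; rewrite -mul_tau_nbrs in tzn.
have ttzn := tzn; rewrite -mul_tau_nbrs in ttzn.
have -> : u (x + mul_tau z) - u x - tau R * (u (x + z) - u x) =
    (f (x + mul_tau z) - f x) - tau R * (f (x + z) - f x).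
  by rewrite !displacementB emb_mul_tau; ring.
have xt : x + z + mul_tau (mul_tau z) = x + mul_tau z.
  by rewrite -mul_tauBl -addrA subrKC.
have fb : f (x + mul_tau z) - f (x + z) = (f (x + mul_tau z) - f x) - (f (x + z) - f x).
  by ring.
have K1 := step_bound x zn; have K2 := step_bound x tzn.
have B := conformal_defect_bound K1 K2.
have e0 := edge_defect_ge0 x z; have e1 := edge_defect_ge0 x (mul_tau z).
have e2 := edge_defect_ge0 (x + z) (mul_tau (mul_tau z)).
have h0 := is_hole_ge0 x; have h1 := is_hole_ge0 (x + z).
have h2 := is_hole_ge0 (x + mul_tau z).
have hB : 1 <= is_hole x + is_hole (x + z) + is_hole (x + mul_tau z) ->
   sqnorm (f (x + mul_tau z) - f x - tau R * (f (x + z) - f x)) <=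
   48 * (edge_defect x z + edge_defect x (mul_tau z) +
      edge_defect (x + z) (mul_tau (mul_tau z))) +
   400 * (is_hole x + is_hole (x + z) + is_hole (x + mul_tau z)) by lra.
case Ex : (omega x) => [p|]; last first.
  by apply: hB; move: h0 h1 h2; rewrite /is_hole Ex eqxx /= mulr1n; lra.
case Exz : (omega (x + z)) => [q|]; last first.
  by apply: hB; move: h0 h1 h2; rewrite /is_hole Exz eqxx /= mulr1n; lra.
case Ext : (omega (x + mul_tau z)) => [r|]; last first.
  by apply: hB; move: h0 h1 h2; rewrite /is_hole Ext eqxx /= mulr1n; lra.
rewrite /edge_defect xt /is_hole Ex Exz Ext/= subr0 !mulr1 !mul1r !addr0 mulr0 addr0 fb.
have bd y w : w \in nbrs -> omega y <> None -> omega (y + w) <> None ->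
    2^-1 < normc (f (y + w) - f y) < 3 / 2.
  by move=> wn hy hyw; have := edge_bounds wn hy hyw; move: alpha2; lra.
rewrite conformal_defect_near//.
- by rewrite -Im_div_gt0; exact: op.
- by apply: bd => //; rewrite ?Ex ?Exz.
- by apply: bd => //; rewrite ?Ex ?Ext.
- by rewrite -fb -xt; apply: bd => //; rewrite ?xt ?Exz ?Ext.
Qed.

Let sum_hole z : \sum_(x <- box N) is_hole (x + z) = hole_count.
Proof. by rewrite (box_sum_shift N0 z is_hole_periodic). Qed.

Let sum_hole_pairs :
  \sum_(x <- box N) \sum_(z <- nbrs) (is_hole x + is_hole (x + z)) = 12 * hole_count.
Proof.
rewrite exchange_big/= (eq_bigr (fun=> 2 * hole_count)).
  by rewrite nbrsE !big_cons big_nil; ring.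
by move=> z _; rewrite big_split/= sum_hole /hole_count; ring.
Qed.

(** Summing [triangle_bound] counts each edge defect three times and each hole 18 times, which gives
    144 and 7200; the factor 3/2 of [box_conformal_defect] is then divided out. *)
Lemma deviation_le : deviation <= 96 * total_defect + 4800 * hole_count.
Proof.
have := box_conformal_defect N0 displacement_periodic.
have -> : \sum_(x <- box N) \sum_(z <- nbrs) sqnorm (u (x + z) - u x) = deviation.
  by apply: eq_bigr => x _; apply: eq_bigr => z _; rewrite displacementB.
move=> D.
suff : 3 / 2 * deviation <= 144 * total_defect + 7200 * hole_count by lra.
rewrite -D.
have e1 : \sum_(x <- box N) \sum_(z <- nbrs) edge_defect x (mul_tau z) = total_defect.
  by apply: eq_bigr => x _; rewrite (sum_nbrs_mul_tau (edge_defect x)).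
have e2 : \sum_(x <- box N) \sum_(z <- nbrs)
    edge_defect (x + z) (mul_tau (mul_tau z)) = total_defect.
  rewrite exchange_big/=.
  under eq_bigr do rewrite (box_sum_shift N0 _ (edge_defect_periodic _)).
  rewrite exchange_big/=; apply: eq_bigr => x _.
  by rewrite (sum_nbrs_mul_tau (edge_defect x \o mul_tau)) (sum_nbrs_mul_tau (edge_defect x)).
have h3 : \sum_(x <- box N) \sum_(z <- nbrs) is_hole (x + mul_tau z) = 6 * hole_count.
  rewrite exchange_big/= (eq_bigr (fun=> hole_count)); last by move=> z _; exact: sum_hole.
  by rewrite nbrsE !big_cons big_nil; ring.
have -> : 144 * total_defect + 7200 * hole_count = \sum_(x <- box N) \sum_(z <- nbrs)
   (48 * (edge_defect x z + edge_defect x (mul_tau z)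
        + edge_defect (x + z) (mul_tau (mul_tau z)))
    + 400 * (is_hole x + is_hole (x + z) + is_hole (x + mul_tau z))).
  rewrite sum2D !sum2Z sum2D sum2D e1 e2 sum2D sum_hole_pairs h3.
  by rewrite -/total_defect; ring.
apply: ler_sum => x _; rewrite big_seq [leRHS]big_seq; apply: ler_sum => z zn.
exact: triangle_bound.
Qed.

Variables (V : R -> R) (k c m : R).
Hypothesis c0 : 0 < c.
Hypothesis kc : `|k| <= c / 192.
Hypothesis HV : forall r : R, 1 - alpha < r < 1 + alpha ->
  V l + k * (r ^+ 2 - l ^+ 2) + c * (r - l) ^+ 2 <= V r.
Hypothesis hm : 50 * c + 12 * `|V l| + 1236 * `|k| <= 2 * m.

(** For two occupied sites this is [HV]. At a hole the pair energy is 0, and the penalty covers the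
    remaining terms because |r^2 - l^2| <= 103 for r <= 10 and l < 3/2. *)
Let pair_bound x z : z \in nbrs ->
  V l + k * (sqnorm (f (x + z) - f x) - l ^+ 2) + c * edge_defect x z
  - (`|V l| + 103 * `|k|) * (is_hole x + is_hole (x + z)) <=
  pair_energy V (omega x) (omega (x + z)).
Proof.
move=> zn; have K := step_bound x zn; rewrite -normc_sqr.
have n0 := normc_ge0 (f (x + z) - f x).
have k0 : 0 <= `|k| by [].
have kb : k * (normc (f (x + z) - f x) ^+ 2 - l ^+ 2) <= 103 * `|k|.
  rewrite (le_trans (ler_norm _))// normrM mulrC ler_wpM2r// ler_norml.
  by move: l2 K n0; move: (normc _) => t *; apply/andP; split; nra.
have vl := ler_norm (V l).
have hB : 1 <= is_hole x + is_hole (x + z) ->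
    edge_defect x z = 0 ->
    V l + k * (normc (f (x + z) - f x) ^+ 2 - l ^+ 2) + c * edge_defect x z
    - (`|V l| + 103 * `|k|) * (is_hole x + is_hole (x + z)) <= 0.
  move=> h1 ->; rewrite mulr0 addr0.
  have : (`|V l| + 103 * `|k|) * 1 <= (`|V l| + 103 * `|k|) * (is_hole x + is_hole (x + z)).
    by rewrite ler_wpM2l// addr_ge0// mulr_ge0.
  lra.
have h0 := is_hole_ge0 x; have h1 := is_hole_ge0 (x + z).
case Ex : (omega x) => [p|]; last first.
  apply: hB; first by move: h0 h1; rewrite /is_hole Ex eqxx /= mulr1n; lra.
  by rewrite /edge_defect/is_hole Ex eqxx mulr1n subrr !mul0r.
case Exz : (omega (x + z)) => [q|] /=; last first.
  apply: hB; first by move: h0 h1; rewrite /is_hole Exz eqxx /= mulr1n; lra.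
  by rewrite /edge_defect/is_hole Exz eqxx mulr1n subrr mulr0 mul0r.
have := @edge_bounds x z zn; rewrite /edge_defect/is_hole Ex Exz/=.
rewrite (hat_site_Some Ex) (hat_site_Some Exz) subr0 !mul1r addr0 mulr0 subr0.
by move=> /(_ ltac:(by []) ltac:(by [])) /HV; rewrite -(normcN (q - p)) opprB.
Qed.

(** By [deviationE] the linear terms sum to k times the deviation. By [deviation_le] the quadratic
    ones are worth c / 96 times the deviation minus 50 c per hole, and |k| <= c / 192 consumes half
    of this gain. Each hole thus costs 50 c + 12 (|V l| + 103 |k|), which [hm] bounds by 2 m. *)
Lemma energy_excess :
  c / 192 * deviation <=
  \sum_(x <- box N) \sum_(z <- nbrs) pair_energy V (omega x) (omega (x + z))
  + 2 * m * hole_count - 6 * (N * N)%:R * V l.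
Proof.
have : \sum_(x <- box N) \sum_(z <- nbrs)
   (V l + k * (sqnorm (f (x + z) - f x) - l ^+ 2) + c * edge_defect x z
  - (`|V l| + 103 * `|k|) * (is_hole x + is_hole (x + z))) <=
  \sum_(x <- box N) \sum_(z <- nbrs) pair_energy V (omega x) (omega (x + z)).
  apply: ler_sum => x _; rewrite big_seq [leRHS]big_seq; apply: ler_sum => z zn.
  exact: pair_bound.
have -> : \sum_(x <- box N) \sum_(z <- nbrs)
   (V l + k * (sqnorm (f (x + z) - f x) - l ^+ 2) + c * edge_defect x z
  - (`|V l| + 103 * `|k|) * (is_hole x + is_hole (x + z))) =
  6 * (N * N)%:R * V l + k * deviation + c * total_defect
  - (`|V l| + 103 * `|k|) * (12 * hole_count).
  rewrite sum2D sum2D sum2D !sum2Z -deviationE -/total_defect.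
  have -> : \sum_(x <- box N) \sum_(z <- nbrs)
      - ((`|V l| + 103 * `|k|) * (is_hole x + is_hole (x + z))) =
      - ((`|V l| + 103 * `|k|) * (12 * hole_count)).
    rewrite -sum_hole_pairs -mulNr -sum2Z.
    by apply: eq_bigr => x _; apply: eq_bigr => z _; rewrite mulNr.
  congr (_ + _ + _ - _).
  rewrite (eq_bigr (fun=> 6 * V l)); last first.
    by move=> x _; rewrite nbrsE !big_cons big_nil; ring.
  by rewrite big_const_seq count_predT size_box iter_addr_0 -mulr_natr; ring.
have D := deviation_le; have d0 : 0 <= deviation.
  by apply: sumr_ge0 => x _; apply: sumr_ge0 => z _; exact: sqnorm_ge0.
have kd : - (c / 192 * deviation) <= k * deviation.
  by rewrite -mulNr ler_wpM2r// lerNl (le_trans _ kc)// -normrN ler_norm.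
have cG : c / 96 * deviation <= c * total_defect + 50 * c * hole_count.
  have := ler_wpM2l (ltW c0) D; lra.
have := ler_wpM2r hole_count_ge0 hm.
lra.
Qed.

End allowed_configurations.

(** * Estimates on the potential *)

Section potential.
Variables (R : realType) (I : set R) (V : R -> R).
Hypothesis hV : potential I V.

Lemma mean_value (f : R -> R) (x y : R) : x < y ->
  (forall r, x <= r <= y -> derivable f r 1) ->
  exists2 r, x < r < y & f y - f x = derive1 f r * (y - x).
Proof.
move=> xy df.
have dr r : r \in `]x, y[ -> is_derive r 1 f (derive1 f r).
  rewrite in_itv/= => /andP[/ltW xr /ltW ry].
  by rewrite derive1E; apply: DeriveDef => //; apply: df; rewrite xr ry.
have cf : {within `[x, y], continuous f}.
  by apply: derivable_within_continuous => r; rewrite in_itv/= => rxy; exact: df.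
by have [r] := MVT xy dr cf; rewrite in_itv/= => h e; exists r.
Qed.

Lemma potential_continuous r : I r -> {for r, continuous V}.
Proof.
move=> Ir; apply/differentiable_continuous/derivable1_diffP.
exact: (potential_derivable hV).
Qed.

Section near_minimum.
Variables (a C : R).
Hypothesis aI : forall r, 1 - a < r < 1 + a -> I r.
Hypothesis aC : forall r, 1 - a < r < 1 + a -> C <= derive1 (derive1 V) r.

Let mono x y : x <= y -> 1 - a < x < 1 + a -> 1 - a < y < 1 + a ->
  C * (y - x) <= derive1 V y - derive1 V x.
Proof.
rewrite le_eqVlt => /predU1P[->|xy] hx hy; first by rewrite !subrr mulr0.
have [|r rxy ->] := mean_value xy (f := derive1 V).
  by move=> r rxy; apply/(potential_derivable2 hV)/aI; lra.
by rewrite ler_wpM2r ?aC//; lra.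
Qed.

(** [phi] is V minus the linear part of its tangent at [l] and the parabola. As V' grows at least at
    rate [C], phi' is nonnegative to the right of [l] and nonpositive to the left, so [phi] is
    minimal at [l]. *)
Lemma potential_taylor r l : 1 - a < r < 1 + a -> 1 - a < l < 1 + a ->
  V l + derive1 V l * (r - l) + C / 2 * (r - l) ^+ 2 <= V r.
Proof.
move=> hr hl.
pose phi t := V t - derive1 V l * t - C / 2 * (t - l) ^+ 2.
have dphi t : 1 - a < t < 1 + a -> is_derive t 1 phi
    (derive1 V t - derive1 V l - C * (t - l)).
  move=> ht; have dV : is_derive t 1 V (derive1 V t).
    by rewrite derive1E; apply/DeriveDef => //; apply/(potential_derivable hV)/aI.
  by rewrite /phi; apply: is_derive_eq; rewrite /GRing.scale/=; field.
have step : phi l <= phi r.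
  case: (ltgtP l r) => [lr|rl|->//].
  - have D t : l <= t <= r -> derivable phi t 1.
      move=> tlr; have ht : 1 - a < t < 1 + a by lra.
      by case: (dphi t ht).
    have [t tlr e] := mean_value lr D.
    rewrite -subr_ge0 e mulr_ge0//; last lra.
    have -> : derive1 phi t = derive1 V t - derive1 V l - C * (t - l).
      by rewrite derive1E; apply: derive_val; apply: dphi; lra.
    have := @mono l t; lra.
  - have D t : r <= t <= l -> derivable phi t 1.
      move=> tlr; have ht : 1 - a < t < 1 + a by lra.
      by case: (dphi t ht).
    have [t tlr e] := mean_value rl D.
    rewrite -subr_le0 e mulr_le0_ge0//; last lra.
    have -> : derive1 phi t = derive1 V t - derive1 V l - C * (t - l).
      by rewrite derive1E; apply: derive_val; apply: dphi; lra.
    have := @mono t l; lra.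
move: step; rewrite /phi subrr expr0n/= mulr0 subr0; lra.
Qed.

Lemma potential_lipschitz K :
  (forall r, 1 - a < r < 1 + a -> `|derive1 V r| <= K) ->
  forall r s, 1 - a < r < 1 + a -> 1 - a < s < 1 + a -> V r - V s <= K * `|r - s|.
Proof.
move=> HK; have K0 r : 1 - a < r < 1 + a -> 0 <= K.
  by move=> /HK; exact: le_trans.
suff main r s : r < s -> 1 - a < r < 1 + a -> 1 - a < s < 1 + a ->
    `|V s - V r| <= K * `|s - r|.
  move=> r s hr hs; case: (ltgtP r s) => [rs|sr|->].
  - by rewrite (le_trans (ler_norm _))// distrC (distrC r) main.
  - by rewrite (le_trans (ler_norm _))// main.
  - by rewrite !subrr normr0 mulr0.
move=> rs hr hs; have [|t trs ->] := mean_value rs (f := V).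
  by move=> t trs; apply/(potential_derivable hV)/aI; lra.
by rewrite normrM ler_wpM2r// HK//; lra.
Qed.

End near_minimum.

Lemma potential_neighbourhood (e : R) : 0 < e ->
  exists a, [/\ 0 < a, a <= 2^-1,
    forall r, 1 - a < r < 1 + a -> I r,
    forall r, 1 - a < r < 1 + a ->
      derive1 (derive1 V) 1 / 2 <= derive1 (derive1 V) r &
    forall r, 1 - a < r < 1 + a -> `|derive1 V r| <= e].
Proof.
move=> e0; have I1 := potential_1 hV.
have c0 := potential_convex hV I1.
have : \forall r \near (1 : R), [/\ I r,
    derive1 (derive1 V) 1 / 2 <= derive1 (derive1 V) r & `|derive1 V r| <= e].
  near=> r; split.
  - by near: r; apply: open_nbhs_nbhs; split => //; exact: potential_open hV.
  - near: r; apply: (cvgr_ge (derive1 (derive1 V) 1)); last by lra.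
    exact: (potential_C2 hV I1).
  - near: r; apply: (cvgr_norm_le 0 (f := derive1 V)); last by rewrite normr0.
    rewrite -(potential_min hV).
    by apply/differentiable_continuous/derivable1_diffP/(potential_derivable2 hV).
move=> /nbhs_ballP[d /= d0 hd]; exists (Num.min d 2^-1).
have hb r : 1 - Num.min d 2^-1 < r < 1 + Num.min d 2^-1 -> ball (1 : R) d r.
  move=> hr; rewrite /ball/= ltr_distlC.
  have : Num.min d 2^-1 <= d by rewrite ge_min lexx.
  by move: hr; move: (Num.min _ _) => t; lra.
split; first by rewrite lt_min d0/=; lra.
- by rewrite ge_min lexx orbT.
- by move=> r /hb/hd[].
- by move=> r /hb/hd[].
- by move=> r /hb/hd[].
Unshelve. all: by end_near. Qed.

(** All constants are uniform in [alpha] and [l]. With k = V'(l) / (2 l) the tangent term V'(l) (r -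
    l) equals k (r^2 - l^2) - k (r - l)^2, and the second part is absorbed by the convexity of V. *)
Lemma potential_estimates : exists alpha0 c M : R, [/\ 0 < alpha0 <= 2^-1, 0 < c &
  forall alpha l, 0 < alpha < alpha0 -> 1 - alpha / 2 < l < 1 + alpha / 2 ->
  [/\ `|V l| <= M,
   (exists2 k, `|k| <= c / 192 & forall r : R, 1 - alpha < r < 1 + alpha ->
     V l + k * (r ^+ 2 - l ^+ 2) + c * (r - l) ^+ 2 <= V r),
   forall r s : R, 1 - alpha < r < 1 + alpha -> 1 - alpha < s < 1 + alpha ->
     V r - V s <= `|r - s| &
   forall r : R, 1 - alpha < r < 1 + alpha -> {for r, continuous V}]].
Proof.
(* Since V'' >= V''(1) / 2 = 8 c near 1, Taylor's formula provides 4 c (r - l)^2, which leaves room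
   for the loss k (r - l)^2. *)
pose c := derive1 (derive1 V) 1 / 16.
have c0 : 0 < c by rewrite /c divr_gt0// (potential_convex hV (potential_1 hV)).
(* The bound 1 on V' gives the Lipschitz constant of V, the bound c / 192 gives that of [k], because
   l > 1/2 implies |k| <= |V'(l)|. *)
have e0 : 0 < Num.min 1 (c / 192) by rewrite lt_min ltr01/= divr_gt0.
have [a [a0 a2 aI aC ae]] := potential_neighbourhood e0.
have ae1 r : 1 - a < r < 1 + a -> `|derive1 V r| <= 1.
  by move=> /ae /le_trans; apply; rewrite ge_min lexx.
have aec r : 1 - a < r < 1 + a -> `|derive1 V r| <= c / 192.
  by move=> /ae /le_trans; apply; rewrite ge_min lexx orbT.
have lip := potential_lipschitz aI ae1.
exists a, c, (`|V 1| + 1); split => //; first by rewrite a0 a2.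
move=> alpha l ha hl; have hla : 1 - a < l < 1 + a by lra.
split.
- have h1 : 1 - a < (1 : R) < 1 + a by lra.
  have := lip l 1 hla h1; have := lip 1 l h1 hla.
  rewrite distrC; have : `|l - 1| <= 1 by rewrite ler_norml; lra.
  have := ler_norm (V 1); have := ler_norm (- V 1); rewrite normrN => *.
  by rewrite ler_norml; lra.
- have l2 : 2^-1 < l by lra.
  have kE : `|derive1 V l / (2 * l)| <= `|derive1 V l|.
    rewrite normrM ler_piMr// ger0_norm ?invr_ge0; last lra.
    by rewrite invf_le1; lra.
  have kb : `|derive1 V l / (2 * l)| <= c / 192 by rewrite (le_trans kE)// aec.
  exists (derive1 V l / (2 * l)) => // r hr.
  have hra : 1 - a < r < 1 + a by lra.
  have := potential_taylor aI aC hra hla.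
  have -> : derive1 V l * (r - l) =
    derive1 V l / (2 * l) * (r ^+ 2 - l ^+ 2) - derive1 V l / (2 * l) * (r - l) ^+ 2.
    field; lra.
  have : derive1 V l / (2 * l) * (r - l) ^+ 2 <= c * (r - l) ^+ 2.
    rewrite ler_wpM2r ?sqr_ge0// (le_trans (ler_norm _))// (le_trans kb)//.
    by move: c0; lra.
  have := sqr_ge0 (r - l).
  have : 0 <= c * (r - l) ^+ 2 by rewrite mulr_ge0 ?sqr_ge0// ltW.
  rewrite (_ : _ / 2 / 2 = 4 * c); last by rewrite /c; field.
  lra.
- move=> r s hr hs; rewrite -[leRHS]mul1r; apply: lip; lra.
- by move=> r hr; apply/potential_continuous/aI; lra.
Qed.

End potential.

(** * Bijectivity of interpolations *)

Section interpolation.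
Variable R : realType.
Local Notation C := R[i].
Implicit Types (g : lattice -> C) (p q : C).

Definition lat_pt (s t : R) : C := s%:C + t%:C * tau R ^+ 2.

(** A lattice map is viewed as a configuration without holes. The interpolation of any configuration
    is thereby one of its site values, and displacements can be interpolated as well. *)
Definition interp g : C -> C := hat (fun x => Some (g x)).

Lemma hat_interp (omega : conf R) : hat omega = interp (hat_site omega).
Proof. by []. Qed.

Lemma lat_ptP p : exists s t, p = lat_pt s t.
Proof.
have s3 : Num.sqrt 3 != 0 :> R by rewrite lt0r_neq0// sqrtr_gt0.
pose t := complex.Im p / (Num.sqrt 3 / 2).
exists (complex.Re p + t / 2), t; rewrite /lat_pt tau_sqr tauE.
case: p @t => a b /=; apply/eqP; rewrite eq_complex/=.
by apply/andP; split; apply/eqP; field.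
Qed.

Lemma sqnorm_lat_pt s t : sqnorm (lat_pt s t) = s ^+ 2 - s * t + t ^+ 2.
Proof.
have s3 := sqr_sqrt3 R.
rewrite /lat_pt tau_sqr tauE sqnormE/=.
have -> : forall a : R, (s + (t * (2^-1 - 1) - 0 * a)) ^+ 2 + (0 + (t * a + 0 * (2^-1 - 1))) ^+ 2
   = (s - t / 2) ^+ 2 + t ^+ 2 * a ^+ 2 by move=> a; field.
by rewrite subr0 exprMn s3; field.
Qed.

Lemma lat_pt_bounds s t :
  `|s| <= 2 * normc (lat_pt s t) /\ `|t| <= 2 * normc (lat_pt s t).
Proof.
have := normc_sqr (lat_pt s t); rewrite sqnorm_lat_pt; have := normc_ge0 (lat_pt s t).
move: (normc _) => r r0 rE.
have aux (a : R) : a ^+ 2 <= 4 * r ^+ 2 -> `|a| <= 2 * r.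
  move=> h; rewrite -(@ler_pXn2r _ 2)// ?nnegrE ?mulr_ge0//.
  by rewrite real_normK ?num_real// exprMn; lra.
by split; apply: aux; rewrite rE; [have := sqr_ge0 (s - 2 * t)|
  have := sqr_ge0 (t - 2 * s)]; have := sqr_ge0 s; have := sqr_ge0 t; lra.
Qed.

Lemma normc_lat_pt s t : normc (lat_pt s t) <= `|s| + `|t|.
Proof.
rewrite -(@ler_pXn2r _ 2)// ?nnegrE ?normc_ge0 ?addr_ge0// normc_sqr sqnorm_lat_pt.
have -> : (`|s| + `|t|) ^+ 2 = s ^+ 2 + 2 * `|s * t| + t ^+ 2.
  by rewrite sqrrD !real_normK ?num_real// normrM mulr_natl.
by have := ler_norm (- (s * t)); have := normr_ge0 (s * t); rewrite normrN; lra.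
Qed.

Lemma lat_ptB s t s' t' : lat_pt s t - lat_pt s' t' = lat_pt (s - s') (t - t').
Proof. by rewrite /lat_pt !rmorphB/=; ring. Qed.

Lemma emb_lat_pt x : emb R x = lat_pt x.1%:~R x.2%:~R.
Proof. by rewrite /lat_pt /emb -!(rmorph_int (real_complex R)). Qed.

Lemma emb10 : emb R (1, 0) = 1. Proof. by rewrite /emb/= mul0r addr0. Qed.

Lemma emb11 : emb R (1, 1) = 1 + tau R ^+ 2.
Proof. by rewrite /emb/= mul1r. Qed.

Lemma emb01 : emb R (0, 1) = tau R ^+ 2.
Proof. by rewrite /emb/= mul1r add0r. Qed.

Lemma interp_lower g x u v : 0 <= v -> v <= u -> u <= 1 ->
  interp g (lat_pt (x.1%:~R + u) (x.2%:~R + v)) =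
  g x + (u - v)%:C * (g (x + (1, 0)) - g x) + v%:C * (g (x + (1, 1)) - g x).
Proof.
move=> v0 vu u1.
have := @hatP _ (fun x => Some (g x)) x (1, 0) (u - v) v (mem_head _ _).
rewrite subr_ge0 vu v0 subrK u1 => /(_ isT isT isT) h.
transitivity (affine_on (fun x => Some (g x)) x (1, 0) (u - v) v); last by [].
rewrite -h; congr hat; have -> : mul_tau (1, 0) = (1, 1) by [].
rewrite emb10 emb11 emb_lat_pt /lat_pt !rmorphD/= rmorphN/=.
by ring.
Qed.

Lemma interp_upper g x u v : 0 <= u -> u <= v -> v <= 1 ->
  interp g (lat_pt (x.1%:~R + u) (x.2%:~R + v)) =
  g x + u%:C * (g (x + (1, 1)) - g x) + (v - u)%:C * (g (x + (0, 1)) - g x).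
Proof.
move=> u0 uv v1.
have m : mul_tau (1, 0) \in [:: (1, 0); mul_tau (1, 0)] by rewrite !inE eqxx orbT.
have := @hatP _ (fun x => Some (g x)) x (mul_tau (1, 0)) u (v - u) m.
rewrite subr_ge0 uv u0 subrKC v1 => /(_ isT isT isT) h.
transitivity (affine_on (fun x => Some (g x)) x (mul_tau (1, 0)) u (v - u)); last by [].
rewrite -h; congr hat.
have -> : mul_tau (mul_tau (1, 0)) = (0, 1) by [].
have -> : mul_tau (1, 0) = (1, 1) by [].
rewrite emb01 emb11 emb_lat_pt /lat_pt !rmorphD/= rmorphN/=.
by ring.
Qed.

Lemma lat_pt_cell s t : exists (x : lattice) (u v : R),
  [/\ 0 <= u <= 1, 0 <= v <= 1 & (s = x.1%:~R + u) /\ (t = x.2%:~R + v)].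
Proof.
exists (Num.floor s, Num.floor t), (s - (Num.floor s)%:~R), (t - (Num.floor t)%:~R).
have := floor_itv s; have := floor_itv t; rewrite !rmorphD/= => ht hs.
by split; [lra|lra|split; ring].
Qed.

(** Interpolation is linear in the site values and reproduces the embedding of the lattice. *)
Lemma interp_affine g p (l : R) :
  interp (fun x => g x - l%:C * emb R x) p = interp g p - l%:C * p.
Proof.
have [s [t ->]] := lat_ptP p.
have [x [u [v [/andP[u0 u1] /andP[v0 v1] [-> ->]]]]] := lat_pt_cell s t.
rewrite [X in _ = _ - _ * X](_ : _ = emb R x + lat_pt u v); last first.
  by rewrite emb_lat_pt /lat_pt !rmorphD/=; ring.
have [vu|/ltW uv] := leP v u.
  by rewrite !interp_lower// !embD emb10 emb11 /lat_pt !rmorphB/=; ring.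
by rewrite !interp_upper// !embD emb01 emb11 /lat_pt !rmorphB/=; ring.
Qed.

(** A segment is cut at the integers it crosses; the induction counts the unit intervals to the
    right of the one that contains its left end. *)
Lemma lipschitz_glue (G : R -> C) (K : R) :
  (forall (n : int) a b, n%:~R <= a -> a <= b -> b <= n%:~R + 1 ->
     normc (G b - G a) <= K * (b - a)) ->
  forall a b, normc (G b - G a) <= K * `|b - a|.
Proof.
move=> H; suff main a b : a <= b -> normc (G b - G a) <= K * (b - a).
  move=> a b; have [ab|/ltW ba] := leP a b; first by rewrite ger0_norm ?subr_ge0// main.
  by rewrite distrC -normcN opprB ger0_norm ?subr_ge0// main.
pose n := Num.floor a; have /andP[na] := floor_itv a; rewrite rmorphD/= => an.
suff chain (m : nat) b' : a <= b' -> b' <= n%:~R + 1 + m%:R ->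
    normc (G b' - G a) <= K * (b' - a).
  move=> ab; apply: (chain (Num.bound (b - n%:~R))) => //.
  have := archi_boundP (x := b - n%:~R) ltac:(lra); lra.
elim: m b' => [|m IH] b' ab' b'm.
  by apply: (H n) => //; move: b'm; rewrite addr0.
have [h|/ltW h] := leP b' (n%:~R + 1 + m%:R); first exact: IH.
apply: (le_trans (normc_dist_triangle (G (n%:~R + 1 + m%:R)) _ _)).
have m0 : 0 <= m%:R :> R by rewrite ler0n.
have -> : b' - a = (b' - (n%:~R + 1 + m%:R)) + (n%:~R + 1 + m%:R - a) by ring.
rewrite mulrDr lerD//; last by apply: IH => //; lra.
move: (H (n + 1 + m%:Z)); rewrite !rmorphD/= -pmulrn; apply => //.
by move: b'm; rewrite -natr1; lra.
Qed.

Section lipschitz.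
Variables (g : lattice -> C) (K : R).
Hypothesis gK : forall x z, z \in nbrs -> normc (g (x + z) - g x) <= K.

Let gK2 x y z : z \in nbrs -> y = x + z -> normc (g y - g x) <= K.
Proof. by move=> zn ->; exact: gK. Qed.

Let scale_bound (r : R) p : 0 <= r -> normc p <= K -> normc (r%:C * p) <= K * r.
Proof.
move=> r0 pK; rewrite normcM mulrC ler_pM ?normc_ge0//.
by rewrite /= expr0n/= addr0 sqrtr_sqr ger0_norm.
Qed.

(** In each of the two triangles of a cell the derivative in this direction is the increment of [g]
    along one edge. A segment inside a cell is cut where it crosses the diagonal. *)
Let interp_lip_s t a b : normc (interp g (lat_pt b t) - interp g (lat_pt a t))
  <= K * `|b - a|.
Proof.
apply: (lipschitz_glue (G := fun s => interp g (lat_pt s t))) => n {}a {}b na ab bn.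
have [x [_ [v [_ /andP[v0 v1] [_ tE]]]]] := lat_pt_cell 0 t.
pose y : lattice := (n, x.2).
have -> : a = y.1%:~R + (a - n%:~R) by rewrite /=; ring.
have -> : b = y.1%:~R + (b - n%:~R) by rewrite /=; ring.
have -> : t = y.2%:~R + v by [].
have -> : y.1%:~R + (b - n%:~R) - (y.1%:~R + (a - n%:~R)) = b - n%:~R - (a - n%:~R).
  by rewrite /=; ring.
have : 0 <= a - n%:~R by lra.
have : a - n%:~R <= b - n%:~R by lra.
have : b - n%:~R <= 1 by lra.
move: (a - _) (b - _) => u u' u'1 uu' u0 {na ab bn}.
have low w w' : v <= w -> w <= w' -> w' <= 1 -> normc (
    interp g (lat_pt (y.1%:~R + w') (y.2%:~R + v)) -
    interp g (lat_pt (y.1%:~R + w) (y.2%:~R + v))) <= K * (w' - w).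
  move=> vw ww' w'1; rewrite !interp_lower//; [|lra..].
  have -> : forall A B D : C, A + (w' - v)%:C * (B - A) + v%:C * (D - A) -
    (A + (w - v)%:C * (B - A) + v%:C * (D - A)) = (w' - w)%:C * (B - A).
    by move=> A B D; rewrite !rmorphB/=; ring.
  by apply: scale_bound; [lra|exact: gK].
have up w w' : 0 <= w -> w <= w' -> w' <= v -> normc (
    interp g (lat_pt (y.1%:~R + w') (y.2%:~R + v)) -
    interp g (lat_pt (y.1%:~R + w) (y.2%:~R + v))) <= K * (w' - w).
  move=> w0 ww' w'1; rewrite !interp_upper//; [|lra..].
  have -> : forall A B D : C, A + w'%:C * (B - A) + (v - w')%:C * (D - A) -
    (A + w%:C * (B - A) + (v - w)%:C * (D - A)) = (w' - w)%:C * (B - D).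
    by move=> A B D; rewrite !rmorphB/=; ring.
  by apply: scale_bound; [lra|apply: (gK2 (z := (1, 0))); rewrite // -addrA].
have [vu|/ltW uv] := leP v u; first exact: low.
have [vu'|/ltW u'v] := leP v u'; last exact: up.
apply: (le_trans (normc_dist_triangle (interp g (lat_pt (y.1%:~R + v) (y.2%:~R + v))) _ _)).
have -> : u' - u = (u' - v) + (v - u) by ring.
by rewrite mulrDr lerD//; [exact: low|exact: up].
Qed.

Let interp_lip_t s a b : normc (interp g (lat_pt s b) - interp g (lat_pt s a))
  <= K * `|b - a|.
Proof.
apply: (lipschitz_glue (G := fun t => interp g (lat_pt s t))) => n {}a {}b na ab bn.
have [x [v [_ [/andP[v0 v1] _ [sE _]]]]] := lat_pt_cell s 0.
pose y : lattice := (x.1, n).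
have -> : a = y.2%:~R + (a - n%:~R) by rewrite /=; ring.
have -> : b = y.2%:~R + (b - n%:~R) by rewrite /=; ring.
have -> : s = y.1%:~R + v by [].
have -> : y.2%:~R + (b - n%:~R) - (y.2%:~R + (a - n%:~R)) = b - n%:~R - (a - n%:~R).
  by rewrite /=; ring.
have : 0 <= a - n%:~R by lra.
have : a - n%:~R <= b - n%:~R by lra.
have : b - n%:~R <= 1 by lra.
move: (a - _) (b - _) => u u' u'1 uu' u0 {na ab bn}.
have up w w' : v <= w -> w <= w' -> w' <= 1 -> normc (
    interp g (lat_pt (y.1%:~R + v) (y.2%:~R + w')) -
    interp g (lat_pt (y.1%:~R + v) (y.2%:~R + w))) <= K * (w' - w).
  move=> vw ww' w'1; rewrite !interp_upper//; [|lra..].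
  have -> : forall A B D : C, A + v%:C * (B - A) + (w' - v)%:C * (D - A) -
    (A + v%:C * (B - A) + (w - v)%:C * (D - A)) = (w' - w)%:C * (D - A).
    by move=> A B D; rewrite !rmorphB/=; ring.
  by apply: scale_bound; [lra|exact: gK].
have low w w' : 0 <= w -> w <= w' -> w' <= v -> normc (
    interp g (lat_pt (y.1%:~R + v) (y.2%:~R + w')) -
    interp g (lat_pt (y.1%:~R + v) (y.2%:~R + w))) <= K * (w' - w).
  move=> w0 ww' w'1; rewrite !interp_lower//; [|lra..].
  have -> : forall A B D : C, A + (v - w')%:C * (D - A) + w'%:C * (B - A) -
    (A + (v - w)%:C * (D - A) + w%:C * (B - A)) = (w' - w)%:C * (B - D).
    by move=> A B D; rewrite !rmorphB/=; ring.
  by apply: scale_bound; [lra|apply: (gK2 (z := (0, 1))); rewrite // -addrA].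
have [vu|/ltW uv] := leP v u; first exact: up.
have [vu'|/ltW u'v] := leP v u'; last exact: low.
apply: (le_trans (normc_dist_triangle (interp g (lat_pt (y.1%:~R + v) (y.2%:~R + v))) _ _)).
have -> : u' - u = (u' - v) + (v - u) by ring.
by rewrite mulrDr lerD//; [exact: up|exact: low].
Qed.

(** The move is split along the two lattice directions, each costing [K] per unit; a lattice
    coordinate is at most twice the norm, hence the 4. *)
Lemma interp_lipschitz p q : normc (interp g p - interp g q) <= 4 * K * normc (p - q).
Proof.
have [s [t ->]] := lat_ptP p; have [s' [t' ->]] := lat_ptP q.
rewrite lat_ptB.
have [] := lat_pt_bounds (s - s') (t - t').
move: (normc (lat_pt _ _)) => r h1 h2.
apply: (le_trans (normc_dist_triangle (interp g (lat_pt s t')) _ _)).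
have A := interp_lip_s t' s' s; have B := interp_lip_t s t' t.
have K0 : 0 <= K by apply: le_trans (gK (0, 0) (z := (1, 0)) _); rewrite ?normc_ge0.
have := ler_wpM2l K0 h1; have := ler_wpM2l K0 h2; lra.
Qed.

End lipschitz.
End interpolation.

(** * Bijectivity of Lipschitz maps of the plane *)

Section bijectivity.
Variable R : realType.
Local Notation C := R[i].
Implicit Types p q : C.

Lemma lipschitz_continuous_real (T : normedModType R) (phi : T -> R) (L : R) :
  (forall a b, `|phi a - phi b| <= L * `|a - b|) -> continuous phi.
Proof.
move=> lip a; apply/cvgrPdist_lt => e e0.
have L1 : 0 < `|L| + 1 by rewrite ltr_pwDr.
near=> b; have ab : `|a - b| < e / (`|L| + 1).
  by near: b; apply: cvgr_dist_lt; rewrite ?divr_gt0.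
rewrite (le_lt_trans (lip _ _))//.
apply: (@le_lt_trans _ _ ((`|L| + 1) * `|a - b|)).
  by rewrite ler_wpM2r// (le_trans (ler_norm _))// lerDl.
by rewrite mulrC -ltr_pdivlMr.
Unshelve. all: by end_near. Qed.

Lemma normc_dist_le p q : `|normc p - normc q| <= normc (p - q).
Proof.
rewrite ler_norml; have := le_normcD (p - q) q; have := le_normcD (q - p) p.
by rewrite !subrK -(normcN (q - p)) opprB; lra.
Qed.

Lemma le_normc_Re p : `|complex.Re p| <= normc p.
Proof.
rewrite -(@ler_pXn2r _ 2)// ?nnegrE ?normc_ge0// normc_sqr sqnormE.
by rewrite real_normK ?num_real// lerDl sqr_ge0.
Qed.

Lemma le_normc_Im p : `|complex.Im p| <= normc p.
Proof.
rewrite -(@ler_pXn2r _ 2)// ?nnegrE ?normc_ge0// normc_sqr sqnormE.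
by rewrite real_normK ?num_real// lerDr sqr_ge0.
Qed.

Lemma le_norm_fst (T U : normedModType R) (a : T * U) : `|a.1| <= `|a|.
Proof. by rewrite [leRHS]/Num.norm/= le_max lexx. Qed.

Lemma le_norm_snd (T U : normedModType R) (a : T * U) : `|a.2| <= `|a|.
Proof. by rewrite [leRHS]/Num.norm/= le_max lexx orbT. Qed.

(** Lattice coordinates move compactness arguments to [R * R], where squares are compact and the
    extreme value theorem applies. *)
Definition pt (a : R * R) : C := lat_pt a.1 a.2.

Lemma normc_ptB (a b : R * R) : normc (pt a - pt b) <= 2 * `|a - b|.
Proof.
rewrite /pt lat_ptB (le_trans (normc_lat_pt _ _))// mulr2n mulrDl mul1r.
by rewrite lerD ?(le_norm_fst (a - b)) ?(le_norm_snd (a - b)).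
Qed.

Lemma pt_inj : injective pt.
Proof.
case=> s t [s' t'] e; have := lat_pt_bounds (s - s') (t - t').
rewrite -lat_ptB [lat_pt s t]e subrr normc0 mulr0 !normr_le0 !subr_eq0.
by move=> [/eqP-> /eqP->].
Qed.

Definition square (M : R) : set (R * R) := `[- M, M] `*` `[- M, M].

Lemma square_compact M : compact (square M).
Proof. by apply: compact_setX; exact: segment_compact. Qed.

Lemma squareP M a : square M a <-> `|a.1| <= M /\ `|a.2| <= M.
Proof. by rewrite /square/= !in_itv/= -!ler_norml. Qed.

Lemma ptP p : exists2 a, p = pt a & `|a.1| <= 2 * normc p /\ `|a.2| <= 2 * normc p.
Proof.
by have [s [t ->]] := lat_ptP p; exists (s, t) => //; exact: lat_pt_bounds.
Qed.

Lemma rat_approx (s e : R) : 0 < e -> exists a : rat, `|s - ratr a| < e.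
Proof.
move=> e0; have [|a] := @rat_in_itvoo R (s - e) (s + e); first by lra.
by rewrite in_itv/= => h; exists a; rewrite ltr_norml; lra.
Qed.

Definition rat_pt (a : rat * rat) : C := pt (ratr a.1, ratr a.2).

Lemma rat_pt_approx (s : R * R) e : 0 < e -> exists a : rat * rat,
  [/\ `|s.1 - ratr a.1| < e, `|s.2 - ratr a.2| < e & normc (pt s - rat_pt a) < 2 * e].
Proof.
move=> e0; have [a ha] := rat_approx s.1 e0; have [b hb] := rat_approx s.2 e0.
exists (a, b); split => //; rewrite /rat_pt (le_lt_trans (normc_ptB _ _))//.
by rewrite ltr_pM2l// [ltLHS]/Num.norm/= gt_max/= ha hb.
Qed.

Section lipschitz.
Variables (F : C -> C) (L : R).
Hypothesis L0 : 0 < L.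
Hypothesis lipF : forall p q, normc (F p - F q) <= L * normc (p - q).

(** The pairs in the square at distance at least 1 / (n + 1) form a compact set, on which the
    continuous image distance attains a minimum; injectivity makes it positive. *)
Lemma injective_gap (n : nat) : injective F -> exists k : nat,
  forall a b : R * R, square n.+1%:R a -> square n.+1%:R b -> n.+1%:R^-1 <= `|a - b| ->
    k.+1%:R^-1 < normc (F (pt a) - F (pt b)).
Proof.
move=> injF; pose A : set ((R * R) * (R * R)) :=
  (square n.+1%:R `*` square n.+1%:R) `&` [set ab | n.+1%:R^-1 <= `|ab.1 - ab.2|].
pose phi (ab : (R * R) * (R * R)) := normc (F (pt ab.1) - F (pt ab.2)).
have [[ab0 Aab0]|A0] := pselect (A !=set0); last first.
  by exists 0 => a b ha hb hab; exfalso; apply: A0; exists (a, b).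
have cphi : continuous phi.
  apply: (lipschitz_continuous_real (L := 4 * L)) => x y.
  rewrite /phi (le_trans (normc_dist_le _ _))//.
  have -> : F (pt x.1) - F (pt x.2) - (F (pt y.1) - F (pt y.2)) =
    (F (pt x.1) - F (pt y.1)) - (F (pt x.2) - F (pt y.2)) by ring.
  rewrite (le_trans (le_normcD _ _))// normcN.
  have h1 := ler_wpM2l (ltW L0) (normc_ptB x.1 y.1).
  have h2 := ler_wpM2l (ltW L0) (normc_ptB x.2 y.2).
  have h3 := ler_wpM2l (ltW L0) (le_norm_fst (x - y)).
  have h4 := ler_wpM2l (ltW L0) (le_norm_snd (x - y)).
  have h5 := lipF (pt x.1) (pt y.1); have h6 := lipF (pt x.2) (pt y.2).
  rewrite /= in h3 h4; lra.
have cA : compact A.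
  have cS : compact (square n.+1%:R `*` square n.+1%:R).
    by apply: compact_setX; exact: square_compact.
  apply: (subclosed_compact _ cS); last exact: subIsetl.
  apply: closedI; first exact: (compact_closed _ cS).
  rewrite (_ : [set _ | _] = (fun ab : (R * R) * (R * R) => `|ab.1 - ab.2|) @^-1`
    [set r | n.+1%:R^-1 <= r])//.
  apply: closed_comp; last exact: closed_ge.
  move=> x _; apply: (lipschitz_continuous_real (L := 2)) => a b.
  rewrite (le_trans (ler_dist_dist _ _))//.
  have -> : a.1 - a.2 - (b.1 - b.2) = (a - b).1 - (a - b).2.
    by rewrite /= opprB addrACA [- a.2 + _]addrC -opprB; ring.
  rewrite (le_trans (ler_normB _ _))// mulr2n mulrDl mul1r.
  by rewrite lerD ?le_norm_fst ?le_norm_snd.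
have [ab /set_mem[[sa sb] /= dab] hmin] :=
  compact_EVT_min (ex_intro _ ab0 Aab0) cA (continuous_subspaceT cphi).
have phi0 : 0 < phi ab.
  rewrite lt_neqAle normc_ge0 andbT eq_sym; apply/eqP => /eq0_normc/eqP.
  rewrite subr_eq0 => /eqP/injF e.
  have : ab.1 = ab.2.
    exact: pt_inj.
  move=> ab12; move: dab; rewrite ab12 subrr normr0 leNgt invr_gt0.
  by rewrite ltr0Sn.
exists (Num.bound (phi ab)^-1) => a b ha hb hd.
have h : phi ab <= phi (a, b) by apply: hmin; rewrite inE.
apply: lt_le_trans h; rewrite -[ltRHS]invrK ltf_pV2 ?posrE ?invr_gt0//.
by rewrite (lt_trans (archi_boundP _)) ?invr_ge0 ?normc_ge0// ltr_nat.
Qed.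

(** By coercivity, outside the square of size [M] the image is farther from [q] than F 0, so a
    minimum over the compact square is global. *)
Lemma distance_attained (c B : R) q : 0 < c ->
  (forall p, c * normc p - B <= normc (F p)) ->
  exists p0, forall p, normc (F p0 - q) <= normc (F p - q).
Proof.
move=> c0 coer.
pose phi (a : R * R) := normc (F (pt a) - q).
have cphi : continuous phi.
  apply: (lipschitz_continuous_real (L := 2 * L)) => x y.
  rewrite /phi (le_trans (normc_dist_le _ _))//.
  have -> : F (pt x) - q - (F (pt y) - q) = F (pt x) - F (pt y) by ring.
  have h1 := ler_wpM2l (ltW L0) (normc_ptB x y).
  by have := lipF (pt x) (pt y); lra.
pose M := 2 * ((`|B| + 2 * normc q + normc (F 0)) / c + 1).
have M0 : 0 < M.
  rewrite mulr_gt0// ltr_wpDl// divr_ge0 ?(ltW c0)//.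
  by rewrite !addr_ge0 ?mulr_ge0 ?normc_ge0.
have ne : square M !=set0 by exists 0; apply/squareP; rewrite /= normr0 ltW.
have [a _ hmin] := compact_EVT_min ne (@square_compact M) (continuous_subspaceT cphi).
exists (pt a) => p; have [b pE [b1 b2]] := ptP p.
have [bM|Mb] := leP (2 * normc p) M.
  by rewrite pE; apply: hmin; rewrite inE; apply/squareP; rewrite (le_trans b1) ?(le_trans b2).
apply: (@le_trans _ _ (normc (F 0 - q))).
  have -> : 0 = pt (0, 0) by rewrite /pt/lat_pt/= mul0r addr0.
  by apply: hmin; rewrite inE; apply/squareP; rewrite /= normr0 ltW.
have Mp : `|B| + 2 * normc q + normc (F 0) < c * normc p.
  rewrite [c * _]mulrC -ltr_pdivrMr//; by move: Mb; rewrite /M; move: (_ / c) => X; lra.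
have h1 := coer p; have h2 := le_normcD (F p - q) q.
have h3 := normc_dist_triangle 0 (F 0) q.
rewrite subr0 sub0r normcN in h3; rewrite subrK in h2.
have := ler_norm B; have := normc_ge0 q; rewrite -?pE; lra.
Qed.

(** Quantitative injectivity tested at rational points only; with [rational_density] it expresses
    bijectivity by countably many conditions on values of [F], which is what measurability
    requires. *)
Definition rational_gap := forall n : nat, exists k : nat, forall a b : rat * rat,
  square n.+1%:R (ratr a.1 : R, ratr a.2 : R) ->
  square n.+1%:R (ratr b.1 : R, ratr b.2 : R) ->
  n.+1%:R^-1 <= `|(ratr a.1 : R, ratr a.2 : R) - (ratr b.1 : R, ratr b.2 : R)| ->
  k.+1%:R^-1 < normc (F (rat_pt a) - F (rat_pt b)).

Definition rational_density := forall (b : rat * rat) (k : nat),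
  exists a : rat * rat, normc (F (rat_pt a) - rat_pt b) < k.+1%:R^-1.

(** By the Lipschitz bound the gap at rational points excludes two real points with the same image.
    Density yields surjectivity because a coercive continuous map attains its distance to every
    point, so this distance cannot be positive. *)
Lemma bijective_rational (c B : R) : 0 < c ->
  (forall p, c * normc p - B <= normc (F p)) ->
  bijective F <-> rational_gap /\ rational_density.
Proof.
move=> c0 coer; have archi (e : R) : 0 < e -> exists k : nat, k.+1%:R^-1 < e.
  move=> e0; exists (Num.bound e^-1).
  rewrite -[ltRHS]invrK ltf_pV2 ?posrE ?invr_gt0//.
  by rewrite (lt_trans (archi_boundP _)) ?invr_ge0 ?ltW// ltr_nat.
split=> [[G FK GK]|[gap dens]].
  split=> [n|b k].
    have [k kP] := injective_gap n (can_inj FK).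
    by exists k => a b ha hb hab; exact: kP.
  have [s sE _] := ptP (G (rat_pt b)).
  have e0 : 0 < k.+1%:R^-1 / (2 * L) by rewrite divr_gt0 ?mulr_gt0.
  have [a [_ _ ha]] := rat_pt_approx s e0; exists a.
  rewrite -{1}(GK (rat_pt b)) sE -normcN opprB (le_lt_trans (lipF _ _))//.
  rewrite mulrC -ltr_pdivlMr//; move: ha; rewrite invfM.
  by rewrite (_ : 2 * _ = k.+1%:R^-1 / L)//; field; rewrite ?gt_eqF// pnatr_eq0.
have injF : injective F.
  move=> p p' e; have [s sE _] := ptP p; have [s' s'E _] := ptP p'.
  rewrite sE s'E; congr pt; apply/eqP/negPn/negP => ss'.
  have [d dE d0] : exists2 d, d = `|s - s'| & 0 < d.
    by exists `|s - s'| => //; rewrite normr_gt0 subr_eq0.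
  have [n nP] : exists n : nat, `|s| + `|s'| + 1 + 2 / d < n.+1%:R.
    exists (Num.bound (`|s| + `|s'| + 1 + 2 / d)).
    have X0 : 0 <= `|s| + `|s'| + 1 + 2 / d by rewrite !addr_ge0// divr_ge0// ltW.
    by rewrite (lt_trans (archi_boundP X0))// ltr_nat.
  have dn : n.+1%:R^-1 < d / 2.
    rewrite -[ltRHS]invf_div ltf_pV2 ?posrE ?divr_gt0//.
    by rewrite (le_lt_trans _ nP)// lerDr !addr_ge0.
  have [k kP] := gap n.
  have d2 : 0 <= 2 / d by rewrite divr_ge0// ltW.
  (* Accuracy of the rational approximations: at most 1 keeps them in the square, d / 4 keeps them 1
     / (n + 1) apart, and the last bound brings their images within 1 / (k + 1), contradicting the
     gap. *)
  have [eta [eta0 eta1 etad etak]] : exists eta, [/\ 0 < eta, eta <= 1,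
      eta <= d / 4 & 4 * L * eta <= k.+1%:R^-1].
    exists (Num.min (Num.min 1 (d / 4)) (k.+1%:R^-1 / (4 * L))); split.
    - by rewrite !lt_min ltr01/= !divr_gt0// mulr_gt0.
    - by rewrite !ge_min lexx.
    - by rewrite !ge_min lexx orbT.
    - by rewrite mulrC -ler_pdivlMr ?mulr_gt0// !ge_min lexx !orbT.
  have near_square (t : R * R) (a : rat * rat) : `|t| <= `|s| + `|s'| ->
      `|t.1 - ratr a.1| < eta -> `|t.2 - ratr a.2| < eta ->
      square n.+1%:R (ratr a.1 : R, ratr a.2 : R).
    move=> ht h1 h2; apply/squareP => /=.
    have := le_norm_fst t; have := le_norm_snd t => t2 t1.
    have := ler_normB (t.1) (t.1 - ratr a.1); have := ler_normB (t.2) (t.2 - ratr a.2).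
    by rewrite !subKr; split; lra.
  have [a [a1 a2 ha]] := rat_pt_approx s eta0.
  have [b [b1 b2 hb]] := rat_pt_approx s' eta0.
  pose ra : R * R := (ratr a.1, ratr a.2); pose rb : R * R := (ratr b.1, ratr b.2).
  have sra : `|s - ra| < eta by rewrite [ltLHS]/Num.norm/= gt_max/= a1 a2.
  have srb : `|s' - rb| < eta by rewrite [ltLHS]/Num.norm/= gt_max/= b1 b2.
  have dab : d <= `|s - ra| + `|ra - rb| + `|s' - rb|.
    rewrite (distrC s') dE (_ : s - s' = (s - ra) + (ra - rb) + (rb - s')).
      by rewrite (le_trans (ler_normD _ _))// lerD2r ler_normD.
    by rewrite !subrKA.
  have nab : n.+1%:R^-1 <= `|ra - rb|.
    have gap_le (x y u v w : R) : u < x -> v < x -> d <= u + w + v -> x <= d / 4 ->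
      y < d / 2 -> y <= w by lra.
    exact: gap_le sra srb dab etad dn.
  have := kP a b (near_square s a _ a1 a2) (near_square s' b _ b1 b2) nab.
  rewrite lerDl lerDr !normr_ge0 => /(_ isT isT).
  have h1 := lipF (pt s) (rat_pt a); have h2 := lipF (pt s') (rat_pt b).
  have e' : F (pt s) = F (pt s') by rewrite -sE -s'E.
  have := normc_dist_triangle (F (pt s)) (F (rat_pt a)) (F (rat_pt b)).
  rewrite -[normc (F (rat_pt a) - F (pt s))]normcN opprB {2}e' => h3.
  have h4 := ler_wpM2l (ltW L0) (ltW ha); have h5 := ler_wpM2l (ltW L0) (ltW hb).
  apply/negP; rewrite -leNgt (le_trans h3)// (le_trans _ etak)//.
  have -> : 4 * L * eta = L * (2 * eta) + L * (2 * eta) by ring.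
  by rewrite lerD// ?(le_trans h1)// (le_trans h2).
have surjF q : exists p, F p = q.
  have [p0 hp0] := distance_attained q c0 coer; exists p0.
  apply/eqP; rewrite -subr_eq0; apply/negPn/negP => n0.
  have e0 : 0 < normc (F p0 - q).
    rewrite lt_neqAle normc_ge0 andbT eq_sym.
    by apply: contra n0 => /eqP/eq0_normc/eqP.
  have e4 : 0 < normc (F p0 - q) / 4 by rewrite divr_gt0.
  have e2 : 0 < normc (F p0 - q) / 2 by rewrite divr_gt0.
  (* A rational point closer to [q] than half the minimal distance, and an image closer than the
     other half to that point, would together beat the minimum. *)
  have [s sE _] := ptP q; have [b [_ _ hb]] := rat_pt_approx s e4.
  have [k hk] := archi _ e2; have [a ha] := dens b k.
  have h := normc_dist_triangle (rat_pt b) (F (rat_pt a)) q.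
  rewrite -sE -normcN opprB in hb.
  have := lt_trans ha hk; have := hp0 (rat_pt a).
  move: hb h; move: (normc (F p0 - q)) => e; lra.
have /choice[G GP] := surjF.
exists G => p //; exact/injF/GP.
Qed.

(** F is multiplication by [l] plus a map with Lipschitz constant K < l. Injectivity and coercivity
    are immediate; surjectivity follows by improving a point that minimises the distance to the
    target. *)
Lemma bijective_perturbation (l K : R) : 0 <= K < l ->
  (forall p q, normc ((F p - l%:C * p) - (F q - l%:C * q)) <= K * normc (p - q)) ->
  bijective F.
Proof.
move=> /andP[K0 Kl] HF.
have nl p : normc (l%:C * p) = l * normc p.
  by rewrite normcM /= expr0n/= addr0 sqrtr_sqr ger0_norm//; lra.
have injF : injective F.
  move=> p q e; have := HF p q; rewrite e.
  have -> : F q - l%:C * p - (F q - l%:C * q) = - (l%:C * (p - q)) by ring.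
  rewrite normcN nl => h; apply/eqP; rewrite -subr_eq0; apply/eqP/eq0_normc/eqP.
  by rewrite eq_le normc_ge0 andbT; nra.
have coer p : (l - K) * normc p - normc (F 0) <= normc (F p).
  have := HF p 0; rewrite mulr0 !subr0.
  have -> : F p - l%:C * p - F 0 = - (l%:C * p - (F p - F 0)) by ring.
  rewrite normcN => h.
  have := le_normcD (l%:C * p - (F p - F 0)) (F p - F 0); rewrite subrK nl.
  have := le_normcD (F p) (- F 0); rewrite normcN; lra.
have surjF q : exists p, F p = q.
  have [p0 hp0] := distance_attained q (c := l - K) ltac:(lra) coer; exists p0.
  have l0 : l != 0 by rewrite gt_eqF//; lra.
  have lC : l%:C != 0 by rewrite eq_complex/= eqxx andbT.
  (* One step of the fixed point iteration: it multiplies the distance to [q] by at most K / l < 1,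
     so at a minimiser this distance is 0. *)
  pose p1 := p0 + (l%:C)^-1 * (q - F p0).
  have E : F p1 - q = F p1 - l%:C * p1 - (F p0 - l%:C * p0) by rewrite /p1; field.
  have := HF p1 p0; rewrite -E => h; have := hp0 p1 => h'.
  have e1 : l * normc (p1 - p0) = normc (F p0 - q).
    rewrite -nl /p1 addrC addKr mulrA divff// mul1r -normcN opprB.
    by [].
  apply/eqP; rewrite -subr_eq0; apply/eqP/eq0_normc/eqP.
  rewrite eq_le normc_ge0 andbT; have := normc_ge0 (p1 - p0); nra.
have /choice[G GP] := surjF.
exists G => p //; exact/injF/GP.
Qed.

End lipschitz.
End bijectivity.

(** * Invariant integrals and fundamental domains *)

Section invariant_integral.
Context d (T : measurableType d) (R : realType).
Variables (mu : {measure set T -> \bar R}) (phi : T -> T).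
Hypothesis mphi : measurable_fun setT phi.
Hypothesis muphi : forall A, measurable A -> mu (phi @^-1` A) = mu A.
Local Open Scope ereal_scope.

Lemma ge0_integral_invariant (f : T -> \bar R) : measurable_fun setT f ->
  (forall x, 0 <= f x) -> \int[mu]_x f (phi x) = \int[mu]_x f x.
Proof.
move=> mf f0; have := ge0_integral_pushforward mphi mu measurableT mf (fun x _ => f0 x).
rewrite preimage_setT => <-; apply: eq_measure_integral => A mA _.
exact: muphi.
Qed.

End invariant_integral.

Section power_measure.
Context d (T : measurableType d) (R : realType).
Variables (mu : {sigma_finite_measure set T -> \bar R}) (n : nat).
Local Open Scope ereal_scope.

Definition tuple_box (A : 'I_n -> set T) : set (n.-tuple T) :=
  [set t | forall i, A i (tnth t i)].

Lemma measurable_tuple_box A : (forall i, measurable (A i)) ->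
  measurable (tuple_box A).
Proof.
move=> mA; rewrite (_ : tuple_box A = \bigcap_(i in [set: 'I_n]) ((@tnth n T)^~ i @^-1` A i)).
  apply: fin_bigcap_measurable => // i _; rewrite -[X in measurable X]setTI.
  exact: measurable_tnth.
by apply/seteqP; split=> t /= h i; [move=> _|]; exact: h.
Qed.

Lemma power_measure_box A : (forall i, measurable (A i)) ->
  power_measure mu n (tuple_box A) = \prod_(i < n) mu (A i).
Proof. exact: power_measureE. Qed.

(** Boxes are stable under intersection, generate the product sigma-algebra, and boxes of finite
    measure exhaust the space. *)
Lemma power_measure_unique (m : {measure set (n.-tuple T) -> \bar R}) :
  (forall A, (forall i, measurable (A i)) -> m (tuple_box A) = \prod_(i < n) mu (A i)) ->
  forall X, measurable X -> power_measure mu n X = m X.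
Proof.
move=> mE X mX.
have /sigma_finiteP[F [TF ndF Foo]] := sigma_finiteT mu.
pose G := [set B | exists2 A : 'I_n -> set T, (forall i, measurable (A i)) & B = tuple_box A].
apply: (measure_unique G (fun k => tuple_box (fun=> F k))) => //.
- apply/seteqP; split=> [B|].
    apply: smallest_sub; first exact: smallest_sigma_algebra.
    rewrite -bigcup_seq => C [i _ [D mD <-]].
    apply: sub_sigma_algebra; exists (fun j => if j == i then D else setT).
      by move=> j; case: ifP.
    rewrite setTI; apply/seteqP; split=> t /=.
      by move=> Dt j; case: eqP => // ->.
    by move=> /(_ i); rewrite eqxx.
  apply: smallest_sub; first exact: sigma_algebra_measurable.
  by move=> _ [A mA ->]; exact: measurable_tuple_box.
- move=> _ _ [A mA ->] [B mB ->]; exists (fun i => A i `&` B i).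
    by move=> i; exact: measurableI.
  by apply/seteqP; split=> t /= => [[hA hB] i //|h]; split=> i; have [] := h i.
- by move=> k; exists (fun=> F k) => // _; have [] := Foo k.
- apply/seteqP; split=> // t _.
  have : forall i : 'I_n, exists k, F k (tnth t i).
    by move=> i; have : [set: T] (tnth t i) by []; rewrite TF => -[k _ ?]; exists k.
  move=> /choice[k kP]; exists (\max_i k i)%N => //= i.
  by have /subsetPset := ndF _ _ (leq_bigmax (F := k) i); exact.
- by move=> _ [A mA ->]; rewrite mE//; exact: power_measure_box.
- move=> k; suff : \prod_(i < n) mu (F k) < +oo.
    by rewrite -(power_measure_box (A := fun=> F k)) => // _; have [] := Foo k.
  rewrite ltey_eq; apply/orP; left; elim/big_ind : _ => //.
    by move=> x y; exact: fin_numM.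
  by move=> i _; rewrite ge0_fin_numE//; have [] := Foo k.
Qed.

Variables (pi : 'I_n -> 'I_n) (phi : 'I_n -> T -> T).
Hypothesis bpi : bijective pi.
Hypothesis mphi : forall i, measurable_fun setT (phi i).
Hypothesis muphi : forall i A, measurable A -> mu (phi i @^-1` A) = mu A.

(** Combines a permutation of the coordinates with a map on each of them, so that it covers both
    lattice shifts and translations in the plane. *)
Definition tuple_transform (t : n.-tuple T) : n.-tuple T :=
  [tuple phi i (tnth t (pi i)) | i < n].

Lemma measurable_tuple_transform : measurable_fun setT tuple_transform.
Proof.
apply/measurable_fun_tnthP => i.
rewrite (_ : _ \o _ = phi i \o ((@tnth n T)^~ (pi i))).
  by apply: measurableT_comp => //; exact: measurable_tnth.
by apply/funext => t /=; rewrite tnth_mktuple.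
Qed.

Let mfun_transform : {mfun n.-tuple T >-> n.-tuple T} :=
  HB.pack tuple_transform (isMeasurableFun.Build _ _ _ _ _ measurable_tuple_transform).

Lemma power_measure_transform X : measurable X ->
  power_measure mu n (tuple_transform @^-1` X) = power_measure mu n X.
Proof.
move=> mX; apply/esym.
apply: (power_measure_unique (m := pushforward (power_measure mu n) mfun_transform)) => //.
move=> A mA; have [pi' pK piK] := bpi.
transitivity (power_measure mu n (tuple_transform @^-1` tuple_box A)); first by [].
rewrite (_ : _ @^-1` _ = tuple_box (fun j => phi (pi' j) @^-1` A (pi' j))).
  rewrite power_measure_box => [|j]; last first.
    by rewrite -[X in measurable X]setTI; exact: mphi.
  rewrite [LHS](reindex pi); last exact: onW_bij.
  by apply: eq_bigr => i _; rewrite pK muphi.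
apply/seteqP; split=> t /= h i.
  by have := h (pi' i); rewrite tnth_mktuple piK.
by have := h (pi i); rewrite pK tnth_mktuple.
Qed.

End power_measure.

Section plane_measure.
Variable R : realType.
Local Notation lambda := (@lebesgue_measure R).
Local Notation lambda2 := (product_measure lambda lambda).
Local Open Scope ereal_scope.

Lemma lebesgue_measure_addr (c : R) (A : set R) : measurable A ->
  lambda ((fun x => x + c)%R @^-1` A) = lambda A.
Proof.
move=> mA.
have mf : measurable_fun setT ((fun x => x + c)%R : measurableTypeR R -> measurableTypeR R).
  exact: measurable_funD.
pose F : {mfun measurableTypeR R >-> measurableTypeR R} :=
  HB.pack (fun x => x + c)%R (isMeasurableFun.Build _ _ _ _ _ mf).
apply/esym.
apply: (lebesgue_measure_unique (mu := pushforward lambda F)) => //= _ [[a b]] _ <-.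
transitivity (lambda ((fun x => x + c)%R @^-1` `]a, b]%classic)); last by [].
rewrite (_ : _ @^-1` _ = `]a - c, b - c]%classic)%R.
  rewrite !lebesgue_measure_itv/= !lte_fin ltrD2r; case: ifP => // _.
  by rewrite -!EFinB; congr EFin; ring.
by apply/seteqP; split=> x; rewrite /= !in_itv/= ltrBlDr lerBrDr.
Qed.

Definition translate (v p : R * R) : R * R := (p.1 + v.1, p.2 + v.2)%R.

Local Notation P := (measurableTypeR R * measurableTypeR R)%type.

Lemma measurable_translate v : measurable_fun setT (translate v : P -> P).
Proof.
by apply/measurable_fun_pair; apply: (@measurable_funD _ P R).
Qed.

Lemma lebesgue2_translate v (A : set P) : measurable A ->
  lambda2 (translate v @^-1` A) = lambda2 A.
Proof.
move=> mA.
pose F : {mfun P >-> P} :=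
  HB.pack (translate v) (isMeasurableFun.Build _ _ _ _ _ (measurable_translate v)).
apply/esym.
apply: (product_measure_unique (m' := pushforward lambda2 F)) => // B D mB mD.
transitivity (lambda2 (translate v @^-1` (B `*` D))); first by [].
rewrite (_ : _ @^-1` _ = ((fun x => x + v.1)%R @^-1` B) `*` ((fun x => x + v.2)%R @^-1` D)).
  rewrite /product_measure product_measure1E.
  - by congr (_ * _); exact: lebesgue_measure_addr.
  - rewrite -[X in measurable X]setTI; exact: measurable_funD.
  - rewrite -[X in measurable X]setTI; exact: measurable_funD.
by [].
Qed.

Definition otranslate (v : R * R) : option (R * R) -> option (R * R) :=
  omap (translate v).

Lemma measurable_option d (U : measurableType d) (d' : measure_display)
    (T' : measurableType d') (g : option U -> T') :
  measurable_fun setT (g \o Some) -> measurable_fun setT g.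
Proof.
move=> mg _ B mB; rewrite setTI.
by have := mg measurableT B mB; rewrite setTI.
Qed.

Lemma measurable_otranslate v : measurable_fun setT (otranslate v : option P -> option P).
Proof.
apply: (measurable_option (U := P)).
rewrite (_ : _ \o _ = (@Some P) \o (translate v : P -> P))//.
by apply: measurableT_comp; [exact: measurable_Some|exact: measurable_translate].
Qed.

Lemma hole_measure_otranslate v (A : set (option P)) : measurable A ->
  hole_measure lambda2 (otranslate v @^-1` A) = hole_measure lambda2 A.
Proof.
move=> mA; rewrite /hole_measure !diracE; congr (_ + _).
exact: lebesgue2_translate.
Qed.

End plane_measure.

(** * Two fundamental domains of a measure-preserving action *)

Section fundamental_domains.
Context d (T : measurableType d) (R : realType) (I : countType).
Variables (mu : {measure set T -> \bar R}) (act act' : I -> T -> T).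
Hypothesis mact : forall v, measurable_fun setT (act v).
Hypothesis mact' : forall v, measurable_fun setT (act' v).
Hypothesis actK : forall v, cancel (act v) (act' v).
Hypothesis muact : forall v (f : T -> \bar R), measurable_fun setT f ->
  (forall w, 0 <= f w)%E -> (\int[mu]_w f (act v w) = \int[mu]_w f w)%E.
Variables (Q D1 D2 : set T) (g : T -> \bar R).
Hypotheses (mQ : measurable Q) (mD1 : measurable D1) (mD2 : measurable D2).
Hypothesis mg : measurable_fun setT g.
Hypothesis g0 : forall w, (0 <= g w)%E.
Hypothesis gact : forall v w, g (act v w) = g w.
Hypothesis Qact : forall v w, Q (act v w) <-> Q w.
Hypothesis D1u : forall w, Q w -> exists! v, D1 (act' v w).
Hypothesis D2u : forall w, Q w -> exists! v, D2 (act v w).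
Local Open Scope ereal_scope.

(** [D1] is cut along the translates of [D2], and [D2] along those of [D1]. The transformation
    [act v] maps the piece of the first with index [v] to the piece of the second with the same
    index, and preserves both the measure and [g]. *)
Lemma integral_fundamental_domains :
  \int[mu]_(w in D1 `&` Q) g w = \int[mu]_(w in D2 `&` Q) g w.
Proof.
have mpre (h : T -> T) D : measurable_fun setT h -> measurable D -> measurable (h @^-1` D).
  by move=> mh mD; rewrite -[X in measurable X]setTI; exact: mh.
have union (D E : set T) (a : I -> T -> T) : (forall v, measurable_fun setT (a v)) ->
    measurable D -> measurable E -> (forall w, Q w -> exists! v, E (a v w)) ->
    \int[mu]_(w in D `&` Q) g w = \sum_(n <oo) \int[mu]_(w in
      if pickle_inv n is Some v then D `&` Q `&` (a v @^-1` E) else set0) g w.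
  move=> ma mD mE Eu.
  (* The pieces are enumerated by natural numbers; codes of no group element contribute the empty
     set. *)
  pose F n := if @pickle_inv I n is Some v then D `&` Q `&` (a v @^-1` E) else set0.
  have FE : D `&` Q = \bigcup_n F n.
    apply/seteqP; split=> [w [Dw Qw]|w [n _]].
      have [v [Ev _]] := Eu _ Qw; exists (pickle v) => //.
      by rewrite /F pickleK_inv.
    by rewrite /F; case: pickle_inv => [v [[]]|].
  rewrite [X in integral mu X _ = _]FE.
  apply: ge0_integral_bigcup => //.
  - move=> n; rewrite /F; case: pickle_inv => [v|//].
    by apply: measurableI; [exact: measurableI|exact: mpre].
  - exact: measurable_funS mg.
  - apply/trivIsetP => i j _ _ ij; apply/seteqP; split=> // w [].
    rewrite /F; have := @pickle_invK I i; have := @pickle_invK I j.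
    case: pickle_inv => [v|//]; case: pickle_inv => [v'|//] /= vj v'i [[_ Qw] E1] [_ E2].
    have [u [_ uu]] := Eu _ Qw; move/eqP: ij; apply.
    by rewrite -vj -v'i -(uu _ E1) -(uu _ E2).
rewrite (union D1 D2 act)// (union D2 D1 act')//.
apply: eq_eseriesr => n _; case: pickle_inv => [v|//].
rewrite integral_mkcond [RHS]integral_mkcond -[RHS](muact v).
- apply: eq_integral => w _; rewrite !patchE.
  have -> : (act v w \in D2 `&` Q `&` act' v @^-1` D1) = (w \in D1 `&` Q `&` act v @^-1` D2).
    apply/idP/idP; rewrite !inE /= actK => -[[h1 h2] h3].
      by split=> //; split=> //; exact/(Qact v w).
    by split=> //; split=> //; exact/(Qact v w).
  by rewrite gact.
- apply/(measurable_restrictT _ _).1; last exact: measurable_funS mg.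
  by apply: measurableI; [exact: measurableI|exact: mpre].
- by move=> w; exact: erestrict_ge0.
Qed.

End fundamental_domains.

(** * Measurability of the set of allowed configurations *)

Section measurable_sets.
Context d (T : measurableType d).

Lemma measurable_forall (I : countType) (P : I -> set T) :
  (forall i, measurable (P i)) -> measurable [set w | forall i, P i w].
Proof.
move=> mP.
have -> : [set w | forall i, P i w] =
    \bigcap_n (if unpickle n is Some i then P i else setT).
  apply/seteqP; split=> w /= h; first by move=> n _; case: unpickle.
  by move=> i; have := h (pickle i) Logic.I; rewrite pickleK.
by apply: bigcapT_measurable => n; case: unpickle.
Qed.

Lemma measurable_exists (I : countType) (P : I -> set T) :
  (forall i, measurable (P i)) -> measurable [set w | exists i, P i w].
Proof.
move=> mP.
have -> : [set w | exists i, P i w] = ~` [set w | forall i, (~` P i) w].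
  apply/seteqP; split=> w /=; first by move=> [i Pi] h; exact: (h i).
  by move=> /existsNP[i /contrapT Pi]; exists i.
by apply/measurableC/measurable_forall => i; exact: measurableC.
Qed.

Lemma measurable_impl (P : Prop) (Q : set T) : measurable Q ->
  measurable [set w | P -> Q w].
Proof.
move=> mQ; have [p|np] := pselect P.
  by rewrite (_ : [set w | _] = Q)//; apply/seteqP; split=> w //= h; exact: h.
rewrite (_ : [set w | _] = setT); first exact: measurableT.
by apply/seteqP; split=> w //= _ /np.
Qed.

Lemma measurable_implT (P Q : set T) : measurable P -> measurable Q ->
  measurable [set w | P w -> Q w].
Proof.
move=> mP mQ; rewrite (_ : [set w | _] = ~` P `|` Q).
  by apply: measurableU => //; exact: measurableC.
by apply/seteqP; split=> w /= => [h|[]//]; have [/h|] := pselect (P w); [right|left].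
Qed.

Lemma measurable_bool (f : T -> bool) : measurable_fun setT f -> measurable [set w | f w].
Proof.
by move=> mf; have := mf measurableT [set true]; rewrite setTI; exact.
Qed.

End measurable_sets.

Section complex_measurable.
Context d (T : measurableType d) (R : realType).
Local Notation C := R[i].
Implicit Types f g : T -> C.

Definition cmeasurable f := measurable_fun setT (fun w => complex.Re (f w) : R) /\
  measurable_fun setT (fun w => complex.Im (f w) : R).

Lemma cmeasurable_cst c : cmeasurable (fun=> c).
Proof. by split; exact: measurable_cst. Qed.

Lemma cmeasurableD f g : cmeasurable f -> cmeasurable g -> cmeasurable (fun w => f w + g w).
Proof.
move=> [f1 f2] [g1 g2]; split.
  by under eq_fun do rewrite ReD; exact: measurable_funD.
by under eq_fun do rewrite ImD; exact: measurable_funD.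
Qed.

Lemma cmeasurableM f g : cmeasurable f -> cmeasurable g -> cmeasurable (fun w => f w * g w).
Proof.
move=> [f1 f2] [g1 g2]; split.
  by under eq_fun do rewrite ReM; apply: measurable_funB; exact: measurable_funM.
by under eq_fun do rewrite ImM; apply: measurable_funD; exact: measurable_funM.
Qed.

Lemma cmeasurableN f : cmeasurable f -> cmeasurable (fun w => - f w).
Proof.
move=> mf; under [X in cmeasurable X]eq_fun do rewrite -mulN1r.
by apply: cmeasurableM => //; exact: cmeasurable_cst.
Qed.

Lemma cmeasurableB f g : cmeasurable f -> cmeasurable g -> cmeasurable (fun w => f w - g w).
Proof. by move=> mf mg; apply: cmeasurableD => //; exact: cmeasurableN. Qed.

Lemma cmeasurable_sum (I : Type) (s : seq I) (F : I -> T -> C) :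
  (forall i, cmeasurable (F i)) -> cmeasurable (fun w => \sum_(i <- s) F i w).
Proof.
move=> mF; elim: s => [|i s IH].
  by under [X in cmeasurable X]eq_fun do rewrite big_nil; exact: cmeasurable_cst.
by under [X in cmeasurable X]eq_fun do rewrite big_cons; exact: cmeasurableD.
Qed.

Lemma cmeasurable_if (b : T -> bool) f g : measurable_fun setT b ->
  cmeasurable f -> cmeasurable g -> cmeasurable (fun w => if b w then f w else g w).
Proof.
move=> mb [f1 f2] [g1 g2]; split.
  by under eq_fun do rewrite (fun_if (@complex.Re R)); exact: measurable_fun_ifT.
by under eq_fun do rewrite (fun_if (@complex.Im R)); exact: measurable_fun_ifT.
Qed.

Lemma measurable_sqnorm f : cmeasurable f -> measurable_fun setT (fun w => sqnorm (f w)).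
Proof.
move=> [f1 f2]; under eq_fun do rewrite sqnormE.
by apply: measurable_funD; exact: measurable_funX.
Qed.

Lemma measurable_normc f : cmeasurable f -> measurable_fun setT (fun w => normc (f w)).
Proof.
move=> mf; under eq_fun do rewrite normc_sqrt.
apply: (measurableT_comp (f := @Num.sqrt R)); last exact: measurable_sqnorm.
apply: continuous_measurable_fun; exact: sqrt_continuous.
Qed.

Lemma measurable_cross f g : cmeasurable f -> cmeasurable g ->
  measurable_fun setT (fun w => cross (f w) (g w)).
Proof.
move=> [f1 f2] [g1 g2]; under eq_fun do rewrite crossE.
by apply: measurable_funB; exact: measurable_funM.
Qed.

End complex_measurable.

Section configurations.
Variables (R : realType) (alpha l : R) (N : nat).
Local Notation C := R[i].
Local Notation tup := ((N * N).-tuple (option (R * R))).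
Hypothesis N0 : (0 < N)%N.

Lemma measurable_site x d' (T' : measurableType d') (h : option (R * R) -> T') :
  measurable_fun setT (h \o Some) ->
  measurable_fun setT (fun w : tup => h (nth None w (index_of N x))).
Proof.
move=> mh; apply: (measurableT_comp (f := h)); first exact: measurable_option.
under eq_fun do rewrite -[index_of N x]/(nat_of_ord (Ordinal (index_of_lt N0 x)))
  -tnth_nth.
exact: measurable_tnth.
Qed.

Lemma measurable_conf_hole x : measurable_fun setT (fun w : tup => conf_of l w x == None).
Proof.
rewrite (_ : (fun w => _) = (fun w : tup => ~~ isSome (nth None w (index_of N x)))).
  by apply: (@measurable_site x _ _ (fun o => ~~ isSome o)); exact: measurable_cst.
by apply/funext => w; rewrite /conf_of /index_of; case: nth.
Qed.

Lemma cmeasurable_conf x : cmeasurable (fun w : tup => odflt 0 (conf_of l w x)).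
Proof.
pose c := (l * N%:R)%:C * emb R (cell_of N x).
have E (w : tup) : odflt 0 (@conf_of R l N w x) =
    odflt 0 (omap (fun p : R * R => (p.1 +i* p.2) + c) (nth None w (index_of N x))).
  by [].
split; under eq_fun do rewrite E.
  apply: (@measurable_site x _ R (fun o => complex.Re (odflt 0
    (omap (fun p : R * R => (p.1 +i* p.2) + c) o)))).
  rewrite (_ : _ \o _ = (fun p : R * R => p.1 + complex.Re c)).
    by apply: measurable_funD.
  by apply/funext => p; rewrite /= ReD.
apply: (@measurable_site x _ R (fun o => complex.Im (odflt 0
    (omap (fun p : R * R => (p.1 +i* p.2) + c) o)))).
rewrite (_ : _ \o _ = (fun p : R * R => p.2 + complex.Im c)).
  by apply: measurable_funD.
by apply/funext => p; rewrite /= ImD.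
Qed.

Lemma cmeasurable_hat_site x : cmeasurable (fun w : tup => hat_site (conf_of l w) x).
Proof.
rewrite (_ : (fun w => _) = (fun w : tup => if conf_of l w x == None
   then 6^-1 * \sum_(z <- nbrs) odflt 0 (conf_of l w (x + z))
   else odflt 0 (conf_of l w x))); last first.
  by apply/funext => w; rewrite /hat_site; case: (conf_of l w x).
apply: cmeasurable_if; [exact: measurable_conf_hole| |exact: cmeasurable_conf].
apply: cmeasurableM; first exact: cmeasurable_cst.
by apply: cmeasurable_sum => z; exact: cmeasurable_conf.
Qed.

Lemma cmeasurable_affine_on x z s t :
  cmeasurable (fun w : tup => affine_on (conf_of l w) x z s t).
Proof.
rewrite /affine_on; apply: cmeasurableD; first apply: cmeasurableD.
- exact: cmeasurable_hat_site.
- apply: cmeasurableM; first exact: cmeasurable_cst.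
  by apply: cmeasurableB; exact: cmeasurable_hat_site.
- apply: cmeasurableM; first exact: cmeasurable_cst.
  by apply: cmeasurableB; exact: cmeasurable_hat_site.
Qed.

Lemma cmeasurable_hat p : cmeasurable (fun w : tup => hat (conf_of l w) p).
Proof.
rewrite /hat/=; apply: cmeasurable_if; first exact: measurable_cst.
  exact: cmeasurable_affine_on.
exact: cmeasurable_affine_on.
Qed.

Lemma measurable_edge_lengths : measurable [set w : tup | edge_lengths alpha (conf_of l w)].
Proof.
rewrite (_ : [set w | _] = [set w : tup | forall x y : int * int, adj R x y ->
   [set w | ~~ ((conf_of l w x == None) || (conf_of l w y == None))] w ->
   [set w | (1 - alpha < normc (odflt 0 (conf_of l w x) - odflt 0 (conf_of l w y))) &&
     (normc (odflt 0 (conf_of l w x) - odflt 0 (conf_of l w y)) < 1 + alpha)] w]).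
  apply: (@measurable_forall _ _ (int * int)%type) => x.
  apply: (@measurable_forall _ _ (int * int)%type) => y.
  apply: measurable_impl; apply: measurable_implT; apply: measurable_bool.
    by apply/measurable_neg/measurable_or; exact: measurable_conf_hole.
  have mn : measurable_fun setT (fun w : tup =>
      normc (odflt 0 (conf_of l w x) - odflt 0 (conf_of l w y))).
    by apply/measurable_normc/cmeasurableB; exact: cmeasurable_conf.
  by apply: measurable_and; apply: measurable_fun_ltr => //; exact: measurable_cst.
apply/seteqP; split=> w /= h x y.
  move=> xy; case Ex: (conf_of l w x) => [p|//]; case Ey: (conf_of l w y) => [q|//] _.
  exact: h xy Ex Ey.
move=> p q xy Ex Ey; have := h x y xy; rewrite Ex Ey /=; exact.
Qed.

Lemma measurable_holes_separated : measurable [set w : tup | holes_separated (conf_of l w)].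
Proof.
rewrite (_ : [set w | _] = [set w : tup | forall x y : int * int,
   ~ (x = y \/ 2 < normc (emb R x - emb R y)) ->
   [set w | ~~ ((conf_of l w x == None) && (conf_of l w y == None))] w]).
  apply: (@measurable_forall _ _ (int * int)%type) => x.
  apply: (@measurable_forall _ _ (int * int)%type) => y.
  apply: measurable_impl; apply: measurable_bool.
  by apply/measurable_neg/measurable_and; exact: measurable_conf_hole.
apply/seteqP; split=> w /= h x y.
  by move=> n; apply/negP => /andP[/eqP hx /eqP hy]; apply: n; exact: h.
by move=> hx hy; apply: contrapT => /(h x y); rewrite hx hy.
Qed.

Lemma measurable_orientation_preserving :
  measurable [set w : tup | orientation_preserving (conf_of l w)].
Proof.
rewrite (_ : [set w | _] = [set w : tup | forall x z : int * int, z \in nbrs ->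
   [set w | 0 < cross (hat_site (conf_of l w) (x + z) - hat_site (conf_of l w) x)
      (hat_site (conf_of l w) (x + mul_tau z) - hat_site (conf_of l w) x)] w]).
  apply: (@measurable_forall _ _ (int * int)%type) => x.
  apply: (@measurable_forall _ _ (int * int)%type) => z.
  apply: measurable_impl; apply: measurable_bool.
  apply: measurable_fun_ltr; first exact: measurable_cst.
  by apply: measurable_cross; apply: cmeasurableB; exact: cmeasurable_hat_site.
by apply/seteqP; split=> w /= h x z zn; have := h x z zn; rewrite Im_div_gt0.
Qed.

(** Solving for the lattice coordinates removes the existential quantifier and leaves inequalities
    between measurable functions. *)
Lemma fundamental_domainE (p : C) : fundamental_domain l N p <->
  let t := complex.Im p / (Num.sqrt 3 / 2) in let s := complex.Re p + t / 2 in
  (0 <= s) && (s < l * N%:R) && ((0 <= t) && (t < l * N%:R)).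
Proof.
have s3 : Num.sqrt 3 != 0 :> R by rewrite lt0r_neq0// sqrtr_gt0.
have tq (s t : R) : s%:C + tau R ^+ 2 * t%:C = (s - t / 2) +i* (t * (Num.sqrt 3 / 2)).
  rewrite tau_sqr tauE; apply/eqP; rewrite eq_complex/=.
  by apply/andP; split; apply/eqP; field.
split=> [[s [t [hs ht e]]]|] /=.
  rewrite (etrans e (tq s t)) /= mulfK; last by rewrite mulf_neq0.
  by rewrite subrK hs ht.
move=> /andP[hs ht]; set t := _ / _ in ht hs; exists (complex.Re p + t / 2), t.
split=> //; apply: etrans (esym (tq _ _)); rewrite /t addrK divfK; last by rewrite mulf_neq0.
by case: (p).
Qed.

Lemma measurable_representatives : measurable (@representatives R l N).
Proof.
rewrite (_ : @representatives R l N = [set w : tup | forall x : int * int, x \in box N ->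
   [set w | [set w : tup | ~~ (conf_of l w x == None)] w ->
   [set w | [set w : tup | forall y : int * int, (y \in box N) && lex_lt y x ->
       [set w : tup | conf_of l w y == None] w] w ->
     [set w : tup | fundamental_domain l N (odflt 0 (conf_of l w x))] w] w] w]).
  apply: (@measurable_forall _ _ (int * int)%type) => x; apply: measurable_impl.
  apply: measurable_implT.
    by apply/measurable_bool/measurable_neg; exact: measurable_conf_hole.
  apply: measurable_implT.
    apply: (@measurable_forall _ _ (int * int)%type) => y; apply: measurable_impl.
    by apply: measurable_bool; exact: measurable_conf_hole.
  under eq_set do rewrite (propext (fundamental_domainE _)) /=.
  have [m1 m2] := cmeasurable_conf x.
  have mt : measurable_fun setT (fun w : tup =>
      complex.Im (odflt 0 (conf_of l w x)) / (Num.sqrt 3 / 2)).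
    by apply: measurable_funM => //; exact: measurable_cst.
  have ms : measurable_fun setT (fun w : tup => complex.Re (odflt 0 (conf_of l w x))
      + complex.Im (odflt 0 (conf_of l w x)) / (Num.sqrt 3 / 2) / 2).
    by apply: measurable_funD => //; apply: measurable_funM => //; exact: measurable_cst.
  apply: measurable_bool; apply: measurable_and; apply: measurable_and.
  - by apply: measurable_fun_ler => //; exact: measurable_cst.
  - by apply: measurable_fun_ltr => //; exact: measurable_cst.
  - by apply: measurable_fun_ler => //; exact: measurable_cst.
  - by apply: measurable_fun_ltr => //; exact: measurable_cst.
apply/seteqP; split=> w /= h x.
  move=> xb; case E : (conf_of l w x) => [p|//] _ hy.
  by apply: (h x p xb E) => y yb yx; apply/eqP; apply: hy; rewrite yb.
move=> p xb E hy; have := h x xb; rewrite E; apply => //.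
by move=> y /andP[yb yx]; apply/eqP; exact: hy.
Qed.

Hypothesis alpha2 : alpha <= 2^-1.
Hypothesis l2 : 2^-1 < l < 3 / 2.

Section bijective.
Variable omega : conf R.
Hypothesis qp : quasiperiodic l N omega.
Hypothesis el : edge_lengths alpha omega.
Hypothesis hs : holes_separated omega.

Lemma hat_lipschitz p q : normc (hat omega p - hat omega q) <= 40 * normc (p - q).
Proof.
rewrite hat_interp (_ : 40 = 4 * 10); last by ring.
by apply: interp_lipschitz => x z; exact: (step_bound alpha2 el hs).
Qed.

(** The interpolation differs from multiplication by [l] by the interpolated displacement. This is
    bounded: it is periodic on the lattice, Lipschitz, and every point lies within distance 2 of a
    lattice point. *)
Lemma hat_coercive : exists B, forall p, l * normc p - B <= normc (hat omega p).
Proof.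
have /andP[l0 l1] := l2; pose u := displacement l omega.
have pu : box_periodic N u by exact: displacement_periodic.
pose M := \sum_(x <- box N) normc (u x).
have uM x : normc (u x) <= M.
  rewrite (lattice_divE N0 x) pu /M (bigD1_seq (site N (index_of N x)))/=; last first.
  - by rewrite (perm_uniq (perm_box N0)) map_inj_in_uniq ?iota_uniq// => a b;
      rewrite !mem_iota/= !add0n => aN bN ab;
      rewrite -(index_of_site N0 aN) ab index_of_site.
  - by rewrite mem_box_site// index_of_lt.
  by rewrite lerDl sumr_ge0// => y _; exact: normc_ge0.
have nl p : normc (l%:C * p) = l * normc p.
  by rewrite normcM /= expr0n/= addr0 sqrtr_sqr ger0_norm//; lra.
have lip : forall p q, normc (interp u p - interp u q) <= 4 * (10 + l) * normc (p - q).
  apply: interp_lipschitz => x z zn; rewrite /u displacementB.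
  rewrite (le_trans (le_normcD _ _))// normcN nl lerD ?(step_bound alpha2 el hs)//.
  by rewrite normc_sqrt sqnorm_emb// sqrtr1 mulr1.
exists (M + 4 * (10 + l) * 2) => p.
have -> : hat omega p = interp u p + l%:C * p.
  by rewrite /u /displacement interp_affine -hat_interp subrK.
suff : normc (interp u p) <= M + 4 * (10 + l) * 2.
  have := le_normcD (interp u p + l%:C * p) (- interp u p).
  by rewrite addrAC subrr add0r normcN nl; lra.
have [s [t ->]] := lat_ptP p.
have [x [v [w [/andP[v0 v1] /andP[w0 w1] [-> ->]]]]] := lat_pt_cell s t.
have ux : interp u (emb R x) = u x.
  by rewrite /interp hat_emb.
have := lip (lat_pt (x.1%:~R + v) (x.2%:~R + w)) (emb R x).
rewrite ux emb_lat_pt lat_ptB ![_ + _ - _]addrAC !subrr !add0r => h.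
have := le_normcD (interp u (lat_pt (x.1%:~R + v) (x.2%:~R + w)) - u x) (u x).
rewrite subrK; have := uM x.
have nb : normc (lat_pt v w) <= 2.
  by rewrite (le_trans (normc_lat_pt _ _))// !ger0_norm//; lra.
have : 4 * (10 + l) * normc (lat_pt v w) <= 4 * (10 + l) * 2.
  by rewrite ler_wpM2l//; lra.
lra.
Qed.

Lemma hat_bijective_rational :
  hat_bijective omega <-> rational_gap (hat omega) /\ rational_density (hat omega).
Proof.
have [B hB] := hat_coercive; have /andP[l0 l1] := l2.
by apply: (bijective_rational (L := 40) _ hat_lipschitz (c := l) _ hB); lra.
Qed.

End bijective.

(** The conditions that are invariant under shifts and translations, separated from the choice of a
    representative, which is not. *)
Definition proper : set tup := [set w | [/\ edge_lengths alpha (conf_of l w),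
  holes_separated (conf_of l w), hat_bijective (conf_of l w)
  & orientation_preserving (conf_of l w)]].

Lemma allowedE : @allowed R alpha l N = @representatives R l N `&` proper.
Proof.
by apply/seteqP; split=> w /=; [move=> [? ? ? ? ?]|move=> [? [? ? ? ?]]].
Qed.

(** The rational conditions are equivalent to bijectivity only in the presence of the edge and hole
    conditions, which give the Lipschitz and coercivity bounds; hence the whole intersection is
    rewritten at once. *)
Lemma measurable_proper : measurable proper.
Proof.
rewrite (_ : proper = [set w | edge_lengths alpha (conf_of l w)] `&`
  [set w | holes_separated (conf_of l w)] `&`
  [set w | orientation_preserving (conf_of l w)] `&`
  ([set w : tup | forall n : nat, [set w | exists k : nat,
     [set w | forall a : rat * rat, [set w | forall b : rat * rat,
       (square n.+1%:R (ratr a.1 : R, ratr a.2 : R) /\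
       square n.+1%:R (ratr b.1 : R, ratr b.2 : R) /\
       n.+1%:R^-1 <= `|(ratr a.1 : R, ratr a.2 : R) - (ratr b.1 : R, ratr b.2 : R)|) ->
       [set w | k.+1%:R^-1 <
         normc (hat (conf_of l w) (rat_pt R a) - hat (conf_of l w) (rat_pt R b))] w] w] w] w] `&`
  [set w : tup | forall b : rat * rat, [set w | forall k : nat, [set w | exists a : rat * rat,
     [set w | normc (hat (conf_of l w) (rat_pt R a) - rat_pt R b) < k.+1%:R^-1] w] w] w])).
  apply: measurableI; first apply: measurableI; first apply: measurableI.
  - exact: measurable_edge_lengths.
  - exact: measurable_holes_separated.
  - exact: measurable_orientation_preserving.
  apply: measurableI.
    apply: measurable_forall => n; apply: measurable_exists => k.
    apply: (@measurable_forall _ _ (rat * rat)%type) => a.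
    apply: (@measurable_forall _ _ (rat * rat)%type) => b.
    apply: measurable_impl; apply: measurable_bool; apply: measurable_fun_ltr.
      exact: measurable_cst.
    by apply/measurable_normc/cmeasurableB; exact: cmeasurable_hat.
  apply: (@measurable_forall _ _ (rat * rat)%type) => b.
  apply: measurable_forall => k; apply: (@measurable_exists _ _ (rat * rat)%type) => a.
  apply: measurable_bool; apply: measurable_fun_ltr; last exact: measurable_cst.
  apply/measurable_normc/cmeasurableB; first exact: cmeasurable_hat.
  exact: cmeasurable_cst.
apply/seteqP; split=> w.
  move=> [el hs hb op]; have qp := conf_of_quasiperiodic l w N0.
  have [gap dens] := (hat_bijective_rational qp el hs).1 hb.
  split; first by []; split => //= n; have [k kP] := gap n; exists k => a b [sa [sb ab]].
  exact: kP.
move=> [[[el hs] op] [gap dens]]; split => //.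
apply/(hat_bijective_rational (conf_of_quasiperiodic l w N0) el hs); split => // n.
by have [k kP] := gap n; exists k => a b sa sb ab; exact: kP.
Qed.

Lemma measurable_allowed : measurable (@allowed R alpha l N).
Proof.
by rewrite allowedE; apply: measurableI; [exact: measurable_representatives|
  exact: measurable_proper].
Qed.

End configurations.

(** * Shift invariance *)

Section configuration_measure.
Variables (R : realType) (N : nat).
Local Notation tup := ((N * N).-tuple (option (R * R))).
Local Notation lambda2 := (product_measure (@lebesgue_measure R) (@lebesgue_measure R)).
Local Notation P := (measurableTypeR R * measurableTypeR R)%type.
Local Open Scope ereal_scope.

(* The library equips [R] with two displays; the integrals of the statement use
   the default one, whereas [lebesgue_measure] lives on [measurableTypeR R].
   The measurable sets are the same. *)
Definition config_measure : set tup -> \bar R :=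
  power_measure (hole_measure lambda2) (N * N).

Let config_measure0 : config_measure set0 = 0.
Proof. exact: measure0. Qed.

Let config_measure_ge0 A : 0 <= config_measure A.
Proof. exact: measure_ge0. Qed.

Let config_measure_semi_sigma_additive : semi_sigma_additive config_measure.
Proof.
exact: (@measure_semi_sigma_additive _ _ _ (power_measure (hole_measure lambda2) (N * N))).
Qed.

HB.instance Definition _ := isMeasure.Build _ tup R config_measure
  config_measure0 config_measure_ge0 config_measure_semi_sigma_additive.

Section transform.
Variables (pi : 'I_(N * N) -> 'I_(N * N)) (v : 'I_(N * N) -> R * R).
Hypothesis bpi : bijective pi.

Definition config_transform : tup -> tup :=
  tuple_transform pi (fun i => otranslate (v i)).

Lemma measurable_config_transform : measurable_fun setT config_transform.
Proof.
exact: (@measurable_tuple_transform _ (option P) _ pi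
  (fun i => otranslate (v i) : option P -> option P)
  (fun i => measurable_otranslate (v i))).
Qed.

Lemma integral_config_transform (f : tup -> \bar R) : measurable_fun setT f ->
  (forall w, 0 <= f w) ->
  \int[config_measure]_w f (config_transform w) = \int[config_measure]_w f w.
Proof.
move=> mf f0; apply: ge0_integral_invariant => //.
- exact: measurable_config_transform.
- exact: (@power_measure_transform _ (option P) R (hole_measure lambda2) (N * N) pi
    (fun i => otranslate (v i) : option P -> option P) bpi
    (fun i => measurable_otranslate (v i))
    (fun i A => @hole_measure_otranslate R (v i) A)).
Qed.

End transform.
End configuration_measure.

(** * Shifts and translations of configurations *)

Section symmetries.
Variable R : realType.
Local Notation C := R[i].
Implicit Type omega : conf R.

Definition shift (y : lattice) omega : conf R := fun x => omega (x + y).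

Definition translation (c : C) omega : conf R := fun x => omap (+%R^~ c) (omega x).

Definition proper_conf (alpha : R) omega := [/\ edge_lengths alpha omega,
  holes_separated omega, hat_bijective omega & orientation_preserving omega].

Lemma hat_site_shift y omega x : hat_site (shift y omega) x = hat_site omega (x + y).
Proof.
rewrite /hat_site/shift; case: (omega (x + y)) => //.
by congr (_ * _); apply: eq_bigr => z _; rewrite addrAC.
Qed.

Lemma interp_shift (g : lattice -> C) y p :
  interp (fun x => g (x + y)) p = interp g (p + emb R y).
Proof.
have [s [t ->]] := lat_ptP p.
have [x [u [v [/andP[u0 u1] /andP[v0 v1] [-> ->]]]]] := lat_pt_cell s t.
have -> : lat_pt (x.1%:~R + u) (x.2%:~R + v) + emb R y =
    lat_pt ((x + y).1%:~R + u) ((x + y).2%:~R + v).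
  by rewrite emb_lat_pt /lat_pt/= !rmorphD/=; ring.
have [vu|/ltW uv] := leP v u.
  by rewrite !interp_lower// ![x + y + _]addrAC.
by rewrite !interp_upper// ![x + y + _]addrAC.
Qed.

Lemma interp_translation (g : lattice -> C) c p :
  interp (fun x => g x + c) p = interp g p + c.
Proof.
have [s [t ->]] := lat_ptP p.
have [x [u [v [/andP[u0 u1] /andP[v0 v1] [-> ->]]]]] := lat_pt_cell s t.
have [vu|/ltW uv] := leP v u.
  by rewrite !interp_lower//; ring.
by rewrite !interp_upper//; ring.
Qed.

Lemma hat_shift y omega p : hat (shift y omega) p = hat omega (p + emb R y).
Proof.
rewrite !hat_interp -interp_shift.
by congr (interp _ _); apply/funext => x; exact: hat_site_shift.
Qed.

Lemma hat_site_translation c omega x : holes_separated omega ->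
  hat_site (translation c omega) x = hat_site omega x + c.
Proof.
move=> hs; rewrite /hat_site/translation; case E : (omega x) => [p|] /=; first by [].
have mean (F G : lattice -> C) : (forall y, y \in nbrs -> G y = F y + c) ->
    6^-1 * (\sum_(y <- nbrs) G y) = 6^-1 * (\sum_(y <- nbrs) F y) + c.
  move=> GF; rewrite big_seq (eq_bigr _ GF) -big_seq big_split/=.
  by rewrite nbrsE !big_cons !big_nil/=; field.
apply: mean => y yn; case E2 : (omega (x + y)) => [q|]; first by [].
by have := hole_nbr hs yn E.
Qed.

Lemma hat_translation c omega p : holes_separated omega ->
  hat (translation c omega) p = hat omega p + c.
Proof.
move=> hs; rewrite !hat_interp -interp_translation.
by congr (interp _ _); apply/funext => x; exact: hat_site_translation.
Qed.

Lemma proper_shift alpha y omega : proper_conf alpha omega ->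
  proper_conf alpha (shift y omega).
Proof.
move=> [el hs [G FK GK] op]; split.
- move=> x x' p q xx' hx hx'; apply: el hx hx'.
  by rewrite /adj !embD opprD addrACA subrr addr0.
- move=> x x' hx hx'; have [/addIr ->|h] := hs _ _ hx hx'; first by left.
  by right; move: h; rewrite !embD opprD addrACA subrr addr0.
- exists (fun p => G p - emb R y) => p; rewrite hat_shift.
    by rewrite FK addrK.
  by rewrite subrK GK.
- move=> x z zn; rewrite !hat_site_shift ![x + _ + y]addrAC; exact: op.
Qed.

Lemma holes_separated_translation c omega : holes_separated omega ->
  holes_separated (translation c omega).
Proof.
move=> hs x x'; rewrite /translation => hx hx'; apply: hs.
  by move: hx; case: (omega x).
by move: hx'; case: (omega x').
Qed.

Lemma proper_translation alpha c omega : proper_conf alpha omega ->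
  proper_conf alpha (translation c omega).
Proof.
move=> [el hs [G FK GK] op]; split.
- move=> x x' p q xx'; rewrite /translation.
  case E : (omega x) => [p'|//] [<-]; case E' : (omega x') => [q'|//] [<-].
  by rewrite opprD addrACA subrr addr0; exact: el E E'.
- exact: holes_separated_translation.
- exists (fun p => G (p - c)) => p; rewrite hat_translation//.
    by rewrite addrK FK.
  by rewrite GK subrK.
- move=> x z zn; rewrite !hat_site_translation//.
  have e (a b : C) : a + c - (b + c) = a - b by ring.
  by rewrite !e; exact: op.
Qed.

Lemma pair_energy_translation V c omega x y :
  pair_energy V (translation c omega x) (translation c omega y) =
  pair_energy V (omega x) (omega y).
Proof.
rewrite /translation; case: (omega x) => [p|//]; case: (omega y) => [q|//] /=.
by rewrite opprD addrACA subrr addr0.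
Qed.

Section tuples.
Variables (l : R) (N : nat).
Hypothesis N0 : (0 < N)%N.
Local Notation tup := ((N * N).-tuple (option (R * R))).

(** A site moved out of the box re-enters at its residue, and quasiperiodicity adds [l * N] times
    the cell it had reached. *)
Definition shift_tuple (y : lattice) : tup -> tup :=
  config_transform (shift_index N0 y)
    (fun k => let c := (l * N%:R)%:C * emb R (cell_of N (site N k + y)) in
      (complex.Re c, complex.Im c)).

Definition translation_tuple (c : C) : tup -> tup :=
  config_transform id (fun=> (complex.Re c, complex.Im c)).

Lemma conf_ofE (w : tup) x : conf_of l w x =
  omap (fun p => (p.1 +i* p.2) + (l * N%:R)%:C * emb R (cell_of N x))
    (tnth w (Ordinal (index_of_lt N0 x))).
Proof. by rewrite (tnth_nth None). Qed.

Lemma conf_of_inj : injective (@conf_of R l N).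
Proof.
move=> w w' e; have [w0 [_ h]] := conf_of_bij N0 (conf_of_quasiperiodic l w N0).
by rewrite -(h w erefl) (h w').
Qed.

Lemma conf_of_shift y w : conf_of l (shift_tuple y w) = shift y (conf_of l w).
Proof.
have tE c (p : R * R) : ((p.1 + complex.Re c) +i* (p.2 + complex.Im c)) = (p.1 +i* p.2) + c.
  by case: c.
apply/funext => x; rewrite /shift !conf_ofE tnth_mktuple.
set i := shift_index _ _ _; set j := Ordinal (index_of_lt _ (_ + _)).
have -> : i = j by apply: val_inj; rewrite /= index_of_shift.
have -> : cell_of N (x + y) = cell_of N x + cell_of N (site N (index_of N x) + y).
  by rewrite [RHS]addrC -(cell_ofDMn N0) addrAC -(lattice_divE N0).
case: (tnth w j) => [p|//]; congr Some.
pose d := (l * N%:R)%:C * emb R (cell_of N (site N (index_of N x) + y)).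
transitivity (((p.1 + complex.Re d) +i* (p.2 + complex.Im d))
  + (l * N%:R)%:C * emb R (cell_of N x)); first by [].
by rewrite tE embD /d; ring.
Qed.

Lemma conf_of_translation c w : conf_of l (translation_tuple c w) =
  translation c (conf_of l w).
Proof.
apply/funext => x; rewrite /translation !conf_ofE tnth_mktuple/=.
case: (tnth w _) => //= p; congr Some; rewrite addrAC; congr (_ + _).
by case: c.
Qed.

Lemma lex_lt_site j k : (j < N * N)%N -> (k < N * N)%N ->
  lex_lt (site N j) (site N k) = (j < k)%N.
Proof.
move=> jN kN; rewrite /lex_lt/site/= !ltz_nat eqz_nat.
rewrite [in RHS](divn_eq j N) [in RHS](divn_eq k N).
have := ltn_pmod j N0; have := ltn_pmod k N0.
move: (j %/ N)%N (j %% N)%N (k %/ N)%N (k %% N)%N => a b c d dN bN.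
have [ac|ca|->] := ltngtP a c; last by rewrite ltn_add2l.
  have : (a.+1 * N <= c * N)%N by rewrite leq_mul2r ac orbT.
  by rewrite mulSn => h; apply/esym; lia.
have : (c.+1 * N <= a * N)%N by rewrite leq_mul2r ca orbT.
by rewrite mulSn => h; apply/esym/negbTE; rewrite -leqNgt; lia.
Qed.

(** For N > 1 the first two sites of the box are neighbours, so they cannot both be holes. *)
Lemma first_site (w : tup) : (1 < N)%N -> holes_separated (conf_of l w) ->
  exists2 k, (k < N * N)%N &
  conf_of l w (site N k) <> None /\
  forall j, (j < k)%N -> conf_of l w (site N j) = None.
Proof.
move=> N2 hs.
have ex : exists k, (k < N * N)%N && (conf_of l w (site N k) != None).
  have [h0|h0] := eqVneq (conf_of l w (site N 0)) None.
    exists 1%N; apply/andP; split; first by nia.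
    apply/negP => /eqP h1.
    have zn : (0, 1) \in nbrs by [].
    apply: (hole_nbr hs zn h0).
    by move: h1; rewrite /site divn_small// modn_small// div0n mod0n.
  by exists 0%N; rewrite muln_gt0 N0.
have [k /andP[kN hk] kmin] := ex_minnP ex; exists k => //; split; first exact/eqP.
move=> j jk; apply/eqP/negPn/negP => hj.
have := kmin j; rewrite hj (ltn_trans jk kN) => /(_ isT).
by rewrite leqNgt jk.
Qed.

Lemma representatives_first (w : tup) k p : (k < N * N)%N -> conf_of l w (site N k) = Some p ->
  (forall j, (j < k)%N -> conf_of l w (site N j) = None) ->
  representatives l w <-> fundamental_domain l N p.
Proof.
move=> kN kp hk; split=> [h|h x q xb xq hx].
  apply: (h (site N k) p) => //; first exact: mem_box_site.
  move=> y yb; rewrite -(site_box N0 yb) lex_lt_site ?index_of_lt//.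
  exact: hk.
have iN := index_of_lt N0 x; move: xq hx; rewrite -(site_box N0 xb).
set i := index_of N x in iN *; move=> xq hx.
have [ik|ki|ik] := ltngtP i k.
- by move: xq; rewrite hk.
- by move: (hx (site N k)); rewrite kp mem_box_site// lex_lt_site// ki => /(_ isT isT).
- by move: xq; rewrite ik kp => -[<-].
Qed.

Section observables.
Variables (alpha : R) (V : R -> R) (beta m : R).
Hypothesis alpha2 : alpha <= 2^-1.
Hypothesis l2 : 2^-1 < l < 3 / 2.
Hypothesis mV : measurable_fun setT V.

Lemma measurable_pair_energy x y :
  measurable_fun setT (fun w : tup => pair_energy V (conf_of l w x) (conf_of l w y)).
Proof.
rewrite (_ : (fun w => _) = (fun w : tup =>
  if (conf_of l w x == None) || (conf_of l w y == None) then 0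
  else V (normc (odflt 0 (conf_of l w x) - odflt 0 (conf_of l w y))))); last first.
  by apply/funext => w; case: (conf_of l w x) => [p|//]; case: (conf_of l w y).
apply: measurable_fun_ifT; last first.
- apply: (measurableT_comp mV).
  by apply/measurable_normc/cmeasurableB; exact: cmeasurable_conf.
- exact: measurable_cst.
- by apply: measurable_or; exact: measurable_conf_hole.
Qed.

Lemma measurable_boltzmann : measurable_fun setT (@boltzmann R V l N beta m).
Proof.
apply: (measurableT_comp (f := @expR R)); first exact: measurable_expR.
apply: (measurableT_comp (f := @GRing.opp R)) => //.
apply: measurable_funM; first exact: measurable_cst.
apply: measurable_funD; (apply: measurable_funM; first exact: measurable_cst).
  apply: measurable_sum => x; apply: measurable_sum => z; exact: measurable_pair_energy.
apply: measurable_sum => x.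
apply: (measurableT_comp (f := fun b : bool => b%:R : R)) => //.
exact: measurable_conf_hole.
Qed.

Definition sq_deviation (x z : lattice) (w : tup) : R :=
  normc (hat_site (conf_of l w) (x + z) - hat_site (conf_of l w) x - l%:C * emb R z) ^+ 2.

Lemma measurable_sq_deviation x z : measurable_fun setT (sq_deviation x z).
Proof.
apply: measurable_funX; apply/measurable_normc/cmeasurableB; last exact: cmeasurable_cst.
by apply: cmeasurableB; exact: cmeasurable_hat_site.
Qed.

Lemma hamiltonian_shift y w : hamiltonian V l m (shift_tuple y w) = hamiltonian V l m w.
Proof.
have qp := conf_of_quasiperiodic l w N0.
rewrite /hamiltonian conf_of_shift; congr (_ * _ + _ * _).
  pose F x := \sum_(z <- nbrs) pair_energy V (conf_of l w x) (conf_of l w (x + z)).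
  transitivity (\sum_(x <- box N) F (x + y)).
    by apply: eq_bigr => x _; apply: eq_bigr => z _; rewrite /shift [x + z + y]addrAC.
  apply: (box_sum_shift N0) => x z; apply: eq_bigr => z' _; rewrite addrAC !qp.
  exact: (pair_energy_translation V _ (conf_of l w)).
apply: (box_sum_shift N0 (F := fun x => (conf_of l w x == None)%:R)) => x z.
by rewrite qp; case: (conf_of l w x).
Qed.

Lemma hamiltonian_translation c w :
  hamiltonian V l m (translation_tuple c w) = hamiltonian V l m w.
Proof.
rewrite /hamiltonian conf_of_translation; congr (_ * _ + _ * _).
  by apply: eq_bigr => x _; apply: eq_bigr => z _; exact: pair_energy_translation.
by apply: eq_bigr => x _; rewrite /translation; case: (conf_of l w x).
Qed.

Lemma proper_shift_tuple y w :
  proper alpha l (shift_tuple y w) <-> proper alpha l w.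
Proof.
have E : proper alpha l w = proper_conf alpha (conf_of l w) by [].
rewrite -[proper _ _ (shift_tuple y w)]/(proper_conf alpha (conf_of l (shift_tuple y w))).
rewrite conf_of_shift E; split; last exact: proper_shift.
move=> /(proper_shift (- y)); congr (proper_conf _ _).
by apply/funext => x; rewrite /shift subrK.
Qed.

Lemma proper_translation_tuple c w :
  proper alpha l (translation_tuple c w) <-> proper alpha l w.
Proof.
have E : proper alpha l w = proper_conf alpha (conf_of l w) by [].
rewrite -[proper _ _ (translation_tuple c w)]
  /(proper_conf alpha (conf_of l (translation_tuple c w))).
rewrite conf_of_translation E; split; last exact: proper_translation.
move=> /(proper_translation (- c)); congr (proper_conf _ _).
apply/funext => x; rewrite /translation.
by case: (conf_of l w x) => //= p; rewrite addrK.
Qed.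

Hypothesis N2 : (1 < N)%N.

(** In lattice coordinates both components are reduced modulo [l * N] independently, by minus the
    integer part of the quotient. *)
Lemma fundamental_domain_unique (p : C) : exists! v : int * int,
  fundamental_domain l N (p + (l * N%:R)%:C * emb R v).
Proof.
have /andP[l0 _] := l2; have L0 : 0 < l * N%:R by rewrite mulr_gt0 ?ltr0n//; lra.
set L := l * N%:R in L0 *.
have [s [t ->]] := lat_ptP p.
have E v : lat_pt s t + L%:C * emb R v = lat_pt (s + L * v.1%:~R) (t + L * v.2%:~R).
  by rewrite emb_lat_pt /lat_pt !rmorphD/= !rmorphM/=; ring.
have FD a b : fundamental_domain l N (lat_pt a b) <->
    (0 <= a < L) /\ (0 <= b < L).
  split=> [[a' [b' [ha hb e]]]|[ha hb]]; last first.
    by exists a, b; split=> //; rewrite /lat_pt mulrC.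
  have : lat_pt a b = lat_pt a' b' by rewrite e /lat_pt mulrC.
  by move=> /(@pt_inj R (a, b) (a', b'))[-> ->].
have fl (a : R) (n : int) : (0 <= a + L * n%:~R < L) <-> n = - Num.floor (a / L).
  split=> [/andP[h1 h2]|->].
    have : Num.floor (a / L) = - n.
      apply: floor_def; rewrite rmorphD/= rmorphN/=; apply/andP; split.
        by rewrite ler_pdivlMr// mulrC; lra.
      by rewrite ltr_pdivrMr// mulrC; lra.
    by move=> ->; rewrite opprK.
  have := floor_itv (a / L); rewrite rmorphD/= rmorphN/=.
  rewrite ler_pdivlMr// ltr_pdivrMr// => /andP[h1 h2].
  by apply/andP; split; lra.
exists (- Num.floor (s / L), - Num.floor (t / L)); split.
  by rewrite E; apply/FD; split; apply/fl.
by move=> [v1 v2]; rewrite E => /FD[/fl /= -> /fl /= ->].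
Qed.

Lemma translation_unique w : proper alpha l w -> exists! v : int * int,
  representatives l (translation_tuple ((l * N%:R)%:C * emb R v) w).
Proof.
move=> [_ hs _ _]; have [k kN [hk hj]] := first_site N2 hs.
case E : (conf_of l w (site N k)) hk => [p|//] _.
have [v [hv vu]] := fundamental_domain_unique p.
have R_ u : representatives l (translation_tuple ((l * N%:R)%:C * emb R u) w) <->
    fundamental_domain l N (p + (l * N%:R)%:C * emb R u).
  apply: (representatives_first kN); rewrite conf_of_translation /translation.
    by rewrite E.
  by move=> j /hj ->.
by exists v; split; [exact/R_|move=> u /R_ /vu].
Qed.

Lemma shift_translation_tuple y c w :
  shift_tuple y (translation_tuple c w) = translation_tuple c (shift_tuple y w).
Proof.
by apply: conf_of_inj; rewrite conf_of_shift !conf_of_translation conf_of_shift.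
Qed.

Lemma shift_tupleK y w : shift_tuple (- y) (shift_tuple y w) = w.
Proof.
apply: conf_of_inj; rewrite !conf_of_shift; apply/funext => x.
by rewrite /shift addrNK.
Qed.

Lemma translation_tupleD c c' w :
  translation_tuple c (translation_tuple c' w) = translation_tuple (c' + c) w.
Proof.
apply: conf_of_inj; rewrite !conf_of_translation; apply/funext => x.
by rewrite /translation; case: (conf_of l w x) => //= p; rewrite addrA.
Qed.

Lemma translation_tuple0 w : translation_tuple 0 w = w.
Proof.
apply: conf_of_inj; rewrite conf_of_translation; apply/funext => x.
by rewrite /translation; case: (conf_of l w x) => //= p; rewrite addr0.
Qed.

Local Open Scope ereal_scope.

(** The shift by [x] carries the observable at [x] to the one at the origin, and the representatives
    to another fundamental domain of the translations by l N A_2. The integrand is translation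
    invariant, so both domains give the same integral. *)
Lemma integral_allowed_shift x z :
  \int[@config_measure R N]_(w in @allowed R alpha l N)
    (sq_deviation x z w * boltzmann V l beta m w)%:E =
  \int[@config_measure R N]_(w in @allowed R alpha l N)
    (sq_deviation (0 : lattice)%R z w * boltzmann V l beta m w)%:E.
Proof.
have mQ := measurable_proper N0 alpha2 l2.
have mD := measurable_representatives l N0.
pose g0 w :=
    (sq_deviation (0 : lattice)%R z w * boltzmann V l beta m w)%:E.
have mg0 : measurable_fun setT g0.
  apply/measurable_EFinP/measurable_funM; first exact: measurable_sq_deviation.
  exact: measurable_boltzmann.
have g00 w : 0 <= g0 w.
  by rewrite lee_fin mulr_ge0// ?sqr_ge0// expR_ge0.
(* Cutting off outside [proper] makes the integrand translation invariant everywhere: the value at a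
   hole is translated correctly only if its neighbours are occupied. *)
pose g := g0 \_ (@proper R alpha l N).
have mg : measurable_fun setT g.
  by apply/(measurable_restrictT _ _).1 => //; exact: measurable_funS mg0.
have gge0 w : 0 <= g w by apply: erestrict_ge0.
pose D1 : set tup := [set w | representatives l (shift_tuple (- x)%R w)].
have mD1 : measurable D1.
  rewrite -[X in measurable X]setTI; apply: measurable_config_transform => //.
have e1 : \int[@config_measure R N]_(w in @allowed R alpha l N)
    (sq_deviation x z w * boltzmann V l beta m w)%:E =
    \int[@config_measure R N]_(w in D1 `&` @proper R alpha l N) g w.
  rewrite allowedE integral_mkcond [RHS]integral_mkcond.
  rewrite -[RHS](integral_config_transform
    (fun k => let c := ((l * N%:R)%:C * emb R (cell_of N (site N k + x)))%R in
      (complex.Re c, complex.Im c)) (shift_index_bij N0 x)).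
  - apply: eq_integral => w _; rewrite !patchE -[config_transform _ _ w]/(shift_tuple x w).
    have -> : (shift_tuple x w \in D1 `&` @proper R alpha l N) =
        (w \in @representatives R l N `&` @proper R alpha l N).
      by apply/idP/idP; rewrite !inE /D1/= shift_tupleK => -[h /proper_shift_tuple].
    case: ifPn => //; rewrite inE => -[_ Qw]; rewrite /g patchE mem_set; last first.
      exact/proper_shift_tuple.
    rewrite /g0 /sq_deviation /boltzmann hamiltonian_shift conf_of_shift.
    by rewrite !hat_site_shift !add0r (addrC z).
  - apply/(measurable_restrictT _ _).1; first exact: measurableI.
    exact: measurable_funS mg.
  - by move=> w; exact: erestrict_ge0.
have e2 : \int[@config_measure R N]_(w in @allowed R alpha l N) g0 w =
    \int[@config_measure R N]_(w in @representatives R l N `&` @proper R alpha l N) g w.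
  rewrite allowedE; apply: eq_integral => w; rewrite inE => -[_ Qw].
  by rewrite /g patchE mem_set.
rewrite e1 e2.
apply: (@integral_fundamental_domains _ _ R (int * int)%type _
  (fun v => translation_tuple ((l * N%:R)%:C * emb R v)%R)
  (fun v => translation_tuple (- ((l * N%:R)%:C * emb R v))%R)) => //.
- by move=> v; exact: measurable_config_transform.
- by move=> v; exact: measurable_config_transform.
- by move=> v w; rewrite translation_tupleD subrr translation_tuple0.
- move=> v f mf f0; apply: integral_config_transform => //; exact: (Bijective (g := id)).
- move=> v w; rewrite /g !patchE.
  have -> : (translation_tuple ((l * N%:R)%:C * emb R v)%R w \in @proper R alpha l N) =
      (w \in @proper R alpha l N).
    by apply/idP/idP; rewrite !inE => /proper_translation_tuple.
  case: ifPn => //; rewrite inE => -[_ hs _ _].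
  rewrite /g0 /sq_deviation /boltzmann hamiltonian_translation conf_of_translation.
  rewrite !hat_site_translation//; congr (_ * _)%:E; congr (normc (_ - _) ^+ 2)%R.
  by rewrite opprD addrACA subrr addr0.
- by move=> v w; exact: proper_translation_tuple.
- move=> w /(proper_shift_tuple (- x)%R)/translation_unique[u [hu uu]].
  have E v : D1 (translation_tuple (- ((l * N%:R)%:C * emb R v))%R w) <->
      representatives l (translation_tuple ((l * N%:R)%:C * emb R (- v))%R (shift_tuple (- x)%R w)).
    by rewrite embN mulrN -shift_translation_tuple.
  exists (- u)%R; split; first by apply/E; rewrite opprK.
  by move=> v /E /uu ->; rewrite opprK.
- by move=> w /translation_unique.
Qed.

End observables.
End tuples.
End symmetries.

(** * Volume of the set of allowed configurations *)

Section integral_monotone.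
Context d (T : measurableType d) (R : realType) (mu : {measure set T -> \bar R}).
Local Open Scope ereal_scope.

(** The integral of a nonnegative function is a supremum over the simple functions below it, so
    enlarging the function enlarges the supremum. It serves for section volumes of arbitrary sets in
    [cons_volume]. *)
Lemma ge0_le_integralT (f g : T -> \bar R) : (forall x, 0 <= f x) ->
  (forall x, f x <= g x) -> \int[mu]_x f x <= \int[mu]_x g x.
Proof.
move=> f0 fg; have g0 x : 0 <= g x by exact: le_trans (fg x).
rewrite !ge0_integralTE//; apply: le_ereal_sup => _ [h hf <-].
by exists h => // x; exact: le_trans (fg x).
Qed.

End integral_monotone.

(** * Volume of chains in which each particle is close to the previous one *)

Section chains.
Variable R : realType.
Local Notation lambda2 := (product_measure (@lebesgue_measure R) (@lebesgue_measure R)).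
Local Notation P := (measurableTypeR R * measurableTypeR R)%type.
Local Notation pm := (power_measure (hole_measure lambda2)).

Definition near_pt (D : R) (p q : R * R) : Prop :=
  (`|p.1 - q.1| <= D) /\ (`|p.2 - q.2| <= D).

Lemma lambda2_near (D : R) (q : R * R) : 0 <= D ->
  measurable ([set p | near_pt D p q] : set P) /\
  lambda2 [set p | near_pt D p q] = (4 * D ^+ 2)%:E.
Proof.
move=> D0.
have -> : [set p | near_pt D p q] =
    `[q.1 - D, q.1 + D]%classic `*` `[q.2 - D, q.2 + D]%classic.
  by apply/seteqP; split=> p /=; rewrite /near_pt !in_itv/= -!ler_distl.
split; first exact: measurableX.
rewrite /product_measure product_measure1E//= !lebesgue_measure_itv/= !lte_fin.
have [D00|D1] := eqVneq D 0.
  by rewrite D00 !subr0 !addr0 !ltxx mule0 expr0n mulr0.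
have Dp : 0 < D by rewrite lt_neqAle eq_sym D1.
rewrite !ifT; [|lra..].
by rewrite -!EFinB -EFinM; congr EFin; ring.
Qed.

(** The power measure integrates the volume of sections over the first coordinate: the hole is an
    atom of mass 1, and a particle is confined to a square of side 2 D. *)
Lemma cons_volume n (A : set (n.+1.-tuple (option P))) (D c0 c1 : R) (q : R * R) :
  0 <= D -> 0 <= c0 -> 0 <= c1 ->
  (pm n [set t | A (Defs.cons_tuple (None, t))] <= c0%:E)%E ->
  (forall p, near_pt D p q -> (pm n [set t | A (Defs.cons_tuple (Some p, t))] <= c1%:E)%E) ->
  (forall p t, A (Defs.cons_tuple (Some p, t)) -> near_pt D p q) ->
  (pm n.+1 A <= (c0 + c1 * (4 * D ^+ 2))%:E)%E.
Proof.
move=> D0 c00 c10 hN hS hA; have [mD lD] := lambda2_near q D0.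
pose B : set (option P) := Some @` [set p | near_pt D p q].
have BE : Some @^-1` B = [set p | near_pt D p q].
  by apply/seteqP; split=> p /= => [[p' h [<-]]|h] //; exists p.
rewrite -BE in mD lD; have mB : measurable B by exact: mD.
have mNone : measurable ([set None] : set (option P)).
  suff : measurable (Some @^-1` [set None] : set P) by [].
  by rewrite (_ : _ @^-1` _ = set0) ?measurable0//; apply/seteqP; split.
have -> : pm n.+1 A = (\int[hole_measure lambda2]_a pm n [set t | A (Defs.cons_tuple (a, t))])%E.
  transitivity (\int[hole_measure lambda2]_a
      (pm n \o xsection (@Defs.cons_tuple (option P) n @^-1` A)) a)%E; first by [].
  by apply: eq_integral => a _ /=; congr (pm n _); apply/seteqP; split=> t /=;
    rewrite /xsection/= inE.
have m0 (c : R) (E : set (option P)) : 0 <= c -> measurable E ->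
    measurable_fun setT (fun a => c%:E * (\1_E a)%:E)%E /\
    (\int[hole_measure lambda2]_a (c%:E * (\1_E a)%:E) = c%:E * hole_measure lambda2 E)%E.
  move=> c0' mE; have mi : measurable_fun setT (fun a : option P => (\1_E a)%:E : \bar R).
    by apply/measurable_EFinP; exact: measurable_indic.
  split; first by apply: emeasurable_funM => //; exact: measurable_cst.
  by rewrite ge0_integralZl_EFin// integral_indic// setIT.
have [mf1 i1] := m0 _ _ c00 mNone; have [mf2 i2] := m0 _ _ c10 mB.
apply: (@le_trans _ _ (\int[hole_measure lambda2]_a
    (c0%:E * (\1_[set None] a)%:E + c1%:E * (\1_B a)%:E))%E).
  apply: ge0_le_integralT => [a|a]; first exact: measure_ge0.
  case: a => [p|].
    rewrite [X in (_ <= _ * X + _)%E](_ : _ = 0%E); last first.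
      by rewrite indicE memNset.
    rewrite mule0 add0e.
    have [np|nnp] := pselect (near_pt D p q).
      by rewrite indicE mem_set ?mule1 ?hS//; exists p.
    rewrite (_ : [set t | _] = set0) ?measure0.
      by rewrite mule_ge0// lee_fin.
    by apply/seteqP; split=> t //= /hA.
  rewrite indicE mem_set// mule1 indicE memNset ?mule0 ?adde0//.
  by case.
have pos (c : R) (E : set (option P)) : 0 <= c ->
    forall a, setT a -> (0 <= c%:E * (\1_E a)%:E)%E.
  by move=> c0' a _; rewrite mule_ge0// lee_fin.
rewrite (ge0_integralD (hole_measure lambda2) measurableT (pos _ _ c00) mf1 (pos _ _ c10) mf2).
rewrite i1 i2 /hole_measure !diracE mem_set// memNset; last by case.
have lN : lambda2 (Some @^-1` [set None]) = 0%E.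
  by rewrite (_ : Some @^-1` [set None] = set0) ?measure0//; apply/seteqP; split.
rewrite [X in (_ * (X + _) + _ <= _)%E]lN [X in (_ + _ * (X + _) <= _)%E]lD.
by rewrite add0e adde0 mule1 -EFinM -EFinD.
Qed.

Variables (o : nat -> R * R) (D a : R).
Hypotheses (D1 : 1 <= D) (a0 : 0 <= a).

(* [o k] stands for the shift of the [k]-th site due to quasiperiodicity; holes
   are skipped. *)
Fixpoint chain (k : nat) (p : R * R) (s : seq (option (R * R))) : Prop :=
  match s with
  | [::] => True
  | None :: s' => chain k.+1 p s'
  | Some q :: s' => near_pt D (translate (o k) q) p /\ chain k.+1 (translate (o k) q) s'
  end.

(** The first particle has no predecessor to confine it; the radius [a] will come from the
    fundamental domain. *)
Fixpoint start (k : nat) (s : seq (option (R * R))) : Prop :=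
  match s with
  | [::] => True
  | None :: s' => start k.+1 s'
  | Some q :: s' => near_pt a q (0, 0) /\ chain k.+1 (translate (o k) q) s'
  end.

Let D0 : 0 <= D. Proof. exact: le_trans ler01 D1. Qed.

Let K : R := 1 + 4 * D ^+ 2.

Let K0 : 0 <= K.
Proof. by rewrite addr_ge0// mulr_ge0// sqr_ge0. Qed.

Lemma chain_volume n k p (A : set (n.-tuple (option P))) :
  (forall t, A t -> chain k p t) -> (pm n A <= (K ^+ n)%:E)%E.
Proof.
elim: n k p A => [|n IH] k p A hA.
  by rewrite expr0 /= diracE lee_fin; case: (_ \in _).
pose q : R * R := (p.1 - (o k).1, p.2 - (o k).2).
have nq r : near_pt D (translate (o k) r) p <-> near_pt D r q.
  rewrite /near_pt/translate/q/=.
  have -> : r.1 - (p.1 - (o k).1) = r.1 + (o k).1 - p.1 by ring.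
  by have -> : r.2 - (p.2 - (o k).2) = r.2 + (o k).2 - p.2 by ring.
rewrite exprS {1}/K mulrDl mul1r [_ * K ^+ n]mulrC.
have Kn : 0 <= K ^+ n by rewrite exprn_ge0.
apply: (@cons_volume _ _ _ _ _ q) => //.
- by apply: (IH k.+1 p) => t; exact: hA.
- by move=> r _; apply: (IH k.+1 (translate (o k) r)) => t /hA[].
- by move=> r t /hA /= [/nq].
Qed.

(** The first coordinate is a hole, and the search for a first particle goes on, or that particle,
    followed by a chain. The two contributions are at most twice the bound for length [n], and 2 <=
    K pays for the doubling. *)
Lemma start_volume n k (A : set (n.-tuple (option P))) :
  (forall t, A t -> start k t) -> (pm n A <= ((1 + 4 * a ^+ 2) * K ^+ n)%:E)%E.
Proof.
have A0 : 0 <= 1 + 4 * a ^+ 2 by rewrite addr_ge0// mulr_ge0// sqr_ge0.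
elim: n k A => [|n IH] k A hA.
  rewrite expr0 mulr1 /= diracE lee_fin; have := sqr_ge0 a.
  by case: (_ \in _) => /=; lra.
have Kn : 0 <= K ^+ n by rewrite exprn_ge0.
apply: (@le_trans _ _ ((1 + 4 * a ^+ 2) * K ^+ n + K ^+ n * (4 * a ^+ 2))%:E).
  apply: (@cons_volume _ _ _ _ _ (0, 0)) => //; first by rewrite mulr_ge0.
  - by apply: (IH k.+1) => t; exact: hA.
  - by move=> r _; apply: (@chain_volume n k.+1 (translate (o k) r)) => t /hA[].
  - by move=> r t /hA /= [].
rewrite lee_fin [K ^+ n.+1]exprS.
have K2 : 2 <= K.
  rewrite /K; have : 1 <= D ^+ 2 by rewrite expr_ge1.
  lra.
have H := ler_wpM2r (mulr_ge0 A0 Kn) K2.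
apply: (@le_trans _ _ (2 * ((1 + 4 * a ^+ 2) * K ^+ n))).
  by rewrite -subr_ge0 (_ : _ - _ = K ^+ n)//; move: (K ^+ n) => x; ring.
by rewrite (le_trans H)// mulrCA.
Qed.

End chains.

Section allowed_volume.
Variables (R : realType) (alpha l : R) (N : nat).
Local Notation C := R[i].
Local Notation tup := ((N * N).-tuple (option (R * R))).
Hypothesis N2 : (1 < N)%N.
Hypothesis alpha2 : alpha <= 2^-1.
Hypothesis l2 : 2^-1 < l < 3 / 2.

Let N0 : (0 < N)%N. Proof. exact: ltn_trans N2. Qed.

(* The sites of the box, lifted so that consecutive ones are neighbours. *)
Definition lifted_site (k : nat) : lattice := ((k %/ N)%N : int, k : int).

Definition lift_offset (k : nat) : R * R :=
  let c : C := (l * N%:R)%:C * emb R (0, (k %/ N)%N : int) in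
  (complex.Re c, complex.Im c).

Lemma lifted_siteE k : lifted_site k = site N k + ((0, (k %/ N)%N : int) : lattice) *+ N.
Proof.
rewrite mulrn_lattice; apply: injective_projections => /=.
  by rewrite mul0r addr0.
by rewrite {1}(divn_eq k N) addnC PoszD PoszM.
Qed.

(** Within a row the step is (0, 1). At the end of a row the second coordinate keeps growing instead
    of returning to 0, so the step is (1, 1), which embeds as tau. *)
Lemma lifted_siteS k : exists2 z, z \in nbrs & lifted_site k.+1 = lifted_site k + z.
Proof.
rewrite /lifted_site divnS//; have kS : (k.+1 : int) = (k : int) + 1.
  by rewrite -addn1 PoszD.
case: (N %| k.+1)%N.
  by exists (1, 1) => //; apply: injective_projections => //=; rewrite PoszD addrC.
by exists (0, 1) => //; apply: injective_projections; rewrite //= add0n addr0.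
Qed.

Definition complex_of (p : R * R) : C := p.1 +i* p.2.

Lemma conf_of_site (w : tup) k : (k < N * N)%N ->
  conf_of l w (site N k) = omap complex_of (nth None w k).
Proof.
move=> kN; rewrite (conf_ofE l N0) (tnth_nth None)/= index_of_site// cell_of_site//.
case: nth => //= p; congr Some; rewrite /emb/= mul0r addr0 mulr0 addr0.
by [].
Qed.

Lemma conf_of_lifted (w : tup) k : (k < N * N)%N ->
  conf_of l w (lifted_site k) =
  omap (fun p => complex_of (translate (lift_offset k) p)) (nth None w k).
Proof.
move=> kN; rewrite lifted_siteE (conf_of_quasiperiodic l w N0) conf_of_site//.
case: nth => //= p; congr Some; rewrite /complex_of /translate /lift_offset.
move: (_ * emb R _) => c /=; case: c => a b.
by [].
Qed.

Section chain.
Variable w : tup.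
Hypothesis el : edge_lengths alpha (conf_of l w).
Hypothesis hs : holes_separated (conf_of l w).

Local Notation phi k := (hat_site (conf_of l w) (lifted_site k)).

Let phi_step k : normc (phi k.+1 - phi k) <= 10.
Proof. by have [z zn ->] := lifted_siteS k; exact: step_bound alpha2 el hs _ _ zn. Qed.

Let holeS k : conf_of l w (lifted_site k) = None -> conf_of l w (lifted_site k.+1) <> None.
Proof. by have [z zn ->] := lifted_siteS k; exact: hole_nbr. Qed.

(** [p] is the last particle met. Since two consecutive sites of the path are never both holes, it
    lies at most two steps of length 10 back, and only one step back if the current site is a
    hole. *)
Lemma chain_conf n k p : (k + n = N * N)%N ->
  normc (complex_of p - phi k) <= 20 ->
  (conf_of l w (lifted_site k) = None -> normc (complex_of p - phi k) <= 10) ->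
  chain lift_offset 20 k p (drop k w).
Proof.
elim: n k p => [|n IH] k p kn h20 h10.
  by rewrite drop_oversize// size_tuple -kn addn0.
have kN : (k < N * N)%N by rewrite -kn addnS ltnS leq_addr.
rewrite (drop_nth None) ?size_tuple//.
have := conf_of_lifted w kN; case: (nth None w k) => [q|] /= E.
  have phik := hat_site_Some E; split.
    move: (le_normc_Re (complex_of p - phi k)) (le_normc_Im (complex_of p - phi k)).
    rewrite phik in h20 *; rewrite /= => h1 h2; split; rewrite distrC.
      exact: le_trans h20.
    exact: le_trans h20.
  apply: IH; rewrite ?addSnnS// -phik => *.
    by rewrite -normcN opprB (le_trans (phi_step k))// ler_nat.
  by rewrite -normcN opprB phi_step.
apply: IH; rewrite ?addSnnS//.
  rewrite (le_trans (normc_dist_triangle (phi k) _ _))//.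
  have := h10 E; have := phi_step k; rewrite -[normc (phi k - _)]normcN opprB; lra.
by move=> /(holeS E).
Qed.

Lemma start_conf n k : (k + n = N * N)%N -> representatives l w ->
  (forall j, (j < k)%N -> conf_of l w (site N j) = None) ->
  start lift_offset 20 (l * N%:R) k (drop k w).
Proof.
elim: n k => [|n IH] k kn rw hk.
  by rewrite drop_oversize// size_tuple -kn addn0.
have kN : (k < N * N)%N by rewrite -kn addnS ltnS leq_addr.
rewrite (drop_nth None) ?size_tuple//.
have := conf_of_lifted w kN; have := conf_of_site w kN.
case: (nth None w k) => [q|] /= E E'.
  split.
    have [s [t [hs' ht e]]] : fundamental_domain l N (complex_of q) :=
      (representatives_first N0 kN E hk).1 rw.
    have s3 : Num.sqrt 3 <= 2 :> R.
      by rewrite -(@ler_pXn2r _ 2)// ?nnegrE ?sqrtr_ge0// sqr_sqrt3 -natrX ler_nat.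
    have s30 := sqrtr_ge0 (3 : R).
    have q1 : q.1 = s - t / 2.
      by have := congr1 (@complex.Re R) e; rewrite tau_sqr tauE /= => ->; field.
    have q2 : q.2 = t * (Num.sqrt 3 / 2).
      by have := congr1 (@complex.Im R) e; rewrite tau_sqr tauE /= => ->; field.
    rewrite /near_pt /= !subr0 q1 q2 !ler_norml; move: hs' ht => /andP[hs0 hs1] /andP[ht0 ht1].
    by split; apply/andP; split; nra.
  apply: (@chain_conf n); rewrite ?addSnnS// -(hat_site_Some E') => *.
    by rewrite -normcN opprB (le_trans (phi_step k))// ler_nat.
  by rewrite -normcN opprB phi_step.
apply: IH; rewrite ?addSnnS// => j; rewrite ltnS leq_eqVlt => /predU1P[->//|].
exact: hk.
Qed.

End chain.

(** The factor 1 + 4 (l N)^2 for the first particle is at most 10 N^2, and hence at most 10 * 2 ^ (N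
    * N), so a factor 20 per site absorbs it. *)
Lemma allowed_volume :
  (@config_measure R N (@allowed R alpha l N) <=
    ((20 * (1 + 4 * 20 ^+ 2)) ^+ (N * N))%:E)%E.
Proof.
have /andP[l0 l1] := l2.
have aL : 0 <= l * N%:R by rewrite mulr_ge0//; lra.
have D1 : 1 <= 20 :> R by rewrite ler1n.
apply: (@le_trans _ _ ((1 + 4 * (l * N%:R) ^+ 2) * (1 + 4 * 20 ^+ 2) ^+ (N * N))%:E).
  apply: (@start_volume R lift_offset 20 (l * N%:R) D1 aL (N * N) 0) => w [rw el hs _ _].
  by rewrite -[tval w]drop0; apply: (@start_conf w el hs (N * N)).
rewrite lee_fin [leRHS]exprMn ler_wpM2r//.
have NN : (N * N)%:R <= 2 ^+ (N * N) :> R by rewrite -natrX ler_nat ltnW// ltn_expl.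
have p10 : 10 <= 10 ^+ (N * N) :> R.
  by rewrite -[leLHS]expr1 ler_weXn2l ?ler1n// muln_gt0 N0.
have N1 : 1 <= (N * N)%:R :> R by rewrite ler1n muln_gt0 N0.
have -> : (20 : R) = 10 * 2 by ring.
rewrite [leRHS]exprMn (@le_trans _ _ (10 * (N * N)%:R))//; last first.
  by rewrite ler_pM.
have l94 : l ^+ 2 <= 9 / 4 by nra.
have := ler_wpM2r (le_trans ler01 N1) l94; rewrite exprMn -natrX -mulnn; lra.
Qed.

End allowed_volume.

(** * Configurations near the lattice *)

Section near_lattice.
Variables (R : realType) (alpha l : R) (N : nat).
Local Notation C := R[i].
Hypothesis N0 : (0 < N)%N.
Hypothesis l2 : 2^-1 < l < 3 / 2.

(** Lagrange's identity: the difference of the squares of the two sides is the square of the scalar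
    product. *)
Lemma cross_bound (p q : C) : `|cross p q| <= normc p * normc q.
Proof.
rewrite -(@ler_pXn2r _ 2)// ?nnegrE ?mulr_ge0 ?normc_ge0// exprMn !normc_sqr.
rewrite real_normK ?num_real// -subr_ge0 (_ : _ - _ = scal p q ^+ 2) ?sqr_ge0//.
by rewrite !planeE; ring.
Qed.

Section conf.
Variables (omega : conf R) (c0 : C) (eta : R).
Hypothesis eta0 : 0 <= eta.
Hypothesis eta32 : eta <= 32^-1.
Hypothesis eta_alpha : 2 * eta <= alpha / 2.
Hypothesis l_alpha : 1 - alpha / 2 < l < 1 + alpha / 2.
Hypothesis nearE : forall x, exists2 e, omega x = Some (l%:C * emb R x + c0 + e)
  & normc e <= eta.

Lemma near_lattice_step x z :
  normc (hat_site omega (x + z) - hat_site omega x - l%:C * emb R z) <= 2 * eta.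
Proof.
have [e /hat_site_Some -> he] := nearE x.
have [e' /hat_site_Some -> he'] := nearE (x + z).
rewrite (_ : _ - _ - _ = e' - e); last by rewrite embD; ring.
by rewrite (le_trans (le_normcD _ _))// normcN mulr2n mulrDl mul1r lerD.
Qed.

Let normc_l (p : C) : normc (l%:C * p) = l * normc p.
Proof.
have /andP[l0 _] := l2.
by rewrite normcM /= expr0n/= addr0 sqrtr_sqr ger0_norm//; lra.
Qed.

Lemma near_lattice_length x z : z \in nbrs ->
  `|normc (hat_site omega (x + z) - hat_site omega x) - l| <= 2 * eta.
Proof.
move=> zn; have lz : normc (l%:C * emb R z) = l.
  by rewrite normc_l normc_sqrt sqnorm_emb// sqrtr1 mulr1.
by rewrite -lz (le_trans (normc_dist_le _ _))// near_lattice_step.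
Qed.

Lemma near_lattice_edge_lengths : edge_lengths alpha omega.
Proof.
move=> x y p q /adjE yx; have := near_lattice_length x yx; rewrite subrKC.
move=> h hx hy; move: h; rewrite (hat_site_Some hx) (hat_site_Some hy).
rewrite -normcN opprB ler_norml => /andP[h1 h2].
by move: l_alpha eta_alpha => /andP[? ?] ?; apply/andP; split; lra.
Qed.

Lemma near_lattice_holes_separated : holes_separated omega.
Proof. by move=> x y hx; have [e] := nearE x; rewrite hx. Qed.

(** After subtraction of multiplication by [l] the interpolation has increments at most 2 eta along
    edges, hence Lipschitz constant 8 eta <= 1/4 < l. *)
Lemma near_lattice_bijective : hat_bijective omega.
Proof.
have /andP[l0 l1] := l2.
pose u x := hat_site omega x - l%:C * emb R x.
have lipu p q : normc (interp u p - interp u q) <= 4 * (2 * eta) * normc (p - q).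
  apply: interp_lipschitz => x z _.
  rewrite (_ : u (x + z) - u x = hat_site omega (x + z) - hat_site omega x - l%:C * emb R z).
    exact: near_lattice_step.
  by rewrite /u embD; ring.
have lipF p q : normc (hat omega p - hat omega q) <= (l + 8 * eta) * normc (p - q).
  rewrite hat_interp (_ : _ - _ = interp u p - interp u q + l%:C * (p - q)).
    rewrite (le_trans (le_normcD _ _))// normc_l; have := lipu p q; lra.
  by rewrite /u !interp_affine; ring.
apply: (bijective_perturbation _ lipF (l := l) (K := 8 * eta)).
- by move: eta0; lra.
- by move: eta0 eta32 => ? ?; apply/andP; split; lra.
- move=> p q; rewrite hat_interp -!interp_affine.
  by have := lipu p q; rewrite mulrA -natrM.
Qed.

(** The unperturbed cross product is l^2 sqrt 3 / 2. The perturbation changes it by at most 2 l (2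
    eta) + (2 eta)^2, which is smaller for eta <= 1/32. *)
Lemma near_lattice_orientation_preserving : orientation_preserving omega.
Proof.
have /andP[l0 l1] := l2.
move=> x z zn; rewrite Im_div_gt0.
have := near_lattice_step x z; have := near_lattice_step x (mul_tau z).
set a := _ - l%:C * emb R z; set b := _ - l%:C * emb R (mul_tau z) => hb ha.
have -> : hat_site omega (x + z) - hat_site omega x = l%:C * emb R z + a.
  by rewrite /a; ring.
have -> : hat_site omega (x + mul_tau z) - hat_site omega x =
    l%:C * (tau R * emb R z) + b by rewrite /b emb_mul_tau; ring.
have z1 := sqnorm_emb R zn; move: (emb R z) z1 => e e1.
have te1 : normc (tau R * e) = 1.
  by rewrite normc_sqrt sqnormM sqnorm_tau e1 mul1r sqrtr1.
have ne1 : normc e = 1 by rewrite normc_sqrt e1 sqrtr1.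
have -> : cross (l%:C * e + a) (l%:C * (tau R * e) + b) =
    l ^+ 2 * (Num.sqrt 3 / 2 * sqnorm e) + l * cross e b + l * cross a (tau R * e)
    + cross a b.
  by rewrite !planeE !ReImE; field.
rewrite e1 mulr1.
have h1 := cross_bound e b; have h2 := cross_bound a (tau R * e).
have h3 := cross_bound a b; rewrite ne1 mul1r in h1; rewrite te1 mulr1 in h2.
have s3 : 3 / 2 <= Num.sqrt 3 :> R.
  by rewrite -(@ler_pXn2r _ 2)// ?nnegrE ?sqrtr_ge0// sqr_sqrt3; lra.
have ab : normc a * normc b <= (2 * eta) * (2 * eta) by rewrite ler_pM ?normc_ge0.
have := ler_norm (- cross e b); have := ler_norm (- cross a (tau R * e)).
have := ler_norm (- cross a b); rewrite !normrN => k1 k2 k3.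
have l1' : l * - cross e b <= l * (2 * eta) by rewrite ler_wpM2l; lra.
have l2' : l * - cross a (tau R * e) <= l * (2 * eta) by rewrite ler_wpM2l; lra.
have l3' : l ^+ 2 * (3 / 4) <= l ^+ 2 * (Num.sqrt 3 / 2).
  by rewrite ler_wpM2l ?sqr_ge0//; lra.
have l4' : l * (2 * eta) <= l * 16^-1 by rewrite ler_wpM2l; move: eta32; lra.
have l5' : (2 * eta) * (2 * eta) <= 16^-1 * 16^-1.
  by rewrite ler_pM ?mulr_ge0//; move: eta32; lra.
have l6' : 2^-1 * l <= l ^+ 2 by rewrite expr2 ler_wpM2r; lra.
lra.
Qed.

Lemma near_lattice_energy (V : R -> R) (m : R) :
  (forall r s : R, 1 - alpha < r < 1 + alpha -> 1 - alpha < s < 1 + alpha ->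
     V r - V s <= `|r - s|) ->
  2^-1 * (\sum_(x <- box N) \sum_(z <- nbrs) pair_energy V (omega x) (omega (x + z)))
  + m * \sum_(x <- box N) (omega x == None)%:R <=
  3 * (N * N)%:R * V l + 6 * (N * N)%:R * eta.
Proof.
move=> lipV; have noholes x : omega x != None by have [e ->] := nearE x.
rewrite [X in m * X]big1 => [|x _]; last by rewrite (negbTE (noholes x)).
rewrite mulr0 addr0.
have : \sum_(x <- box N) \sum_(z <- nbrs) pair_energy V (omega x) (omega (x + z)) <=
    \sum_(x <- box N) \sum_(z <- nbrs) (V l + 2 * eta).
  apply: ler_sum => x _; rewrite big_seq [leRHS]big_seq; apply: ler_sum => z zn.
  have len := near_lattice_length x zn.
  have [e ex _] := nearE x; have [e' exz _] := nearE (x + z).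
  have E : normc (hat_site omega (x + z) - hat_site omega x) =
    normc (l%:C * emb R x + c0 + e - (l%:C * emb R (x + z) + c0 + e')).
    by rewrite (hat_site_Some ex) (hat_site_Some exz) -normcN opprB.
  have el := near_lattice_edge_lengths.
  have xz : adj R x (x + z) by apply/adjE; rewrite addrAC subrr add0r.
  have b1 := el _ _ _ _ xz ex exz; rewrite ex exz /=; rewrite E in len.
  have b2 : 1 - alpha < l < 1 + alpha.
    by move: l_alpha eta_alpha eta0 => /andP[? ?] ? ?; apply/andP; split; lra.
  have := lipV _ _ b1 b2; lra.
have -> : \sum_(x <- box N) \sum_(z <- nbrs) (V l + 2 * eta) =
   6 * (N * N)%:R * (V l + 2 * eta).
  rewrite (eq_bigr (fun=> 6 * (V l + 2 * eta))); last first.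
    by move=> x _; rewrite nbrsE !big_cons big_nil; ring.
  by rewrite big_const_seq count_predT size_box iter_addr_0 -mulr_natr; ring.
lra.
Qed.

End conf.
End near_lattice.

(** * A product of squares around the scaled lattice *)

Section near_volume.
Variables (R : realType) (alpha l : R) (N : nat) (delta : R).
Local Notation C := R[i].
Local Notation tup := ((N * N).-tuple (option (R * R))).
Local Notation P := (measurableTypeR R * measurableTypeR R)%type.
Local Notation lambda2 := (product_measure (@lebesgue_measure R) (@lebesgue_measure R)).
Hypothesis N0 : (0 < N)%N.
Hypothesis l2 : 2^-1 < l < 3 / 2.
Hypothesis delta0 : 0 <= delta.

(** The centre of the fundamental domain: the particle at the first site stays in the domain under
    small displacements, so all these configurations are representatives. *)
Let c0 : C := lat_pt (l * N%:R / 2) (l * N%:R / 2).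

Let center (k : nat) : R * R :=
  let c := l%:C * emb R (site N k) + c0 in (complex.Re c, complex.Im c).

Definition near_lattice : set tup :=
  tuple_box (fun k : 'I_(N * N) => Some @` [set p | near_pt delta p (center k)]).

Let site_box_measurable (q : R * R) :
  measurable (Some @` [set p : P | near_pt delta p q] : set (option P)) /\
  hole_measure lambda2 (Some @` [set p : P | near_pt delta p q]) = (4 * delta ^+ 2)%:E.
Proof.
have [mD lD] := lambda2_near q delta0.
have BE : Some @^-1` (Some @` [set p : P | near_pt delta p q]) = [set p | near_pt delta p q].
  by apply/seteqP; split=> p /= => [[p' h [<-]]|h] //; exists p.
split; first by rewrite -BE in mD; exact: mD.
have E : lambda2 (Some @^-1` (Some @` [set p : P | near_pt delta p q])) = (4 * delta ^+ 2)%:E.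
  by rewrite BE; exact: lD.
by rewrite /hole_measure [X in (X + _)%E]E diracE memNset ?adde0//; case.
Qed.

Lemma measurable_near_lattice : measurable near_lattice.
Proof.
exact: (@measurable_tuple_box _ (option P) (N * N) _
  (fun k : 'I_(N * N) => (site_box_measurable (center k)).1)).
Qed.

Lemma near_lattice_volume :
  @config_measure R N near_lattice = ((4 * delta ^+ 2) ^+ (N * N))%:E.
Proof.
transitivity (\prod_(k < N * N) hole_measure lambda2
    (Some @` [set p : P | near_pt delta p (center k)]))%E.
  exact: (@power_measure_box _ (option P) R (hole_measure lambda2) (N * N) _
    (fun k : 'I_(N * N) => (site_box_measurable (center k)).1)).
under eq_bigr do rewrite (site_box_measurable _).2.
by rewrite prodEFin prodr_const card_ord.
Qed.

Lemma near_lattice_conf (w : tup) : near_lattice w -> forall x, exists2 e,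
  conf_of l w x = Some (l%:C * emb R x + c0 + e) & normc e <= 2 * delta.
Proof.
move=> hw x; rewrite (conf_ofE l N0).
set i := Ordinal _; have [q [q1 q2] <- /=] := hw i.
pose c := l%:C * emb R (site N i) + c0.
exists ((q.1 +i* q.2) - c); last first.
  have le_Re_Im (p : C) : normc p <= `|complex.Re p| + `|complex.Im p|.
    rewrite -(@ler_pXn2r _ 2)// ?nnegrE ?normc_ge0 ?addr_ge0// normc_sqr sqnormE.
    rewrite sqrrD !real_normK ?num_real// -mulr_natl.
    by have := mulr_ge0 (normr_ge0 (complex.Re p)) (normr_ge0 (complex.Im p)); lra.
  rewrite (le_trans (le_Re_Im _))// mulr2n mulrDl mul1r.
  by rewrite ReD ImD ReN ImN; apply: lerD.
congr Some; rewrite [in RHS](lattice_divE N0 x) embD embMn -/(site N i) /c rmorphM/=.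
have -> : emb R (site N (index_of N x)) = emb R (site N i) by [].
ring.
Qed.

Hypothesis delta64 : delta <= 64^-1.
Hypothesis delta_alpha : 4 * delta <= alpha / 2.
Hypothesis l_alpha : 1 - alpha / 2 < l < 1 + alpha / 2.

Let eta0 : 0 <= 2 * delta. Proof. by rewrite mulr_ge0. Qed.

Let eta32 : 2 * delta <= 32^-1. Proof. by move: delta64; lra. Qed.

Let eta_alpha : 2 * (2 * delta) <= alpha / 2. Proof. by rewrite mulrA -natrM. Qed.

Lemma near_lattice_allowed : near_lattice `<=` @allowed R alpha l N.
Proof.
move=> w hw; have nearE := near_lattice_conf hw.
have /andP[l0 _] := l2.
split.
- have NN : (0 < N * N)%N by rewrite muln_gt0 N0.
  have [e E he] := nearE (site N 0).
  apply/(representatives_first N0 NN E) => //.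
  have e0 : emb R (site N 0) = 0.
    by rewrite /site div0n mod0n /emb/= mul0r addr0.
  rewrite e0 mulr0 add0r; have [s [t est]] := lat_ptP e.
  have [hs ht] := lat_pt_bounds s t; rewrite -est in hs ht.
  have N1 : 1 <= N%:R :> R by rewrite ler1n.
  have L : 2^-1 <= l * N%:R by nra.
  exists (l * N%:R / 2 + s), (l * N%:R / 2 + t).
  rewrite est /c0 /lat_pt !rmorphD/=; split; [| |by ring].
    have /andP[s1 s2] : - (2 * normc e) <= s <= 2 * normc e by rewrite -ler_norml.
    have := eta32 => h; apply/andP; split; lra.
  have /andP[t1 t2] : - (2 * normc e) <= t <= 2 * normc e by rewrite -ler_norml.
  have := eta32 => h; apply/andP; split; lra.
- exact (near_lattice_edge_lengths l2 eta_alpha l_alpha nearE).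
- exact (near_lattice_holes_separated nearE).
- exact (near_lattice_bijective l2 eta0 eta32 nearE).
- exact (near_lattice_orientation_preserving l2 eta0 eta32 nearE).
Qed.

Lemma near_lattice_hamiltonian (V : R -> R) (m : R) (w : tup) :
  (forall r s : R, 1 - alpha < r < 1 + alpha -> 1 - alpha < s < 1 + alpha ->
     V r - V s <= `|r - s|) ->
  near_lattice w ->
  hamiltonian V l m w <= 3 * (N * N)%:R * V l + 6 * (N * N)%:R * (2 * delta).
Proof.
move=> lipV hw.
exact (near_lattice_energy N l2 eta0 eta_alpha l_alpha (near_lattice_conf hw) m lipV).
Qed.

End near_volume.

(** * Expectations under a measure with density *)

Section integral_density.
Context d (T : measurableType d) (R : realType) (mu : {measure set T -> \bar R}).
Variables (D : set T) (B F : T -> R) (c : R) (G : set T -> \bar R).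
Hypothesis mD : measurable D.
Hypothesis mB : measurable_fun setT B.
Hypothesis B0 : forall w, 0 <= B w.
Hypothesis mF : measurable_fun setT F.
Hypothesis F0 : forall w, 0 <= F w.
Hypothesis c0 : 0 <= c.
Local Open Scope ereal_scope.
Hypothesis GE : forall A, measurable A -> G A = c%:E * \int[mu]_(w in D `&` A) (B w)%:E.

Import HBNNSimple.

(** [G] is only a set function with a density formula on measurable sets, so its integral is
    computed from the definition, starting with simple functions. *)
Let sintegral_density (h : {nnsfun T >-> R}) :
  sintegral G h = c%:E * \int[mu]_(w in D) (h w * B w)%:E.
Proof.
rewrite /sintegral -(fsbig_widen (range h) setT)//=; last first.
  move=> x [_ Nhx] /=; rewrite preimage10// GE// setI0.
  by rewrite integral_set0 !mule0.
have mhx x : measurable (h @^-1` [set x]) by exact: measurable_sfunP.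
have mi x : measurable_fun D (fun w => (x * (\1_(h @^-1` [set x]) w * B w))%:E).
  apply/measurable_EFinP/measurable_funTS/measurable_funM; first exact: measurable_cst.
  by apply: measurable_funM => //; exact: measurable_indic.
have -> : \int[mu]_(w in D) (h w * B w)%:E =
    \int[mu]_(w in D) \sum_(x \in range h) (x * (\1_(h @^-1` [set x]) w * B w))%:E.
  apply: eq_integral => w _; rewrite fsumEFin// {1}(fimfunE h w).
  by rewrite mulr_fsuml; under eq_fsbigr do rewrite -mulrA.
have pos x w : 0 <= (x * (\1_(h @^-1` [set x]) w * B w))%:E.
  rewrite lee_fin indicE; case: (boolP (_ \in _)) => [|_]; last by rewrite mul0r mulr0.
  by rewrite inE /= => <-; rewrite !mulr_ge0.
rewrite ge0_integral_fsum//.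
rewrite ge0_mule_fsumr; last by move=> x; exact: integral_ge0.
apply: eq_fsbigr => x; rewrite inE => -[w _ wx].
have x0 : (0 <= x)%R by rewrite -wx.
rewrite GE// muleCA; congr (_ * _); under [RHS]eq_integral do rewrite EFinM.
rewrite ge0_integralZl_EFin//; last 2 first.
- by move=> y _; rewrite lee_fin mulr_ge0.
- by apply/measurable_EFinP/measurable_funTS/measurable_funM => //; exact: measurable_indic.
congr (_ * _); rewrite integral_mkcondr; apply: eq_integral => y _.
by rewrite patchE indicE; case: ifP => _; rewrite ?mul1r ?mul0r.
Qed.

Let sintegral_density0 : sintegral G (@nnsfun0 _ T R) = 0.
Proof.
rewrite sintegral_density [X in _ * X]integral0_eq ?mule0// => w _.
by rewrite /= mul0r.
Qed.

(** Every simple function below [F] has, by [sintegral_density], at most this integral, and the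
    supremum inherits the bound. The integral of the negative part is only subtracted. *)
Lemma integral_density_le :
  integral G setT (fun w => (F w)%:E) <= c%:E * \int[mu]_(w in D) (F w * B w)%:E.
Proof.
rewrite /integral.
set sp := ereal_sup _; set sn := ereal_sup _.
have sn0 : 0 <= sn.
  apply: ereal_sup_ubound; exists nnsfun0 => /=.
    by move=> x; exact: funeneg_ge0.
  exact: sintegral_density0.
rewrite (@le_trans _ _ sp)//.
  by rewrite -[leRHS]adde0 leeD2l// oppe_le0.
apply: ge_ereal_sup => _ [h hF <-]; rewrite sintegral_density.
rewrite lee_wpmul2l//; apply: ge0_le_integral => //.
- by move=> w _; rewrite lee_fin mulr_ge0.
- by apply/measurable_EFinP/measurable_funTS/measurable_funM.
- by apply/measurable_EFinP/measurable_funTS/measurable_funM.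
move=> w _; rewrite lee_fin ler_wpM2r//.
have := hF w; rewrite patch_setT funeposE.
by rewrite (max_idPl _) ?lee_fin.
Qed.

Lemma integral_density_ge0 : 0 <= integral G setT (fun w => (F w)%:E).
Proof.
rewrite /integral.
set sp := ereal_sup _; set sn := ereal_sup _.
have sp0 : 0 <= sp.
  apply: ereal_sup_ubound; exists nnsfun0 => /=.
    by move=> x; exact: funepos_ge0.
  exact: sintegral_density0.
suff -> : sn = 0 by rewrite sube0.
apply/eqP; rewrite eq_le; apply/andP; split; last first.
  apply: ereal_sup_ubound; exists nnsfun0 => /=.
    by move=> x; exact: funeneg_ge0.
  exact: sintegral_density0.
apply: ge_ereal_sup => _ [h hF <-]; rewrite sintegral_density.
under eq_integral.
  move=> w _; have : h w = 0%R.
    apply/eqP; rewrite eq_le fun_ge0 andbT -lee_fin (le_trans (hF w))//.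
    by rewrite patch_setT funenegE ge_max lexx andbT oppe_le0 lee_fin.
  move=> ->; rewrite mul0r; over.
by rewrite integral0 mule0.
Qed.

End integral_density.

(** * Expected energy excess *)

(** For t <= s the first term suffices. For t > s the exponential is split in two: one half absorbs
    the factor [t] through x <= exp x with x = b t / 4, the other is at most its value at [s]. *)
Lemma expR_tail (R : realType) (b t s : R) : 0 < b -> 0 <= t -> 0 <= s ->
  t * expR (- (b * (t / 2))) <=
  s * expR (- (b * (t / 2))) + 4 / b * expR (- (b * s / 4)).
Proof.
move=> b0 t0 s0; have e0 x : 0 <= expR x :> R by exact: expR_ge0.
have [ts|st] := leP t s.
  by rewrite ler_wpDr ?ler_wpM2r// mulr_ge0// divr_ge0// ltW.
rewrite ler_wpDl ?mulr_ge0//.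
have -> : - (b * (t / 2)) = - (b * t / 4) + - (b * t / 4) by field.
rewrite expRD mulrA; apply: ler_pM; rewrite ?mulr_ge0//.
  rewrite expRN ler_pdivrMr ?expR_gt0// mulrAC ler_pdivlMr//.
  have := expR_ge1Dx (b * t / 4); lra.
by rewrite ler_expR lerN2 ler_pM2r// ler_pM2l// ltW.
Qed.

Lemma integral_mu_N (R : realType) (l : R) (N : nat) (A : set ((N * N).-tuple (option (R * R))))
    (f : (N * N).-tuple (option (R * R)) -> \bar R) : (0 < N)%N -> A `<=` @representatives R l N ->
  (\int[@mu_N R l N]_(w in A) f w = \int[@config_measure R N]_(w in A) f w)%E.
Proof.
move=> N0 AR; have mR := measurable_representatives l N0.
apply: (@eq_measure_integral _ _ R A (@config_measure R N) (mrestr (@config_measure R N) mR)).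
move=> S _ SA; apply: (congr1 (@config_measure R N)).
exact: (setIidl (subset_trans SA AR)).
Qed.

Section energy_bound.
Variables (R : realType) (alpha l : R) (N : nat) (V : R -> R) (beta m c k : R).
Local Notation C := R[i].
Local Notation tup := ((N * N).-tuple (option (R * R))).
Hypothesis N2 : (1 < N)%N.
Hypothesis alpha2 : 0 < alpha <= 2^-1.
Hypothesis l_alpha : 1 - alpha / 2 < l < 1 + alpha / 2.
Hypothesis mV : measurable_fun setT V.
Hypothesis c0 : 0 < c.
Hypothesis kc : `|k| <= c / 192.
Hypothesis HV : forall r : R, 1 - alpha < r < 1 + alpha ->
  V l + k * (r ^+ 2 - l ^+ 2) + c * (r - l) ^+ 2 <= V r.
Hypothesis lipV : forall r s : R, 1 - alpha < r < 1 + alpha -> 1 - alpha < s < 1 + alpha ->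
  V r - V s <= `|r - s|.
Hypothesis hm : 50 * c + 12 * `|V l| + 1236 * `|k| <= 2 * m.
Hypothesis b0 : 0 < beta.

Let N0 : (0 < N)%N. Proof. exact: ltnW. Qed.
Let ale2 : alpha <= 2^-1. Proof. by case/andP: alpha2. Qed.
Let l2 : 2^-1 < l < 3 / 2.
Proof.
by have /andP[? ?] := alpha2; have /andP[? ?] := l_alpha; apply/andP; split; lra.
Qed.

Local Notation n := ((N * N)%:R : R).
Local Notation ground := (3 * n * V l).
Local Notation B := (boltzmann V l beta m).
Local Notation D := (@allowed R alpha l N).
Local Notation mu := (@config_measure R N).

(** The factor 2 matches the sum over ordered pairs in [energy_excess], in which every edge occurs
    twice. *)
Let excess (w : tup) := 2 * (hamiltonian V l m w - ground).

Let boltzmannE (w : tup) :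
  B w = expR (- (beta * ground)) * expR (- (beta * (excess w / 2))).
Proof. by rewrite -expRD /boltzmann /excess; congr expR; field. Qed.

Lemma deviation_excess (z : lattice) (w : tup) : z \in nbrs -> D w ->
  c / 192 * (\sum_(y <- box N) sq_deviation l y z w) <= excess w.
Proof.
move=> zn [_ el hs _ op].
have h := energy_excess ale2 (conf_of_quasiperiodic l w N0) el hs N0 l2 op c0 kc HV hm.
have -> : excess w = \sum_(x <- box N) \sum_(z <- nbrs)
    pair_energy V (conf_of l w x) (conf_of l w (x + z)) +
    2 * m * hole_count N (conf_of l w) - 6 * n * V l.
  by rewrite /excess /hamiltonian /hole_count /is_hole; field.
apply: le_trans h; rewrite ler_wpM2l//; first by rewrite divr_ge0// ltW.
apply: ler_sum => y _; rewrite (big_rem z zn)/= /sq_deviation normc_sqr.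
by rewrite lerDl sumr_ge0// => z' _; rewrite -normc_sqr sqr_ge0.
Qed.

Let sq0 (y z : lattice) (w : tup) : 0 <= sq_deviation l y z w.
Proof. exact: sqr_ge0. Qed.

Let sum_sq_deviation_ge0 (z : lattice) (w : tup) :
  0 <= \sum_(y <- box N) sq_deviation l y z w.
Proof. by exact: sumr_ge0. Qed.

Let excess_ge0 (w : tup) : D w -> 0 <= excess w.
Proof.
move=> Dw; have z1 : ((1, 0) : lattice) \in nbrs by [].
by apply: le_trans (deviation_excess z1 Dw); rewrite mulr_ge0// divr_ge0// ltW.
Qed.

Let KK : R := 20 * (1 + 4 * 20 ^+ 2).
Let KK0 : 0 < KK.
Proof. by rewrite /KK mulr_gt0// addr_gt0// mulr_gt0// exprn_gt0. Qed.

Variables (epsilon delta : R).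
Hypothesis epsilon0 : 0 < epsilon.
Hypothesis delta0 : 0 < delta.
Hypothesis delta64 : delta <= 64^-1.
Hypothesis delta_alpha : 4 * delta <= alpha / 2.
Hypothesis delta_epsilon : 96 * delta <= epsilon.
Hypothesis beta_big : 8 * KK / (4 * delta ^+ 2 * epsilon) <= beta.

(** The second term of [expR_tail] at the threshold s = epsilon * n, with the Boltzmann factor of
    the ground energy restored: a pointwise bound for configurations with larger excess. *)
Let error := expR (- (beta * ground)) * (4 / beta) * expR (- (beta * (epsilon * n) / 4)).

Let error0 : 0 <= error.
Proof. by rewrite !mulr_ge0 ?expR_ge0 ?invr_ge0 ?(ltW b0). Qed.

Let n0 : 0 < n. Proof. by rewrite ltr0n muln_gt0 N0. Qed.

Lemma deviation_boltzmann (z : lattice) (w : tup) : z \in nbrs -> D w ->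
  c / 192 * ((\sum_(y <- box N) sq_deviation l y z w) * B w) <=
  epsilon * n * B w + error.
Proof.
move=> zn Dw; have e0 : 0 <= epsilon * n by rewrite mulr_ge0// ltW.
apply: (@le_trans _ _ (excess w * B w)).
  by rewrite mulrA ler_wpM2r ?expR_ge0// deviation_excess.
have := expR_tail b0 (excess_ge0 Dw) e0.
move=> /(ler_wpM2l (expR_ge0 (- (beta * ground)))).
rewrite boltzmannE /error; set G := expR (- (beta * ground)); set E := expR (- (beta * (_ / 2))).
set F := expR (- (beta * _ / 4)) => h.
rewrite (_ : _ * (G * E) = G * (excess w * E)); last by ring.
by apply: le_trans h _; rewrite le_eqVlt; apply/orP; left; apply/eqP; ring.
Qed.

(** The factor exp(- beta epsilon n / 4) is split into halves. One pays for the volume ratio, as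
    [beta_big] gives KK <= 4 delta^2 exp(beta epsilon / 8); the other covers the energy 12 n delta
    <= epsilon n / 8 of the configurations near the lattice. *)
Lemma error_small : error * KK ^+ (N * N) <=
  4 / beta * ((4 * delta ^+ 2) ^+ (N * N) * expR (- (beta * (ground + 6 * n * (2 * delta))))).
Proof.
have d2 : 0 < 4 * delta ^+ 2 by rewrite mulr_gt0// exprn_gt0.
have h : expR (- (beta * (epsilon * n) / 4)) * KK ^+ (N * N) <=
  (4 * delta ^+ 2) ^+ (N * N) * expR (- (beta * (6 * n * (2 * delta)))).
  apply: (@le_trans _ _ ((4 * delta ^+ 2) ^+ (N * N) * expR (- (beta * epsilon * n / 8)))).
    2: rewrite ler_wpM2l ?exprn_ge0 ?(ltW d2)// ler_expR lerN2.
    2: rewrite -!mulrA ler_pM2l//; have := ler_wpM2r (ltW n0) delta_epsilon; lra.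
  have -> : - (beta * (epsilon * n) / 4) =
      n * (- (beta * epsilon / 8)) + n * (- (beta * epsilon / 8)).
    by field.
  have -> : - (beta * epsilon * n / 8) = n * (- (beta * epsilon / 8)) by field.
  rewrite expRD mulrAC ler_wpM2r ?expR_ge0// expRM_natl -exprMn.
  apply: lerXn2r; rewrite ?nnegrE ?(ltW d2) ?(mulr_ge0 (expR_ge0 _) (ltW KK0))//.
  rewrite expRN mulrC ler_pdivrMr ?expR_gt0//.
  have : KK <= 4 * delta ^+ 2 * (beta * epsilon / 8).
    by move: beta_big; rewrite ler_pdivrMr ?mulr_gt0//; lra.
  move=> /le_trans; apply; rewrite ler_pM2l//.
  by have := expR_ge1Dx (beta * epsilon / 8); lra.
have -> : expR (- (beta * (ground + 6 * n * (2 * delta)))) =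
    expR (- (beta * ground)) * expR (- (beta * (6 * n * (2 * delta)))).
  by rewrite -expRD; congr expR; ring.
have {}h := ler_wpM2l (mulr_ge0 (expR_ge0 (- (beta * ground))) (divr_ge0 (ler0n R 4) (ltW b0))) h.
rewrite /error; apply: (le_trans (le_trans _ h)).
  by rewrite le_eqVlt; apply/orP; left; apply/eqP; ring.
by rewrite le_eqVlt; apply/orP; left; apply/eqP; ring.
Qed.

Local Open Scope ereal_scope.

Let mD : measurable D. Proof. exact: measurable_allowed. Qed.

Let mB : measurable_fun D (fun w => (B w)%:E).
Proof. by apply/measurable_EFinP/measurable_funTS; exact: measurable_boltzmann. Qed.

Let B0 (w : tup) : (0 <= B w)%R. Proof. exact: expR_ge0. Qed.

Let Z := \int[mu]_(w in D) (B w)%:E.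

Lemma partition_function_ge :
  ((4 * delta ^+ 2) ^+ (N * N) * expR (- (beta * (ground + 6 * n * (2 * delta)))))%:E <= Z.
Proof.
have d0 := ltW delta0.
apply: (@le_trans _ _ (\int[mu]_(w in near_lattice l delta) (B w)%:E)); last first.
  apply: ge0_subset_integral => //; first exact: measurable_near_lattice.
    by move=> w _; rewrite lee_fin.
  exact: near_lattice_allowed.
rewrite mulrC EFinM -(near_lattice_volume l N d0) -integral_cst;
  last exact: measurable_near_lattice.
apply: ge0_le_integral => //.
- exact: measurable_near_lattice.
- by move=> w _; rewrite lee_fin expR_ge0.
- by apply/measurable_EFinP/measurable_funTS; exact: measurable_boltzmann.
move=> w hw; rewrite lee_fin ler_expR lerN2 ler_pM2l//.
exact: (near_lattice_hamiltonian N0 l2 d0 delta_alpha l_alpha).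
Qed.

Let Z0 : 0 < Z.
Proof.
apply: lt_le_trans partition_function_ge.
by rewrite lte_fin mulr_gt0 ?expR_gt0// exprn_gt0// mulr_gt0// exprn_gt0.
Qed.

Let Zoo : Z < +oo.
Proof.
apply: (@le_lt_trans _ _ (\int[mu]_(w in D) (cst (expR (- (beta * ground)))%:E) w)).
  apply: ge0_le_integral => //; first by move=> w _; rewrite lee_fin.
  move=> w Dw; rewrite lee_fin boltzmannE ler_piMr ?expR_ge0//.
  by rewrite -[leRHS](expR0) ler_expR oppr_le0 mulr_ge0 ?(ltW b0)// divr_ge0// excess_ge0.
rewrite integral_cst//; apply: lte_mul_pinfty => //.
by apply: le_lt_trans (allowed_volume N2 ale2 l2) _; rewrite ltry.
Qed.

(** By shift invariance n times this integral is the integral of the sum over all sites, which the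
    excess controls. The error term, integrated over the allowed set, is at most 4 / beta times the
    partition function. *)
Lemma integral_deviation_boltzmann x z : z \in nbrs ->
  \int[mu]_(w in D) (sq_deviation l x z w * B w)%:E <= (192 / c * (epsilon + 4 / beta))%:E * Z.
Proof.
move=> zn.
have ms y : measurable_fun D (fun w => (sq_deviation l y z w * B w)%:E).
  apply/measurable_EFinP/measurable_funTS/measurable_funM; first exact: measurable_sq_deviation.
  exact: measurable_boltzmann.
have s0 y (w : tup) : 0 <= (sq_deviation l y z w * B w)%:E.
  by rewrite lee_fin mulr_ge0// sq0.
set S := \int[mu]_(w in D) _.
have sumE : n%:E * S = \int[mu]_(w in D) ((\sum_(y <- box N) sq_deviation l y z w) * B w)%:E.
  under [RHS]eq_integral => w _ do rewrite mulr_suml -sumEFin.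
  rewrite ge0_integral_sum//.
  transitivity (\sum_(y <- box N) S); last first.
    apply: eq_bigr => y _.
    by rewrite /S (integral_allowed_shift N0 beta m ale2 l2 mV N2 x)
      (integral_allowed_shift N0 beta m ale2 l2 mV N2 y).
  have sum_const (s : seq lattice) : \sum_(y <- s) S = (size s)%:R%:E * S.
    elim: s => [|y s IH]; first by rewrite big_nil mul0e.
    rewrite big_cons IH /= -[in RHS]add1n natrD EFinD ge0_muleDl ?lee_fin//.
    by rewrite mul1e.
  by rewrite sum_const size_box.
have SU : (c / 192)%:E * (n%:E * S) <= (epsilon * n)%:E * Z + error%:E * mu D.
  have mS : measurable_fun D (fun w => ((\sum_(y <- box N) sq_deviation l y z w) * B w)%:E).
    apply/measurable_EFinP/measurable_funTS/measurable_funM; last exact: measurable_boltzmann.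
    by apply: measurable_sum => y; exact: measurable_sq_deviation.
  have meB : measurable_fun D (fun w => (epsilon * n)%:E * (B w)%:E) by exact: measurable_funeM.
  have -> : (c / 192)%:E * (n%:E * S) =
      \int[mu]_(w in D) ((c / 192)%:E * ((\sum_(y <- box N) sq_deviation l y z w) * B w)%:E).
    rewrite sumE ge0_integralZl_EFin//; last by rewrite divr_ge0// ltW.
    by move=> w _; rewrite lee_fin mulr_ge0.
  have -> : (epsilon * n)%:E * Z + error%:E * mu D =
      \int[mu]_(w in D) ((epsilon * n)%:E * (B w)%:E + (cst error%:E) w).
    rewrite ge0_integralD ?integral_cst// ?ge0_integralZl_EFin//.
    - by move=> w _; rewrite lee_fin.
    - by rewrite mulr_ge0// ltW.
    - by move=> w _; rewrite lee_fin mulr_ge0// mulr_ge0// ltW.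
  apply: ge0_le_integral => //.
  - by move=> w _; rewrite lee_fin !mulr_ge0// ?invr_ge0// ltW.
  - exact: measurable_funeM.
  - exact: emeasurable_funD.
  by move=> w Dw; rewrite lee_fin; exact: deviation_boltzmann.
have eZ : error%:E * mu D <= (4 / beta)%:E * Z.
  apply: (@le_trans _ _ (error * KK ^+ (N * N))%:E).
    by rewrite [leRHS]EFinM lee_wpmul2l ?allowed_volume// lee_fin.
  have es := error_small; rewrite -lee_fin in es; apply: (le_trans es).
  by rewrite [leLHS]EFinM lee_wpmul2l ?partition_function_ge// lee_fin divr_ge0// ltW.
have Zfin : Z \is a fin_num by rewrite ge0_fin_numE ?(ltW Z0).
have bound : (c / 192)%:E * (n%:E * S) <= (n * (epsilon + 4 / beta))%:E * Z.
  apply: (le_trans SU); apply: le_trans (leeD2l _ eZ) _.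
  rewrite -(fineK Zfin) -!EFinM -EFinD lee_fin -mulrDl ler_wpM2r ?fine_ge0 ?(ltW Z0)//.
  rewrite [(n * _)%R]mulrDr [(n * epsilon)%R]mulrC lerD2l ler_peMl ?divr_ge0 ?(ltW b0)//.
  by rewrite ler1n muln_gt0 N0.
have cn : (0 < c / 192 * n)%R by rewrite mulr_gt0// divr_gt0.
rewrite muleA -EFinM in bound.
rewrite -(@lee_pmul2l _ (c / 192 * n)%:E)//; apply: (le_trans bound).
rewrite muleA -EFinM lee_wpmul2r ?(ltW Z0)// lee_fin.
by rewrite le_eqVlt; apply/orP; left; apply/eqP; field; rewrite ?lt0r_neq0.
Qed.

Lemma mean_sq_deviation_bound x z : z \in nbrs ->
  0 <= mean_sq_deviation V alpha l N beta m x z <= (192 / c * (epsilon + 4 / beta))%:E.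
Proof.
move=> zn.
have DR : D `<=` @representatives R l N by move=> w [].
have Zfin : Z \is a fin_num by rewrite ge0_fin_numE ?(ltW Z0).
have zpos : (0 < fine Z)%R by rewrite fine_gt0// Z0 Zoo.
have ms : measurable_fun setT (@sq_deviation R l N x z) by exact: measurable_sq_deviation.
have mBT : measurable_fun setT (@boltzmann R V l N beta m) by exact: measurable_boltzmann.
have zV : (0 <= (fine Z)^-1)%R by rewrite invr_ge0; exact: ltW.
have GE A : measurable A -> gibbs V alpha l beta m A =
    ((fine Z)^-1)%:E * \int[mu]_(w in D `&` A) (B w)%:E.
  move=> _; rewrite /gibbs /partition_function !integral_mu_N//; last exact: subset_trans DR.
  by rewrite -/Z -{1}(fineK Zfin) inver gt_eqF.
have ge0 := integral_density_ge0 mD mBT B0 (sq0 x z) GE.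
have le := integral_density_le mD mBT B0 ms (sq0 x z) zV GE.
apply/andP; split; first exact: ge0.
apply: (le_trans le).
apply: le_trans (lee_wpmul2l _ (integral_deviation_boltzmann x zn)) _; first by rewrite lee_fin.
have VZ : ((fine Z)^-1)%:E * Z = 1.
  by rewrite -[X in _ * X](fineK Zfin) -EFinM mulVf ?lt0r_neq0.
by rewrite -/Z muleCA VZ mule1.
Qed.

End energy_bound.

Lemma pair_energy_eq (R : realType) (alpha : R) (V W : R -> R) (omega : conf R) x z :
  (forall r, 1 - alpha < r < 1 + alpha -> V r = W r) -> edge_lengths alpha omega ->
  z \in nbrs ->
  pair_energy V (omega x) (omega (x + z)) = pair_energy W (omega x) (omega (x + z)).
Proof.
move=> VW el zn; case xp : (omega x) => [p|//]; case yq : (omega (x + z)) => [q|//] /=.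
by apply/VW/(el x (x + z)) => //; apply/adjE; rewrite addrAC subrr add0r.
Qed.

Lemma boltzmann_eq (R : realType) (alpha l : R) (N : nat) (V W : R -> R) beta m w :
  (forall r, 1 - alpha < r < 1 + alpha -> V r = W r) -> @allowed R alpha l N w ->
  boltzmann V l beta m w = boltzmann W l beta m w.
Proof.
move=> VW [_ el _ _ _]; have E : \sum_(x <- box N) \sum_(z <- nbrs)
    pair_energy V (conf_of l w x) (conf_of l w (x + z)) = \sum_(x <- box N) \sum_(z <- nbrs)
    pair_energy W (conf_of l w x) (conf_of l w (x + z)); last first.
  by rewrite /boltzmann /hamiltonian E.
apply: eq_bigr => x _; apply: eq_big_seq => z zn.
exact: pair_energy_eq el zn.
Qed.

(** Allowed configurations see the potential only at edge lengths in the open interval, so it may be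
    exchanged there for a measurable function. *)
Lemma gibbs_eq (R : realType) (alpha l : R) (N : nat) (V W : R -> R) beta m : (0 < N)%N ->
  (forall r, 1 - alpha < r < 1 + alpha -> V r = W r) ->
  @gibbs R V alpha l N beta m = @gibbs R W alpha l N beta m.
Proof.
move=> N0 VW; have E S : S `<=` @allowed R alpha l N ->
    (\int[@mu_N R l N]_(w in S) (boltzmann V l beta m w)%:E =
     \int[@mu_N R l N]_(w in S) (boltzmann W l beta m w)%:E)%E.
  move=> SD; have SR : S `<=` @representatives R l N by move=> w /SD[].
  rewrite !(integral_mu_N _ N0 SR); apply: eq_integral => w /set_mem/SD Dw.
  by rewrite (boltzmann_eq beta m VW Dw).
by apply/funext => A; rewrite /gibbs /partition_function !E// => w [].
Qed.

Lemma measurable_patch_itv (R : realType) (a b : R) (V : R -> R) :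
  (forall r, a < r < b -> {for r, continuous V}) ->
  measurable_fun setT (V \_ `]a, b[).
Proof.
move=> cV; apply/(measurable_restrictT V (measurable_itv `]a, b[)).
apply: open_continuous_measurable_fun; first exact: interval_open.
by move=> r; rewrite inE /= in_itv /= => /cV.
Qed.

(** The member [t] of the index set secures the lower bound, as an empty supremum would be -oo. *)
Lemma ereal_sup_itv (R : realType) (T : Type) (A : set T) (f : T -> \bar R) (a b : \bar R) t :
  A t -> (forall t, A t -> a <= f t <= b)%E -> (a <= ereal_sup (f @` A) <= b)%E.
Proof.
move=> At fab; apply/andP; split.
  have /andP[h _] := fab _ At; apply: (le_trans h).
  by apply: ereal_sup_ubound; exists t.
by apply: ge_ereal_sup => _ [s As <-]; have /andP[] := fab _ As.
Qed.

Lemma cvge0_le (R : realType) (T : Type) (F : set_system T) (FF : Filter F) (f : T -> \bar R) :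
  (forall e : R, 0 < e -> \forall t \near F, (0 <= f t <= e%:E)%E) ->
  f t @[t --> F] --> 0%E.
Proof.
move=> fe; have fin t (e : R) : (0 <= f t <= e%:E)%E -> f t \is a fin_num.
  by move=> /andP[f0 f1]; rewrite ge0_fin_numE// (le_lt_trans f1)// ltry.
apply/fine_cvgP; split.
  by have := fe 1 ltr01; apply: filterS => t /fin.
apply/cvgrPdist_le => e /fe; apply: filterS => t h.
have /andP[f0 f1] := h.
by rewrite /= sub0r normrN ger0_norm ?fine_ge0// -lee_fin fineK// (fin _ _ h).
Qed.

Theorem theorem1p1 (R : realType) (I : set R) (V : R -> R)
    (hV : potential I V) :
  exists alpha0 m0 : R, 0 < alpha0 /\
    forall alpha l : R,
      0 < alpha < alpha0 ->
      alpha < 1 -> [set r | 1 - alpha <= r <= 1 + alpha] `<=` I ->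
      1 - alpha / 2 < l < 1 + alpha / 2 ->
      ereal_sup [set ereal_sup [set ereal_sup [set ereal_sup
          [set mean_sq_deviation V alpha l N beta m x z | z in [set` nbrs]]
        | x in [set: lattice]]
        | m in [set m | m0 <= m]]
        | N in [set N | (5 <= N)%N]]
      @[beta --> +oo] --> 0%E.
Proof.
have [alpha0 [c [M [/andP[a0 a2] c0 est]]]] := potential_estimates hV.
(* Half of the cost 50 c + 12 |V l| + 1236 |k| of a hole, made independent of [alpha] and [l] by |V
   l| <= M and |k| <= c / 192. *)
exists alpha0, (25 * c + 6 * M + 618 * (c / 192)); split=> // alpha l ha _ _ hl.
have [VM [k kc HV] lipV cV] := est alpha l ha hl.
have /andP[al0 ala] := ha; have /andP[l0 l1] := hl.
have aa2 : 0 < alpha <= 2^-1 by rewrite al0 (ltW (lt_le_trans ala a2)).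
(* [V] is arbitrary outside of [I], hence it need not be measurable. *)
pose W := V \_ `]1 - alpha, 1 + alpha[.
have VW r : 1 - alpha < r < 1 + alpha -> V r = W r.
  by move=> hr; rewrite /W patchE mem_set//= in_itv.
have lin : 1 - alpha < l < 1 + alpha by apply/andP; split; lra.
have mW : measurable_fun setT W by exact: measurable_patch_itv.
have HW (r : R) : 1 - alpha < r < 1 + alpha ->
    W l + k * (r ^+ 2 - l ^+ 2) + c * (r - l) ^+ 2 <= W r.
  by move=> hr; rewrite -!VW//; exact: HV.
have lipW (r s : R) : 1 - alpha < r < 1 + alpha -> 1 - alpha < s < 1 + alpha ->
    W r - W s <= `|r - s|.
  by move=> hr hs; rewrite -!VW//; exact: lipV.
have bound (e : R) : 0 < e -> \forall beta \near +oo,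
    forall N m x z, (5 <= N)%N -> 25 * c + 6 * M + 618 * (c / 192) <= m -> z \in nbrs ->
    (0 <= mean_sq_deviation V alpha l N beta m x z <= e%:E)%E.
  move=> e0; pose K := 192 / c; have K0 : 0 < K by rewrite divr_gt0.
  (* Half of [e] is spent on K * eps; the other half bounds 4 K / beta once beta >= 8 K / e. *)
  pose eps := e / (2 * K); have eps0 : 0 < eps by rewrite divr_gt0// mulr_gt0.
  pose delta := Num.min (eps / 96) (Num.min 64^-1 (alpha / 8)).
  have d0 : 0 < delta.
    rewrite /delta !lt_min; apply/and3P; split.
 - by rewrite divr_gt0.
 - by rewrite invr_gt0.
 - by rewrite divr_gt0.
  have d1 : delta <= 64^-1 by rewrite !ge_min lexx orbT.
  have d2 : 4 * delta <= alpha / 2.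
    have : delta <= alpha / 8 by rewrite !ge_min lexx !orbT.
    lra.
  have d3 : 96 * delta <= eps.
    have : delta <= eps / 96 by rewrite !ge_min lexx.
    lra.
  near=> beta => N m x z N5 hm zn.
  have b0 : 0 < beta by near: beta; apply: nbhs_pinfty_gt; rewrite num_real.
  have b1 : 8 * (20 * (1 + 4 * 20 ^+ 2)) / (4 * delta ^+ 2 * eps) <= beta.
    by near: beta; apply: nbhs_pinfty_ge; rewrite num_real.
  have b2 : 8 * K / e <= beta by near: beta; apply: nbhs_pinfty_ge; rewrite num_real.
  have N2 : (1 < N)%N by exact: leq_trans N5.
  have hmW : 50 * c + 12 * `|W l| + 1236 * `|k| <= 2 * m by rewrite -VW//; lra.
  rewrite /mean_sq_deviation (gibbs_eq l beta m (ltnW N2) VW).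
  have /andP[-> h] := mean_sq_deviation_bound N2 aa2 hl mW c0 kc HW lipW hmW
    b0 eps0 d0 d1 d2 d3 b1 x zn.
  rewrite (le_trans h)// lee_fin mulrDr.
  have -> : 192 / c * eps = e / 2 by rewrite /eps -/K; field; rewrite lt0r_neq0.
  have : 192 / c * (4 / beta) <= e / 2.
    by rewrite -/K mulrA ler_pdivrMr//; move: b2; rewrite ler_pdivrMr//; lra.
  lra.
apply: cvge0_le => e /bound; apply: filterS => beta h.
apply: (@ereal_sup_itv _ _ _ _ _ _ 5%N) => // N N5.
apply: (@ereal_sup_itv _ _ _ _ _ _ (25 * c + 6 * M + 618 * (c / 192))) => [|m hm].
  by rewrite /= lexx.
apply: (@ereal_sup_itv _ _ _ _ _ _ (0 : lattice)) => // x _.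
by apply: (@ereal_sup_itv _ _ _ _ _ _ (1, 0)) => // z zn; exact: h.
Unshelve. all: by end_near. Qed.
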